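(* For $p,q\in\mathbb{N}$ and $k_1,\dots,k_p,l_1,\dots,l_q\in\mathbb{N}_0$, we have $$\zeta_p^{\rm des}(-k_1,\dots,-k_p)\,\zeta_q^{\rm des}(-l_1,\dots,-l_q)=\sum_{\substack{i_1+j_1=l_1\\ \vdots\\ i_q+j_q=l_q}}\left(\prod_{a=1}^q(-1)^{i_a}\binom{l_a}{i_a}\right)\zeta_{p+q}^{\rm des}(-k_1,\dots,-k_{p-1},-k_p-i_1-\cdots-i_q,-j_1,\dots,-j_q),$$ where the sum runs over all $i_1,\dots,i_q,j_1,\dots,j_q\in\mathbb{N}_0$ with $i_a+j_a=l_a$ for $1\le a\le q$.
   Context: $\mathbb{N}=\{1,2,\dots\}$ and $\mathbb{N}_0=\{0,1,2,\dots\}$. Desingularized multiple zeta-function: for $r\in\mathbb{N}$ and $c\in\mathbb{R}$ put $$\tilde{\mathfrak{H}}_r(t_1,\dots,t_r;c):=\prod_{j=1}^r\left(\frac{1}{\exp\left(\sum_{k=j}^r t_k\right)-1}-\frac{c}{\exp\left(c\sum_{k=j}^r t_k\right)-1}\right).$$ For non-integral complex numbers $s_1,\dots,s_r$, define $$\zeta_r^{\rm des}(s_1,\dots,s_r):=\lim_{\substack{c\to1\\ c\in\mathbb{R}\setminus\{1\}}}\frac{1}{(1-c)^r}\prod_{k=1}^r\frac{1}{(e^{2\pi i s_k}-1)\Gamma(s_k)}\int_{\mathcal{C}^r}\tilde{\mathfrak{H}}_r(t_1,\dots,t_r;c)\prod_{k=1}^r t_k^{s_k-1}\,dt_k,$$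 where $\mathcal{C}$ is the path consisting of the positive real axis (top side), a circle around the origin of sufficiently small radius $\varepsilon$, and the positive real axis (bottom side). It is known (Furusho–Komori–Matsumoto–Tsumura) that $\zeta_r^{\rm des}$ continues analytically to an entire function on $\mathbb{C}^r$, also denoted $\zeta_r^{\rm des}$. For $k_1,\dots,k_r\in\mathbb{N}_0$, the desingularized value $\zeta_r^{\rm des}(-k_1,\dots,-k_r)$ is the value of this entire function at $(-k_1,\dots,-k_r)$. *)

(* Defs.v *)
From HB Require Import structures.
From mathcomp Require Import all_boot all_order all_algebra.
From mathcomp Require Import complex.
From mathcomp Require Import all_classical all_reals all_analysis.

Set Implicit Arguments.
Unset Strict Implicit.
Unset Printing Implicit Defensive.

Import Order.TTheory GRing.Theory Num.Theory.
Import numFieldNormedType.Exports.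

Local Open Scope classical_set_scope.
Local Open Scope complex_scope.
Local Open Scope ring_scope.

Section zeta_des.
Variable R : realType.
Local Notation C := R[i].

Definition expC (z : C) : C :=
  (expR (complex.Re z))%:C * (cos (complex.Im z) +i* sin (complex.Im z)).

Definition integralC (D : set R) (f : R -> C) : C :=
  (\int[@lebesgue_measure R]_(x in D) complex.Re (f x))
  +i* (\int[@lebesgue_measure R]_(x in D) complex.Im (f x)).

(* Euler's integral for 0 < Re s. *)
Definition Gamma_integral (s : C) : C :=
  integralC `]0, +oo[ (fun x => expC ((s - 1) * (ln x)%:C) * (expR (- x))%:C).

(* Euler's integral continued by Gamma(s) = Gamma(s + n) / (s (s+1) ... (s+n-1));
   the n chosen here satisfies 0 < Re (s + n). The junk value at the poles
   0, -1, -2, ... is never used. *)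
Definition Gamma (s : C) : C :=
  let n := `|Num.floor (complex.Re s)|%N.+1 in
  Gamma_integral (s + n%:R) / \prod_(m < n) (s + m%:R).

(* A point of the contour is a pair (modulus, argument): the top and bottom sides
   of the positive real axis have the arguments 0 and 2 pi. *)
Definition contour_point (x : R * R) : C := x.1%:C * expC (0 +i* x.2).

(* t ^ s for the branch of the logarithm given by the chosen argument of t. *)
Definition contour_power (x : R * R) (s : C) : C := expC (s * (ln x.1 +i* x.2)).

(* From +oo to eps with argument 0, once counterclockwise around the circle of
   radius eps (where dt = i t dtheta), and from eps to +oo with argument 2 pi. *)
Definition contour_integral (eps : R) (F : R * R -> C) : C :=
  - integralC `[eps, +oo[ (fun rho => F (rho, 0))
  + integralC `[0, 2 * pi]
      (fun theta => F (eps, theta) * ((0 +i* 1) * contour_point (eps, theta)))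
  + integralC `[eps, +oo[ (fun rho => F (rho, 2 * pi)).

(* The integral over the r-fold product of the contour, the first variable outermost. *)
Fixpoint contour_integral_iter (eps : R) (r : nat) :
    (r.-tuple (R * R) -> C) -> C :=
  match r with
  | 0 => fun F => F [tuple]
  | r'.+1 => fun F => contour_integral eps (fun x =>
      contour_integral_iter eps (fun xs : r'.-tuple (R * R) => F [tuple of x :: xs]))
  end.

(* On a product of contours with small eps, a partial sum of the t k that is a pole
   of one of the two fractions below is 0, where the poles cancel. Both fractions
   are then 1 / 0 = 0, on a null set that does not affect the integral. *)
Definition H_tilde (r : nat) (t : 'I_r -> C) (c : R) : C :=
  \prod_(j < r)
    (1 / (expC (\sum_(k < r | (j <= k)%N) t k) - 1)
     - c%:C / (expC (c%:C * \sum_(k < r | (j <= k)%N) t k) - 1)).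

Definition zeta_des_approx (r : nat) (eps c : R) (s : 'rV[C]_r) : C :=
  1 / (1 - c%:C) ^+ r
  * (\prod_(k < r) (1 / ((expC ((0 +i* (2 * pi)) * s 0 k) - 1) * Gamma (s 0 k))))
  * contour_integral_iter eps (fun x : r.-tuple (R * R) =>
      H_tilde (fun k => contour_point (tnth x k)) c
      * \prod_(k < r) contour_power (tnth x k) (s 0 k - 1)).

Definition nonintegral (r : nat) (s : 'rV[C]_r) : Prop :=
  forall (k : 'I_r) (n : int), s 0 k != n%:~R.

Definition entire (r : nat) (f : 'rV[C]_r -> C) : Prop :=
  forall s : 'rV[C^o]_r, differentiable (f : 'rV[C^o]_r -> C^o) s.

(* Z is the entire continuation of the contour integral expression. It is unique,
   since the points without integral coordinates are dense in C^r. *)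
Definition is_zeta_des (r : nat) (Z : 'rV[C]_r -> C) : Prop :=
  entire Z /\
  forall s : 'rV[C]_r, nonintegral s ->
    \forall eps \near (0 : R)^'+,
      zeta_des_approx eps c s @[c --> (1 : R)^'] --> (Z s : C^o).

End zeta_des.

(* Main.v *)
Require Import Defs.
From HB Require Import structures.
From mathcomp Require Import all_boot all_order all_algebra.
From mathcomp Require Import complex.
From mathcomp Require Import all_classical all_reals all_analysis.
From mathcomp Require Import measurable_realfun ring lra zify.

(** The value of the desingularized zeta function at (-k_1, ..., -k_r) is a limit of
    multiple power sums, for which the product formula is the binomial theorem.

    With S_j = t_j + ... + t_r, the integrand is, up to the powers of the t_k, the
    product of the factors h_c(S_j), where h_c(z) is
    (1 / (e^z - 1) - c / (e^(c z) - 1)) / (1 - c). For c -> 1 the factor h_c tends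
    to the derivative of z / (e^z - 1). With v = 1 - e^-z and
    z = v + v^2 / 2 + v^3 / 3 + ..., this derivative becomes
    - e^-z (1 / 2 + v / 3 + v^2 / 4 + ...). The truncations of this series are
    exponential sums b_0 e^-z + b_1 e^(-2 z) + .... For large order and c close
    to 1 they differ from h_c(z) by at most a small multiple of e^(-Re z / 2), on a
    half-strip that contains all the S_j when the radius of the contour is small
    ([des_factor1_approx], [des_factor_approx]).

    For an exponential sum the iterated contour integral is computed exactly: as
    the sum of the (m_j + 1) S_j is the sum of the n_k t_k with
    n_k = (m_1 + 1) + ... + (m_k + 1), it splits into products of Hankel integrals,
    and the normalizing factors turn each of them into n_k^(-s_k)
    ([zeta_prefactor_hankel]). Hankel's formula is obtained from the recursion
    s f(s) = n f(s + 1), which the contour integral and the gamma integral share,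
    because a solution that is O(eps^s) vanishes
    ([contour_integral_exp_power_ge1]). Iterated contour integrals are stable under
    perturbations that are small in a weighted norm outside of countably many
    points of each contour, such as those at which some S_j is 0
    ([contour_integral_iter_perturb]).

    Consequently, at the points -k + d with small d > 0, the truncated sums are
    Cauchy uniformly in d and close to the entire function, and d -> 0 shows that
    its value at -k is the limit over the order of the truncation of
    sum_m (prod_j b_(m_j)) prod_a n_a^(k_a) ([zeta_des_value_limit]).

    For these sums let A be the last partial sum of a first index of length p and
    B_1, ..., B_q the partial sums of a second index. The concatenated index has
    the partial sums of the first one followed by A + B_1, ..., A + B_q, and its
    weight is the product of the weights. Expanding B_b^(l_b) = ((A + B_b) - A)^(l_b)
    gives the product formula ([multi_power_sum_mul]), and the order of the
    truncation may tend to infinity in this finite identity. *)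

Set Implicit Arguments.
Unset Strict Implicit.
Unset Printing Implicit Defensive.

Import Order.TTheory GRing.Theory Num.Theory.
Import numFieldNormedType.Exports.

Local Open Scope ring_scope.

(** * Modulus and exponential of complex numbers *)

Section ComplexModulus.
Variable R : realType.
Local Notation C := R[i].
Local Open Scope complex_scope.

Definition cabs (z : C) : R := Normc.normc z.

Lemma Re_add (x y : C) : complex.Re (x + y) = complex.Re x + complex.Re y.
Proof. by case: x; case: y. Qed.

Lemma Im_add (x y : C) : complex.Im (x + y) = complex.Im x + complex.Im y.
Proof. by case: x; case: y. Qed.

Lemma Re_opp (x : C) : complex.Re (- x) = - complex.Re x.
Proof. by case: x. Qed.

Lemma Im_opp (x : C) : complex.Im (- x) = - complex.Im x.
Proof. by case: x. Qed.

Lemma Re_mul (x y : C) : complex.Re (x * y) =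
  complex.Re x * complex.Re y - complex.Im x * complex.Im y.
Proof. by case: x; case: y. Qed.

Lemma Im_mul (x y : C) : complex.Im (x * y) =
  complex.Re x * complex.Im y + complex.Im x * complex.Re y.
Proof. by case: x; case: y => a b c d /=; rewrite [d * a]mulrC. Qed.

Lemma Re_sum (I : Type) (s : seq I) (P : pred I) (f : I -> C) :
  complex.Re (\sum_(i <- s | P i) f i) = \sum_(i <- s | P i) complex.Re (f i).
Proof. by elim/big_rec2: _ => // i x y _ <-; rewrite Re_add. Qed.

Lemma Im_sum (I : Type) (s : seq I) (P : pred I) (f : I -> C) :
  complex.Im (\sum_(i <- s | P i) f i) = \sum_(i <- s | P i) complex.Im (f i).
Proof. by elim/big_rec2: _ => // i x y _ <-; rewrite Im_add. Qed.

Lemma cabsE (z : C) : cabs z = Num.sqrt (complex.Re z ^+ 2 + complex.Im z ^+ 2).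
Proof. by case: z. Qed.

Lemma sqr_cabs (z : C) : cabs z ^+ 2 = complex.Re z ^+ 2 + complex.Im z ^+ 2.
Proof. by rewrite cabsE sqr_sqrtr// addr_ge0// sqr_ge0. Qed.

Lemma normr_cabs (z : C) : `|z| = (cabs z)%:C.
Proof. by rewrite normc_def cabsE. Qed.

Lemma cabs_ge0 (z : C) : 0 <= cabs z.
Proof. by rewrite cabsE sqrtr_ge0. Qed.

Lemma cabs0 : cabs 0 = 0.
Proof. exact: Normc.normc0. Qed.

Lemma cabs1 : cabs 1 = 1.
Proof. exact: Normc.normc1. Qed.

Lemma cabs_eq0 (z : C) : cabs z = 0 -> z = 0.
Proof. exact: Normc.eq0_normc. Qed.

Lemma cabs_gt0 (z : C) : z != 0 -> 0 < cabs z.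
Proof.
move=> z0; rewrite lt_neqAle cabs_ge0 andbT eq_sym.
by apply: contra_neq z0; exact: cabs_eq0.
Qed.

Lemma cabsM (x y : C) : cabs (x * y) = cabs x * cabs y.
Proof. exact: Normc.normcM. Qed.

Lemma cabsV (x : C) : cabs x^-1 = (cabs x)^-1.
Proof. exact: Normc.normcV. Qed.

Lemma cabsN (x : C) : cabs (- x) = cabs x.
Proof. exact: normcN. Qed.

Lemma cabsD (x y : C) : cabs (x + y) <= cabs x + cabs y.
Proof. exact: le_normcD. Qed.

Lemma cabsB (x y : C) : cabs (x - y) <= cabs x + cabs y.
Proof. by rewrite -(cabsN y) cabsD. Qed.

Lemma cabs_real (r : R) : cabs r%:C = `|r|.
Proof. by rewrite cabsE /= expr0n addr0 sqrtr_sqr. Qed.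

Lemma cabsX (x : C) n : cabs (x ^+ n) = cabs x ^+ n.
Proof. by elim: n => [|n IH]; rewrite ?expr0 ?cabs1// !exprS cabsM IH. Qed.

Lemma cabs_prod (I : Type) (s : seq I) (P : pred I) (f : I -> C) :
  cabs (\prod_(i <- s | P i) f i) = \prod_(i <- s | P i) cabs (f i).
Proof.
by elim/big_rec2: _ => [|i x y _ <-]; [rewrite cabs1 | rewrite cabsM].
Qed.

Lemma cabs_sum (I : Type) (s : seq I) (P : pred I) (f : I -> C) :
  cabs (\sum_(i <- s | P i) f i) <= \sum_(i <- s | P i) cabs (f i).
Proof.
elim/big_rec2: _ => [|i x y _ h]; first by rewrite cabs0.
by apply: le_trans (cabsD _ _) _; rewrite lerD2l.
Qed.

Lemma cabs_nat n : cabs n%:R = n%:R.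
Proof. by rewrite -(rmorph_nat (real_complex R)) cabs_real normr_nat. Qed.

Lemma normr_Re_le (z : C) : `|complex.Re z| <= cabs z.
Proof. by rewrite cabsE -sqrtr_sqr ler_wsqrtr// lerDl sqr_ge0. Qed.

Lemma normr_Im_le (z : C) : `|complex.Im z| <= cabs z.
Proof. by rewrite cabsE -sqrtr_sqr ler_wsqrtr// lerDr sqr_ge0. Qed.

Lemma cabs_le (z : C) : cabs z <= `|complex.Re z| + `|complex.Im z|.
Proof.
rewrite -(@ler_pXn2r _ 2)// ?nnegrE ?cabs_ge0 ?addr_ge0//.
rewrite sqr_cabs sqrrD -!normrX (ger0_norm (sqr_ge0 (complex.Re z))).
rewrite (ger0_norm (sqr_ge0 (complex.Im z))) addrAC lerDl.
by rewrite mulrn_wge0// mulr_ge0.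
Qed.

Lemma real_complexM (x y : R) : (x * y)%:C = x%:C * y%:C.
Proof. exact: (rmorphM (real_complex R)). Qed.

Lemma real_complexX (x : R) n : (x ^+ n)%:C = x%:C ^+ n.
Proof. exact: (rmorphXn (real_complex R)). Qed.

Lemma real_complexD (x y : R) : (x + y)%:C = x%:C + y%:C.
Proof. exact: (rmorphD (real_complex R)). Qed.

Lemma real_complexN (x : R) : (- x)%:C = - x%:C.
Proof. exact: (rmorphN (real_complex R)). Qed.

Lemma real_complex_nat n : (n%:R : R)%:C = n%:R.
Proof. exact: (rmorph_nat (real_complex R)). Qed.

Lemma real_complex0 : (0 : R)%:C = 0.
Proof. by []. Qed.

Lemma real_complex1 : (1 : R)%:C = 1.
Proof. by []. Qed.

Lemma real_complex_eq0 (x : R) : (x%:C == 0) = (x == 0).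
Proof. exact: (fmorph_eq0 (real_complex R)). Qed.

End ComplexModulus.

Section ComplexExponential.
Variable R : realType.
Local Notation C := R[i].
Local Open Scope complex_scope.

Lemma expCD (x y : C) : expC (x + y) = expC x * expC y.
Proof.
rewrite /expC Re_add Im_add expRD real_complexM cosD sinD.
case: x y => [a b] [c d] /=; apply/eqP; rewrite eq_complex /=.
by apply/andP; split; apply/eqP; ring.
Qed.

Lemma expC_real (r : R) : expC r%:C = (expR r)%:C.
Proof. by rewrite /expC /= cos0 sin0 mulr1. Qed.

Lemma expC0 : expC 0 = 1 :> C.
Proof. by rewrite (_ : 0 = (0 : R)%:C)// expC_real expR0. Qed.

Lemma cabs_expC (z : C) : cabs (expC z) = expR (complex.Re z).
Proof.
rewrite /expC cabsM cabs_real ger0_norm ?expR_ge0// [cabs (_ +i* _)]cabsE /=.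
by rewrite cos2Dsin2 sqrtr1 mulr1.
Qed.

Lemma expC_neq0 (z : C) : expC z != 0.
Proof.
apply/eqP => /(congr1 (@cabs R)); rewrite cabs_expC cabs0 => /eqP.
by rewrite expR_eq0.
Qed.

Lemma expCN (z : C) : expC (- z) = (expC z)^-1.
Proof.
apply: (mulIf (expC_neq0 z)); rewrite -expCD addNr expC0.
by rewrite mulVf// expC_neq0.
Qed.

Lemma expC_sum (I : Type) (s : seq I) (P : pred I) (f : I -> C) :
  expC (\sum_(i <- s | P i) f i) = \prod_(i <- s | P i) expC (f i).
Proof.
by elim/big_rec2: _ => [|i x y _ <-]; [rewrite expC0 | rewrite expCD].
Qed.

Lemma expCMn (z : C) n : expC (n%:R * z) = expC z ^+ n.
Proof.
elim: n => [|n IH]; first by rewrite mul0r expC0.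
by rewrite -natr1 mulrDl mul1r expCD IH exprSr.
Qed.

End ComplexExponential.

(** * Complex-valued functions of a real variable *)

Section RealVariable.
Variable R : realType.
Local Notation C := R[i].
Local Open Scope complex_scope.

Implicit Types (f g : R -> C) (x : R) (df dg : C).

(** Componentwise differentiation is enough for mean value bounds and for the
    fundamental theorem of calculus. *)
Definition cderiv (f : R -> C) (x : R) (d : C) : Prop :=
  is_derive x 1 (fun t => complex.Re (f t)) (complex.Re d) /\
  is_derive x 1 (fun t => complex.Im (f t)) (complex.Im d).

Lemma cderiv_ext (f g : R -> C) x d d' :
  f =1 g -> d = d' -> cderiv f x d -> cderiv g x d'.
Proof. by move=> /funext -> ->. Qed.

Lemma cderiv_cst (c : C) x : cderiv (fun=> c) x 0.
Proof. by split; exact: is_derive_cst. Qed.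

Lemma cderiv_real (f : R -> R) (x d : R) :
  is_derive x 1 f d -> cderiv (fun t => (f t)%:C) x d%:C.
Proof. by move=> h; split => //; exact: is_derive_cst. Qed.

Lemma cderivD f g x df dg : cderiv f x df -> cderiv g x dg ->
  cderiv (fun t => f t + g t) x (df + dg).
Proof.
move=> [f1 f2] [g1 g2]; split.
  under eq_fun do rewrite Re_add; rewrite Re_add; exact: is_deriveD.
under eq_fun do rewrite Im_add; rewrite Im_add; exact: is_deriveD.
Qed.

Lemma cderivN f x df : cderiv f x df -> cderiv (fun t => - f t) x (- df).
Proof.
move=> [f1 f2]; split.
  under eq_fun do rewrite Re_opp; rewrite Re_opp; exact: is_deriveN.
under eq_fun do rewrite Im_opp; rewrite Im_opp; exact: is_deriveN.
Qed.

Lemma cderivM f g x df dg : cderiv f x df -> cderiv g x dg ->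
  cderiv (fun t => f t * g t) x (df * g x + f x * dg).
Proof.
move=> [f1 f2] [g1 g2]; split.
  under eq_fun do rewrite Re_mul; rewrite Re_add !Re_mul.
  have h := is_deriveB (is_deriveM f1 g1) (is_deriveM f2 g2).
  apply: (is_derive_eq h).
  by rewrite /GRing.scale /=; ring.
under eq_fun do rewrite Im_mul; rewrite Im_add !Im_mul.
have h := is_deriveD (is_deriveM f1 g2) (is_deriveM f2 g1).
apply: (is_derive_eq h).
by rewrite /GRing.scale /=; ring.
Qed.

Lemma cderivZ (c : C) f x df : cderiv f x df ->
  cderiv (fun t => c * f t) x (c * df).
Proof.
move=> h; apply: cderiv_ext (cderivM (cderiv_cst c x) h) => //.
by rewrite mul0r add0r.
Qed.

Lemma cderivX f x df n : cderiv f x df ->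
  cderiv (fun t => f t ^+ n.+1) x (n.+1%:R * f x ^+ n * df).
Proof.
move=> h; elim: n => [|n IH].
  by apply: cderiv_ext h => //; rewrite expr0 !mul1r.
apply: cderiv_ext (cderivM h IH) => [t|]; first by rewrite [RHS]exprS.
by rewrite -[in RHS]natr1 exprS; ring.
Qed.

Lemma cderiv_sum (I : Type) (s : seq I) (f : I -> R -> C) x (df : I -> C) :
  (forall i, cderiv (f i) x (df i)) ->
  cderiv (fun t => \sum_(i <- s) f i t) x (\sum_(i <- s) df i).
Proof.
move=> h; elim: s => [|i s IH].
  by apply: cderiv_ext (cderiv_cst 0 x) => [t|]; rewrite big_nil.
by apply: cderiv_ext (cderivD (h i) IH) => [t|]; rewrite big_cons.
Qed.

Lemma cderivV f x df : f x != 0 -> cderiv f x df ->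
  cderiv (fun t => (f t)^-1) x (- df / f x ^+ 2).
Proof.
move=> fx0 [f1 f2].
have n0 : complex.Re (f x) ^+ 2 + complex.Im (f x) ^+ 2 != 0.
  by rewrite -sqr_cabs expf_neq0// gt_eqF// cabs_gt0.
have ReV (z : C) : complex.Re z^-1 =
    complex.Re z / (complex.Re z ^+ 2 + complex.Im z ^+ 2) by case: z.
have ImV (z : C) : complex.Im z^-1 =
    - complex.Im z / (complex.Re z ^+ 2 + complex.Im z ^+ 2).
  by case: z => a b /=; rewrite mulNr.
have hn : is_derive x 1
    (fun t => complex.Re (f t) ^+ 2 + complex.Im (f t) ^+ 2)
    (2 * complex.Re (f x) * complex.Re df + 2 * complex.Im (f x) * complex.Im df).
  under eq_fun do rewrite !expr2.
  have h := is_deriveD (is_deriveM f1 f1) (is_deriveM f2 f2).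
  apply: (is_derive_eq h).
  by rewrite /GRing.scale /=; ring.
have hv := @is_deriveV _ (fun t => complex.Re (f t) ^+ 2 + complex.Im (f t) ^+ 2)
   x _ 1 n0 hn.
have Rew : complex.Re (- df / f x ^+ 2) =
   (complex.Re df * (complex.Im (f x) ^+ 2 - complex.Re (f x) ^+ 2)
    - 2 * complex.Re (f x) * complex.Im (f x) * complex.Im df)
    / (complex.Re (f x) ^+ 2 + complex.Im (f x) ^+ 2) ^+ 2.
  rewrite -exprVn expr2 mulrA !(Re_mul, Im_mul, ReV, ImV, Re_opp, Im_opp).
  by field.
have Imw : complex.Im (- df / f x ^+ 2) =
   (2 * complex.Re (f x) * complex.Im (f x) * complex.Re df
    + complex.Im df * (complex.Im (f x) ^+ 2 - complex.Re (f x) ^+ 2))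
    / (complex.Re (f x) ^+ 2 + complex.Im (f x) ^+ 2) ^+ 2.
  rewrite -exprVn expr2 mulrA !(Re_mul, Im_mul, ReV, ImV, Re_opp, Im_opp).
  by field.
split.
  under eq_fun do rewrite ReV; rewrite Rew.
  have h := is_deriveM f1 hv.
  apply: (is_derive_eq h).
  by rewrite /GRing.scale /=; field.
under eq_fun do rewrite ImV; rewrite Imw.
have h := is_deriveM (is_deriveN f2) hv.
apply: (is_derive_eq h); rewrite /GRing.scale /=.
by rewrite -[(- _) x]/(- complex.Im (f x)); field.
Qed.

Lemma cderiv_expC f x df : cderiv f x df ->
  cderiv (fun t => expC (f t)) x (df * expC (f x)).
Proof.
move=> [f1 f2].
have he := is_derive1_comp (is_derive_expR (complex.Re (f x))) f1.
have hc := is_derive1_comp (is_derive_cos (complex.Im (f x))) f2.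
have hs := is_derive1_comp (is_derive_sin (complex.Im (f x))) f2.
split.
  rewrite (_ : (fun t => _) = (fun t => expR (complex.Re (f t))) *
      (fun t => cos (complex.Im (f t)))); last first.
    by apply/funext => t; rewrite /expC Re_mul /= mul0r subr0.
  have h := is_deriveM he hc.
  apply: (is_derive_eq h).
  rewrite /expC !(Re_mul, Im_mul) /= /GRing.scale /=; ring.
rewrite (_ : (fun t => _) = (fun t => expR (complex.Re (f t))) *
    (fun t => sin (complex.Im (f t)))); last first.
  by apply/funext => t; rewrite /expC Im_mul /= mul0r addr0.
have h := is_deriveM he hs.
apply: (is_derive_eq h).
rewrite /expC !(Re_mul, Im_mul) /= /GRing.scale /=; ring.
Qed.

Lemma cderiv_continuous f x d : cderiv f x d ->
  {for x, continuous (fun t => complex.Re (f t))} /\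
  {for x, continuous (fun t => complex.Im (f t))}.
Proof.
by move=> [[h1 _] [h2 _]]; split; apply: differentiable_continuous;
  apply/derivable1_diffP.
Qed.

(** Mean value inequality; the factor 2 comes from treating the real and
    imaginary parts separately. *)
Lemma cderiv_bound (f df : R -> C) (a b M : R) : a <= b ->
  (forall t, a <= t <= b -> cderiv f t (df t)) ->
  (forall t, a <= t <= b -> cabs (df t) <= M) ->
  cabs (f b - f a) <= 2 * M * (b - a).
Proof.
move=> ab hd hM.
have part (g dg : R -> R) :
    (forall t, a <= t <= b -> is_derive t 1 g (dg t)) ->
    (forall t, a <= t <= b -> `|dg t| <= M) -> `|g b - g a| <= M * (b - a).
  move=> hg hgM.
  have [] := @MVT_segment R g dg a b ab.
  - by move=> x /andP[/ltW ax /ltW xb]; apply: hg; rewrite ax.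
  - apply: derivable_within_continuous => x; rewrite in_itv /= => /hg[].
    by move=> ? _.
  move=> c; rewrite in_itv /= => /hgM hc ->.
  by rewrite normrM [`|b - a|]ger0_norm ?ler_wpM2r ?subr_ge0.
apply: le_trans (cabs_le _) _; rewrite Re_add Re_opp Im_add Im_opp.
rewrite -mulrA mulr_natl mulr2n; apply: lerD.
  apply: (part (fun t => complex.Re (f t)) (fun t => complex.Re (df t))).
    by move=> t /hd[].
  by move=> t /hM; exact/le_trans/normr_Re_le.
apply: (part (fun t => complex.Im (f t)) (fun t => complex.Im (df t))).
  by move=> t /hd[].
by move=> t /hM; exact/le_trans/normr_Im_le.
Qed.

End RealVariable.

(** * Approximation of the integrand by exponential sums *)

Section FactorApproximation.
Variable R : realType.
Local Notation C := R[i].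
Local Open Scope classical_set_scope.
Local Open Scope complex_scope.
Local Open Scope ring_scope.
Local Notation "z .re" := (complex.Re z) (at level 2, format "z .re").
Local Notation "z .im" := (complex.Im z) (at level 2, format "z .im").
Implicit Types (z w : C) (t x y : R).

(** A half-strip that contains every sum of points of a small contour. It is
    narrow enough for |1 - e^-z| <= 1 to hold on it. *)
Definition half_strip z : Prop := - 4^-1 <= z.re /\ `|z.im| <= 4^-1.

(** The local parameter 1 - e^-z, in which the factors of the integrand have
    power series that still converge on the half-strip. *)
Definition one_sub_exp z : C := 1 - expC (- z).

Lemma one_sub_exp0 : one_sub_exp 0 = 0.
Proof. by rewrite /one_sub_exp oppr0 expC0 subrr. Qed.

Lemma expR_quarter : expR 4^-1 <= 4 / 3 :> R.
Proof.
have h := expR_ge1Dx (- 4^-1 : R).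
rewrite -[expR _]invrK -expRN.
by rewrite -[leRHS]invrK lef_pV2 ?posrE ?expR_gt0//; lra.
Qed.

Lemma expR_half_strip (s x : R) : 0 <= s <= 1 -> - 4^-1 <= x ->
  expR (- (s * x)) <= 4 / 3.
Proof.
move=> /andP[s0 s1] hx; apply: le_trans expR_quarter; rewrite ler_expR.
nra.
Qed.

Lemma half_strip_scale t z : 0 <= t <= 1 -> half_strip z -> half_strip (t%:C * z).
Proof.
move=> /andP[t0 t1] [h1 h2]; rewrite /half_strip Re_mul Im_mul /= !mul0r subr0 addr0.
split; first by nra.
rewrite normrM (ger0_norm t0); apply: le_trans h2.
by rewrite ler_piMl.
Qed.

Lemma cos_ge1B y : 1 - `|y| <= cos y.
Proof.
wlog y0 : y / 0 <= y => [h|].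
  have [/h//|/ltW yN] := leP 0 y.
  by rewrite -normrN -cosN; apply: h; rewrite oppr_ge0.
rewrite (ger0_norm y0).
have [] := @MVT_segment R (@cos R) (fun x => - sin x) 0 y y0.
  by apply: continuous_subspaceT => x; exact: continuous_cos.
move=> c _; rewrite cos0 subr0 => hc.
have := sin_le1 c; nra.
Qed.

Lemma cabs_one_sub_exp z : half_strip z ->
  cabs (one_sub_exp z) ^+ 2 <= 1 - expR (- z.re) / 6.
Proof.
move=> [h1 h2]; have hc := cos_ge1B (z.im).
have he : expR (- z.re) <= 4 / 3.
  by rewrite -[z.re]mul1r; apply: expR_half_strip => //; rewrite ler01 lexx.
have e0 := expR_gt0 (- z.re).
rewrite sqr_cabs /one_sub_exp Re_add Im_add Re_opp Im_opp /expC Re_mul Im_mul /= !mul0r subr0 addr0.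
rewrite Re_opp Im_opp cosN sinN.
have cs := cos2Dsin2 (z.im).
set e := expR _ in he e0 *; set c := cos _ in hc cs *; set s := sin _ in cs *.
have -> : (1 - e * c) ^+ 2 + (0 - e * - s) ^+ 2 =
   1 - 2 * e * c + e ^+ 2 * (c ^+ 2 + s ^+ 2) by ring.
by rewrite cs; nra.
Qed.

Lemma cabs_one_sub_exp_le1 z : half_strip z -> cabs (one_sub_exp z) <= 1.
Proof.
move=> hz; rewrite -(@ler_pXn2r _ 2)// ?nnegrE ?cabs_ge0 ?ler01// expr1n.
apply: le_trans (cabs_one_sub_exp hz) _.
by rewrite gerBl divr_ge0 ?expR_ge0.
Qed.

Lemma cderiv_exp_ray z t :
  cderiv (fun t => expC (- (t%:C * z))) t (- z * expC (- (t%:C * z))).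
Proof.
apply: cderiv_expC.
apply: (@cderiv_ext _ (fun t => - z * t%:C) _ _ (- z * 1)) => [s||].
- by rewrite mulNr mulrC.
- by rewrite mulr1.
- by apply: cderivZ; apply: cderiv_real; exact: is_derive_id.
Qed.

Lemma cderiv_one_sub_exp_ray z t :
  cderiv (fun t => one_sub_exp (t%:C * z)) t (z * expC (- (t%:C * z))).
Proof.
apply: cderiv_ext (cderivD (cderiv_cst 1 t) (cderivN (cderiv_exp_ray z t))) => //.
by rewrite add0r mulNr opprK.
Qed.

Lemma cabs_one_sub_exp_linear z : half_strip z -> cabs (one_sub_exp z) <= 3 * cabs z.
Proof.
move=> hz.
have := @cderiv_bound _ (fun t => one_sub_exp (t%:C * z))
   (fun t => z * expC (- (t%:C * z))) 0 1 (4 / 3 * cabs z) ler01.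
cbv beta; rewrite real_complex1 real_complex0 mul1r mul0r one_sub_exp0 !subr0 mulr1 => h.
apply: le_trans (h _ _) _; last by have := cabs_ge0 z; lra.
  by move=> t _; exact: cderiv_one_sub_exp_ray.
move=> t t01; rewrite cabsM mulrC ler_wpM2r ?cabs_ge0// cabs_expC.
have [h1 _] := half_strip_scale t01 hz.
by rewrite Re_opp -[X in - X]mul1r; apply: expR_half_strip => //; rewrite ler01 lexx.
Qed.

(** Remainder of z = sum_{n >= 1} v^n / n with v = 1 - e^-z. *)
Definition log_remainder N z : C :=
  z - \sum_(n < N) one_sub_exp z ^+ n.+1 / n.+1%:R.

(** Along the ray t z the remainder has the derivative z v(t z)^N, because the
    geometric sum of the derivatives telescopes. *)
Lemma log_remainder_bound N z B :
  (forall t, 0 <= t <= 1 -> cabs (one_sub_exp (t%:C * z)) ^+ N <= B) ->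
  cabs (log_remainder N z) <= 2 * B * cabs z.
Proof.
move=> hB.
have r0 : log_remainder N 0 = 0.
  rewrite /log_remainder big1 ?subrr// => i _.
  by rewrite one_sub_exp0 expr0n /= mul0r.
have := @cderiv_bound _ (fun t => log_remainder N (t%:C * z))
   (fun t => z * one_sub_exp (t%:C * z) ^+ N) 0 1 (B * cabs z) ler01.
cbv beta; rewrite real_complex1 real_complex0 mul1r mul0r r0 !subr0 mulr1 mulrA; apply; last first.
  move=> t /hB h; rewrite cabsM cabsX mulrC.
  by rewrite ler_wpM2r ?cabs_ge0.
move=> t _; rewrite /log_remainder.
have hs : cderiv (fun t => \sum_(n < N) one_sub_exp (t%:C * z) ^+ n.+1 / n.+1%:R) t
   (\sum_(n < N) one_sub_exp (t%:C * z) ^+ n * (z * expC (- (t%:C * z)))).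
  apply: (@cderiv_sum _ _ _ (fun (n : 'I_N) s =>
     one_sub_exp (s%:C * z) ^+ n.+1 / n.+1%:R)) => n.
  apply: cderiv_ext (cderivZ n.+1%:R^-1 (cderivX n (cderiv_one_sub_exp_ray z t))).
    by move=> s; rewrite mulrC.
  by rewrite !mulrA mulVf ?mul1r// pnatr_eq0.
apply: cderiv_ext (cderivD (cderivZ z (cderiv_real (is_derive_id t 1))) (cderivN hs)).
  by move=> s; rewrite mulrC.
rewrite -mulr_suml; set v := one_sub_exp _.
have -> : expC (- (t%:C * z)) = 1 - v by rewrite /v /one_sub_exp; ring.
have := subrX1 v N; set S := \sum_(i < N) _ => hS.
have {}hS : v ^+ N = 1 + (v - 1) * S by rewrite -hS; ring.
by rewrite hS; ring.
Qed.

(** One factor of the integrand, together with its share of 1 / (1 - c)^r. *)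
Definition des_factor (c : R) z : C :=
  1 / (1 - c%:C) * (1 / (expC z - 1) - c%:C / (expC (c%:C * z) - 1)).

(** Derivative of z / (e^z - 1), the limit of [des_factor c z] for c -> 1. *)
Definition des_factor1 z : C :=
  expC (- z) * (one_sub_exp z - z) / one_sub_exp z ^+ 2.

(** Truncation of the expansion of [des_factor1] in powers of 1 - e^-z, seen
    as a polynomial in e^-z; the factor e^-z gives the decay. *)
Definition des_poly N : {poly C} := - \sum_(n < N) (n.+2%:R^-1 *: (1 - 'X) ^+ n).

Definition des_approx N z : C := expC (- z) * (des_poly N).[expC (- z)].

Lemma des_approxE N z : des_approx N z =
  - expC (- z) * \sum_(n < N) one_sub_exp z ^+ n / n.+2%:R.
Proof.
rewrite /des_approx /des_poly hornerN mulrN mulNr; congr (- (_ * _)).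
rewrite horner_sum; apply: eq_bigr => n _.
by rewrite !hornerE mulrC.
Qed.

Lemma des_factor1_sub_approx N z : one_sub_exp z != 0 ->
  des_factor1 z - des_approx N z =
  - expC (- z) * log_remainder N.+1 z / one_sub_exp z ^+ 2.
Proof.
move=> v0; rewrite des_approxE /des_factor1 /log_remainder big_ord_recl /=.
set v := one_sub_exp z in v0 *; set u := expC _.
have -> : \sum_(i < N) v ^+ (bump 0 i).+1 / (bump 0 i).+1%:R =
   v ^+ 2 * \sum_(n < N) v ^+ n / n.+2%:R.
  by rewrite mulr_sumr; apply: eq_bigr => i _; rewrite /bump /= add1n mulrA -exprD.
by rewrite expr1 divr1; field.
Qed.

Lemma des_approx_bound N z : half_strip z ->
  cabs (des_approx N z) <= N%:R * expR (- z.re).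
Proof.
move=> hz; rewrite des_approxE cabsM cabsN cabs_expC Re_opp mulrC.
rewrite ler_wpM2r ?expR_ge0//; apply: le_trans (cabs_sum _ _ _) _.
rewrite -[N in leRHS]card_ord -sum1_card natr_sum; apply: ler_sum => n _.
rewrite cabsM cabsX cabsV cabs_nat mulr_ile1 ?exprn_ge0 ?cabs_ge0//.
- by rewrite exprn_ile1// ?cabs_ge0// cabs_one_sub_exp_le1.
- by rewrite invf_le1// ler1n.
Qed.

Lemma expR_weight (b1 b2 x : R) : b2 <= b1 -> b1 <= b2 + 1 -> - 4^-1 <= x ->
  expR (- (b1 * x)) <= 4 / 3 * expR (- (b2 * x)).
Proof.
move=> h1 h2 hx.
have -> : - (b1 * x) = - ((b1 - b2) * x) - b2 * x by ring.
by rewrite expRD ler_wpM2r ?expR_ge0// expR_half_strip//; lra.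
Qed.

Lemma half_strip_cabs z : half_strip z -> cabs z <= z.re + 1.
Proof.
move=> [h1 h2]; apply: le_trans (cabs_le z) _.
have : `|z.re| <= z.re + 2^-1.
  by have [h|h] := lerP 0 z.re; [rewrite ger0_norm|rewrite ltr0_norm]; lra.
lra.
Qed.

Lemma exprn_eventually_le (q e : R) : 0 <= q < 1 -> 0 < e ->
  exists N, forall n, (N <= n)%N -> q ^+ n <= e.
Proof.
move=> /andP[q0 q1] e0.
have : q ^+ n @[n --> \oo] --> 0 by apply: cvg_expr; rewrite ger0_norm.
move=> /cvgrPdist_le /(_ e e0)[N _ hN]; exists N => n Nn.
by have := hN n Nn; rewrite sub0r normrN ger0_norm// exprn_ge0.
Qed.

(** Bounded part of the half-strip: there |1 - e^-z| stays away from 1. *)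
Lemma cabs_one_sub_exp_lt1 (X : R) : 0 <= X ->
  exists2 q : R, 0 <= q < 1 & forall z t, half_strip z -> z.re <= X ->
    0 <= t <= 1 -> cabs (one_sub_exp (t%:C * z)) <= q.
Proof.
move=> X0; exists (Num.sqrt (1 - expR (- X) / 6)).
  rewrite sqrtr_ge0 /= -[X in _ < X]sqrtr1 ltr_sqrt ?ltr01//.
  by rewrite gtrBl divr_gt0 ?expR_gt0.
move=> z t hz zX t01; have hw := half_strip_scale t01 hz.
rewrite -[leLHS]ger0_norm ?cabs_ge0// -sqrtr_sqr ler_wsqrtr//.
apply: le_trans (cabs_one_sub_exp hw) _.
rewrite lerD2l lerN2 ler_pM2r ?invr_gt0// ler_expR lerN2 Re_mul /= mul0r subr0.
move: t01 => /andP[t0 t1]; nra.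
Qed.

(** In the expansion of z in powers of 1 - e^-z the remainder is at most half as
    large as z, and the partial sum is bounded by a multiple of 1 - e^-z. *)
Lemma cabs_le_one_sub_exp (X : R) : 0 <= X ->
  exists2 K : R, 0 < K & forall z, half_strip z -> z.re <= X ->
    cabs z <= K * cabs (one_sub_exp z).
Proof.
move=> X0; have [q q01 hq] := cabs_one_sub_exp_lt1 X0.
have h4 : 0 < 4^-1 :> R by [].
have [N hN] := exprn_eventually_le q01 h4.
exists (2 * N.+1%:R); first by rewrite mulr_gt0.
move=> z hz zX.
have hr : cabs (log_remainder N.+1 z) <= 2 * 4^-1 * cabs z.
  apply: log_remainder_bound => t t01.
  apply: le_trans (hN N.+1 (leqnSn N)).
  by rewrite lerXn2r ?nnegrE ?cabs_ge0//; [case/andP: q01|exact: hq].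
have hs : cabs (\sum_(n < N.+1) one_sub_exp z ^+ n.+1 / n.+1%:R) <=
    N.+1%:R * cabs (one_sub_exp z).
  apply: le_trans (cabs_sum _ _ _) _.
  rewrite mulrC -[N.+1 in leRHS]card_ord -sum1_card natr_sum mulr_sumr.
  apply: ler_sum => n _; rewrite mulr1 cabsM cabsX cabsV cabs_nat exprS -mulrA.
  rewrite ler_piMr ?cabs_ge0// mulr_ile1 ?exprn_ge0 ?cabs_ge0 ?invr_ge0//.
    by rewrite exprn_ile1 ?cabs_ge0// cabs_one_sub_exp_le1.
  by rewrite invf_le1// ler1n.
have : cabs z <= cabs (log_remainder N.+1 z) +
    cabs (\sum_(n < N.+1) one_sub_exp z ^+ n.+1 / n.+1%:R).
  by rewrite -[X in cabs X <= _](subrK (\sum_(n < N.+1) one_sub_exp z ^+ n.+1 / n.+1%:R)) cabsD.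
lra.
Qed.

Lemma one_sub_exp_neq0 z : half_strip z -> z != 0 -> one_sub_exp z != 0.
Proof.
move=> hz z0.
have X0 : 0 <= Num.max 0 z.re by rewrite le_max lexx.
have [K K0 /(_ z hz)] := cabs_le_one_sub_exp X0.
rewrite le_max lexx orbT => /(_ isT) h.
apply: contraTneq h => ->; rewrite cabs0 mulr0 -ltNge; exact: cabs_gt0.
Qed.

Lemma expC_sub1_neq0 z : half_strip z -> z != 0 -> expC z - 1 != 0.
Proof.
move=> hz z0; have -> : expC z - 1 = expC z * one_sub_exp z.
  by rewrite /one_sub_exp mulrBr -expCD subrr expC0 mulr1.
by rewrite mulf_neq0 ?expC_neq0// one_sub_exp_neq0.
Qed.

(** The two regimes: far to the right the decay of e^-z wins, and on the
    bounded part the remainder is geometrically small, uniformly near 0 because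
    1 - e^-z and z are comparable there. *)
Lemma des_factor1_approx (e : R) : 0 < e ->
  exists N0, forall N, (N0 <= N)%N -> forall z, half_strip z -> z != 0 ->
    cabs (des_factor1 z - des_approx N z) <= e * expR (- (3 / 4 * z.re)).
Proof.
(* Beyond X the part e^(-Re z / 4) of the decay e^(-Re z) that is given up outweighs
   the linear growth of the remainder and the constant 1 / e. *)
move=> e0; pose X := 1 + 512 / e.
have X1 : 1 <= X by rewrite lerDl; apply: divr_ge0; [exact: ler0n|exact: ltW].
have [q q01 hq] := cabs_one_sub_exp_lt1 (le_trans ler01 X1).
have [q0 q1] := andP q01.
have [K K0 hK] := cabs_le_one_sub_exp (le_trans ler01 X1).
(* The remainder is O(q^N z^3), so that dividing by (1 - e^-z)^2 leaves O(q^N). *)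
pose e' := e * expR (- (3 / 4 * X)) / (24 * K ^+ 2 * (X + 1)).
have e'0 : 0 < e'.
  by rewrite divr_gt0 ?mulr_gt0 ?expR_gt0 ?exprn_gt0//; lra.
have [N1 hN1] := exprn_eventually_le q01 e'0.
exists N1.+1 => -[//|N] hN z hz z0.
have v0 := one_sub_exp_neq0 hz z0.
have v0' := cabs_gt0 v0.
rewrite des_factor1_sub_approx// !cabsM cabsN cabsV cabsX cabs_expC Re_opp.
rewrite ler_pdivrMr ?exprn_gt0//.
have hzn := half_strip_cabs hz.
have zn0 := cabs_ge0 z.
have [zX|/ltW zX] := lerP z.re X; last first.
  have hr : cabs (log_remainder N.+2 z) <= 2 * 1 * cabs z.
    apply: log_remainder_bound => t t01.
    by rewrite exprn_ile1 ?cabs_ge0// cabs_one_sub_exp_le1//; exact: half_strip_scale.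
  have hv : 2^-1 <= cabs (one_sub_exp z).
    have h : 1 <= cabs (one_sub_exp z) + expR (- z.re).
      by rewrite -Re_opp -cabs_expC -(@cabs1 R) -[X in cabs X](subrK (expC (- z))) cabsD.
    have h2 : expR (- z.re) <= 2^-1.
      rewrite expRN lef_pV2 ?posrE ?expR_gt0//.
      by apply: le_trans (expR_ge1Dx _); lra.
    lra.
  have hx : 1 + (z.re / 4) ^+ 2 / 2 <= expR (z.re / 4).
    have := @expR_ge1Dxn R (z.re / 4) 1; rewrite /factorial /= muln1; apply.
    by rewrite divr_ge0//; lra.
  have -> : expR (- z.re) = expR (- (z.re / 4)) * expR (- (3 / 4 * z.re)).
    by rewrite -expRD; congr expR; lra.
  rewrite mulrAC [leRHS]mulrAC ler_wpM2r ?expR_ge0//.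
  have e4 := expR_gt0 (z.re / 4).
  rewrite expRN mulrC ler_pdivrMr//.
  have h8 : 512 <= e * (z.re - 1).
    by rewrite mulrC -ler_pdivrMr//; move: zX; rewrite /X; lra.
  have h9 : 4^-1 <= cabs (one_sub_exp z) ^+ 2 by nra.
  have h10 : 8 * (z.re + 1) <= e * expR (z.re / 4).
    have : e * (1 + (z.re / 4) ^+ 2 / 2) <= e * expR (z.re / 4) by rewrite ler_pM2l.
    have : 512 * z.re <= e * (z.re - 1) * z.re by nra.
    nra.
  have h11 : e * cabs (one_sub_exp z) ^+ 2 * expR (z.re / 4) =
    (e * expR (z.re / 4)) * cabs (one_sub_exp z) ^+ 2 by ring.
  rewrite h11; apply: le_trans hr _.
  have : 8 * (z.re + 1) * 4^-1 <= e * expR (z.re / 4) * cabs (one_sub_exp z) ^+ 2.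
    by apply: ler_pM => //; lra.
  lra.
have hr : cabs (log_remainder N.+2 z) <= 2 * (q ^+ N * (9 * cabs z ^+ 2)) * cabs z.
  apply: log_remainder_bound => t t01.
  rewrite -addn2 exprD; apply: ler_pM; rewrite ?exprn_ge0 ?cabs_ge0//.
    by rewrite lerXn2r ?nnegrE ?cabs_ge0//; exact: hq.
  have := cabs_one_sub_exp_linear (half_strip_scale t01 hz).
  rewrite cabsM cabs_real => h.
  have {h} : cabs (one_sub_exp (t%:C * z)) <= 3 * cabs z.
    apply: le_trans h _; rewrite ler_pM2l// ler_piMl// ger0_norm; by case/andP: t01.
  move=> h; have := lerXn2r 2 (cabs_ge0 _) (mulr_ge0 (ler0n R 3) zn0) h.
  by rewrite exprMn; lra.
have hu : expR (- z.re) <= 4 / 3.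
  rewrite -[z.re]mul1r; apply: expR_half_strip; rewrite ?ler01 ?lexx//.
  by case: hz.
have hz2 : cabs z ^+ 2 <= K ^+ 2 * cabs (one_sub_exp z) ^+ 2.
  rewrite -exprMn lerXn2r ?nnegrE ?mulr_ge0 ?cabs_ge0 ?(ltW K0)//.
  exact: hK.
have hqN := hN1 N hN.
have qN0 : 0 <= q ^+ N by rewrite exprn_ge0.
have hfin : q ^+ N * (24 * K ^+ 2 * (X + 1)) <= e * expR (- (3 / 4 * X)).
  by rewrite -ler_pdivlMr// ?mulr_gt0 ?exprn_gt0//; lra.
have hw : expR (- (3 / 4 * X)) <= expR (- (3 / 4 * z.re)).
  by rewrite ler_expR lerN2 ler_pM2l.
apply: (@le_trans _ _ (4 / 3 * (2 * (q ^+ N * (9 * cabs z ^+ 2)) * cabs z))).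
  by apply: ler_pM; rewrite ?expR_ge0 ?cabs_ge0.
have -> : 4 / 3 * (2 * (q ^+ N * (9 * cabs z ^+ 2)) * cabs z) =
  24 * (q ^+ N) * cabs z * cabs z ^+ 2 by field.
apply: (@le_trans _ _ (24 * q ^+ N * (X + 1) * (K ^+ 2 * cabs (one_sub_exp z) ^+ 2))).
  apply: ler_pM => //; rewrite ?mulr_ge0 ?exprn_ge0//.
  by rewrite ler_wpM2l ?mulr_ge0//; lra.
rewrite mulrA ler_wpM2r ?exprn_ge0 ?cabs_ge0//.
have -> : 24 * q ^+ N * (X + 1) * K ^+ 2 = q ^+ N * (24 * K ^+ 2 * (X + 1)) by ring.
by apply: le_trans hfin _; rewrite ler_pM2l.
Qed.

Lemma des_approx_ray_derivative N z t :
  exists2 d, cderiv (fun t => des_approx N (t%:C * z)) t d &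
    half_strip (t%:C * z) -> cabs d <= 3 * N%:R * cabs z * expR (- (t * z.re)).
Proof.
pose u s : C := expC (- (s%:C * z)); pose v s := one_sub_exp (s%:C * z).
pose S1 := \sum_(n < N) v t ^+ n / n.+2%:R.
pose S2 := \sum_(n < N) (if n == 0 :> nat then 0 else
   (nat_of_ord n)%:R / n.+2%:R * v t ^+ n.-1 : C).
have hS : cderiv (fun s => \sum_(n < N) v s ^+ n / n.+2%:R) t (S2 * (z * u t)).
  rewrite /S2 mulr_suml.
  apply: (@cderiv_sum _ _ _ (fun (n : 'I_N) s => v s ^+ n / n.+2%:R)) => n.
  case: (nat_of_ord n) => [|m] /=.
    by apply: cderiv_ext (cderiv_cst (1 / 2) t) => [s|]; rewrite ?expr0 ?mul0r.
  have h := cderivX m (cderiv_one_sub_exp_ray z t).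
  apply: cderiv_ext (cderivZ (m.+3%:R^-1) h) => [s|]; first by rewrite mulrC.
  by rewrite /v /u; ring.
exists (z * u t * S1 - u t * (S2 * (z * u t))).
  have h := cderivM (cderivN (cderiv_exp_ray z t)) hS.
  apply: cderiv_ext h => [s|]; first by rewrite des_approxE.
  by rewrite -/(u t) /S1; ring.
move=> hw.
have v1 : cabs (v t) <= 1 by exact: cabs_one_sub_exp_le1.
have ue : cabs (u t) = expR (- (t * z.re)).
  by rewrite cabs_expC Re_opp Re_mul /= mul0r subr0.
have u43 : cabs (u t) <= 4 / 3.
  rewrite ue -[t * _]mul1r; apply: expR_half_strip; first by rewrite ler01 lexx.
  by case: hw; rewrite Re_mul /= mul0r subr0.
have termle (f : 'I_N -> C) : (forall n, cabs (f n) <= 1) ->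
    cabs (\sum_n f n) <= N%:R.
  move=> hf; apply: le_trans (cabs_sum _ _ _) _.
  rewrite -[N in leRHS]card_ord -sum1_card natr_sum.
  by apply: ler_sum => n _; exact: hf.
have hS1 : cabs S1 <= N%:R.
  apply: termle => n; rewrite cabsM cabsX cabsV cabs_nat.
  rewrite mulr_ile1 ?exprn_ge0 ?cabs_ge0 ?exprn_ile1 ?cabs_ge0//.
  by rewrite invf_le1// ler1n.
have hS2 : cabs S2 <= N%:R.
  apply: termle => n; case: ifP => _; first by rewrite cabs0 ler01.
  rewrite !cabsM cabsX cabsV !cabs_nat.
  rewrite mulr_ile1 ?mulr_ge0 ?exprn_ge0 ?cabs_ge0 ?exprn_ile1 ?cabs_ge0//.
  by rewrite ler_pdivrMr// mul1r ler_nat; apply: leq_trans (leqnSn _) (leqnSn _).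
apply: le_trans (cabsB _ _) _.
rewrite (cabsM _ S1) (cabsM (u t)) (cabsM S2) (cabsM z (u t)) -ue.
have zu0 : 0 <= cabs z * cabs (u t) by rewrite mulr_ge0 ?cabs_ge0.
have h1 : cabs z * cabs (u t) * cabs S1 <= cabs z * cabs (u t) * N%:R.
  by rewrite ler_wpM2l.
have h2 : cabs (u t) * cabs S2 <= 4 / 3 * N%:R.
  by apply: ler_pM => //; exact: cabs_ge0.
have h3 := ler_wpM2l zu0 h2.
have h4 : 0 <= cabs z * cabs (u t) * N%:R by rewrite mulr_ge0.
nra.
Qed.

Lemma des_factor_ray_derivative z t : half_strip (t%:C * z) -> t%:C * z != 0 ->
  cderiv (fun t => (t%:C * z) / (expC (t%:C * z) - 1)) t (z * des_factor1 (t%:C * z)).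
Proof.
move=> hw w0; have v0 := one_sub_exp_neq0 hw w0.
have ew0 := expC_sub1_neq0 hw w0.
have eE s : (expC (s%:C * z) - 1)^-1 =
    expC (- (s%:C * z)) * (one_sub_exp (s%:C * z))^-1.
  rewrite /one_sub_exp expCN.
  have [h|h] := eqVneq (expC (s%:C * z) - 1) 0.
    have -> : expC (s%:C * z) = 1 by rewrite -[LHS](subrK 1) h add0r.
    by rewrite invr1 subrr invr0 mulr0.
  have e0 := expC_neq0 (s%:C * z).
  by field; rewrite e0 h.
have hz : cderiv (fun s => s%:C * z) t z.
  apply: cderiv_ext (cderivZ z (cderiv_real (is_derive_id t 1))) => [s|].
    by rewrite mulrC.
  by rewrite mulr1.
have h := cderivM hz (cderivM (cderiv_exp_ray z t)
   (cderivV v0 (cderiv_one_sub_exp_ray z t))).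
apply: cderiv_ext h => [s|]; first by rewrite eE.
rewrite /des_factor1; set v := one_sub_exp _ in v0 *.
have -> : expC (- (t%:C * z)) = 1 - v by rewrite /v /one_sub_exp; ring.
by field.
Qed.

(** [des_factor c z] is the mean of [des_factor1] over the segment from c z to
    z, so it inherits the approximation once c is close to 1. *)
Lemma des_factor_approx (e : R) : 0 < e ->
  exists N0, forall N, (N0 <= N)%N -> exists2 d : R, 0 < d &
    forall c, 1 - d < c < 1 -> forall z, half_strip z -> z != 0 ->
    cabs (des_factor c z - des_approx N z) <= e * expR (- (2^-1 * z.re)).
Proof.
move=> e0; have e4 : 0 < e / 4 by rewrite divr_gt0.
have [N0 hN0] := des_factor1_approx e4.
exists N0 => N /hN0 hN.
(* c >= 3/4 lets the bound at s z, c <= s <= 1, decay like e^(-Re z / 2), and the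
   other condition makes [des_approx N] vary little between s z and z. *)
exists (Num.min 4^-1 (e / (256 * N.+1%:R))).
  rewrite lt_min invr_gt0 ltr0n /=.
  by apply: divr_gt0 => //; apply: mulr_gt0; exact: ltr0n.
move=> c /andP[]; rewrite ltrBlDl -ltrBlDr lt_min => /andP[c1 c2] c3 z hz z0.
have cabs1c : cabs (1 - c%:C) = 1 - c.
  by rewrite -real_complex1 -real_complexN -real_complexD cabs_real ger0_norm; lra.
have c0 : 1 - c%:C != 0 :> C.
  by apply/eqP => /(congr1 (@cabs R)); rewrite cabs1c cabs0; lra.
pose g s : C := (s%:C * z) / (expC (s%:C * z) - 1) - s%:C * (z * des_approx N z).
pose dg s : C := z * (des_factor1 (s%:C * z) - des_approx N z).
have sz s : c <= s <= 1 -> half_strip (s%:C * z) /\ s%:C * z != 0.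
  move=> /andP[s1 s2]; split; first by apply: half_strip_scale => //; lra.
  by rewrite mulf_neq0// real_complex_eq0 gt_eqF//; lra.
(* g has the derivative dg, since s z / (e^(s z) - 1) has z [des_factor1] (s z). *)
have hE : des_factor c z - des_approx N z = (g 1 - g c) / (1 - c%:C) / z.
  rewrite /des_factor /g real_complex1 !mul1r.
  have ec : expC (c%:C * z) - 1 != 0.
    by have [] := sz c; [rewrite lexx ltW | exact: expC_sub1_neq0].
  have e1 : expC z - 1 != 0 by exact: expC_sub1_neq0.
  by field; rewrite c0 z0 ec e1.
have [z1 z2] := hz.
have hz1 := half_strip_cabs hz.
have hdg s : c <= s <= 1 ->
   cabs (dg s) <= cabs z * (e / 2 * expR (- (2^-1 * z.re))).
  move=> hs; have /andP[s1 s2] := hs; have [hsz sz0] := sz s hs.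
  rewrite cabsM ler_wpM2l ?cabs_ge0//.
  have -> : des_factor1 (s%:C * z) - des_approx N z =
    (des_factor1 (s%:C * z) - des_approx N (s%:C * z)) -
    (des_approx N z - des_approx N (s%:C * z)) by ring.
  apply: le_trans (cabsB _ _) _.
  have hA := hN _ hsz sz0.
  have hB : cabs (des_approx N z - des_approx N (s%:C * z)) <=
     2 * (3 * N%:R * cabs z * (4 / 3 * expR (- (3 / 4 * z.re)))) * (1 - s).
    have hd t : exists d, cderiv (fun t => des_approx N (t%:C * z)) t d /\
       (half_strip (t%:C * z) -> cabs d <= 3 * N%:R * cabs z * expR (- (t * z.re))).
      by have [d] := des_approx_ray_derivative N z t; exists d.
    have [d hd'] := choice hd.
    have := @cderiv_bound _ (fun t => des_approx N (t%:C * z)) d s 1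
      (3 * N%:R * cabs z * (4 / 3 * expR (- (3 / 4 * z.re)))) s2.
    cbv beta; rewrite real_complex1 mul1r; apply.
      by move=> t _; have [] := hd' t.
    move=> t /andP[t1 t2].
    have ct : c <= t <= 1 by rewrite t2 (le_trans s1 t1).
    have [htz _] := sz t ct.
    have [_ /(_ htz) h] := hd' t; apply: le_trans h _.
    rewrite ler_wpM2l ?mulr_ge0 ?cabs_ge0//.
    by apply: expR_weight => //; lra.
  have hA' : expR (- (3 / 4 * (s%:C * z).re)) <= 4 / 3 * expR (- (2^-1 * z.re)).
    rewrite Re_mul /= mul0r subr0 mulrA; apply: expR_weight => //; lra.
  have hC : cabs z * expR (- (3 / 4 * z.re)) <= 4 * expR (- (2^-1 * z.re)).
    have -> : - (3 / 4 * z.re) = - (z.re / 4) - 2^-1 * z.re by lra.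
    rewrite expRD mulrA ler_wpM2r ?expR_ge0// expRN ler_pdivrMr ?expR_gt0//.
    by have := expR_ge1Dx (z.re / 4); lra.
  have n0 : 0 <= N%:R :> R by [].
  have h1 : N%:R * (1 - s) <= e / 256.
    have : (1 - c) * N.+1%:R <= e / 256.
      rewrite -ler_pdivlMr//; by move: c2; rewrite invfM mulrA => /ltW.
    rewrite -natr1; nra.
  set E := expR (- (2^-1 * z.re)) in hA' hC *.
  have E0 : 0 <= E by rewrite expR_ge0.
  have h2 : e / 4 * expR (- (3 / 4 * (s%:C * z).re)) <= e / 4 * (4 / 3 * E).
    by rewrite ler_pM2l.
  have h3 : 2 * (3 * N%:R * cabs z * (4 / 3 * expR (- (3 / 4 * z.re)))) * (1 - s)
     = 8 * (cabs z * expR (- (3 / 4 * z.re))) * (N%:R * (1 - s)) by lra.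
  have h4 : 8 * (cabs z * expR (- (3 / 4 * z.re))) * (N%:R * (1 - s)) <=
     8 * (4 * E) * (e / 256).
    apply: ler_pM => //; rewrite ?mulr_ge0 ?cabs_ge0 ?expR_ge0 ?subr_ge0//.
    by rewrite ler_pM2l.
  rewrite h3 in hB; apply: le_trans (lerD hA hB) _.
  nra.
have hb : cabs (g 1 - g c) <=
    2 * (cabs z * (e / 2 * expR (- (2^-1 * z.re)))) * (1 - c).
  apply: cderiv_bound hdg; first by lra.
  move=> s /sz[hsz sz0].
  have hl : cderiv (fun s => s%:C * (z * des_approx N z)) s (z * des_approx N z).
    apply: cderiv_ext (cderivZ (z * des_approx N z)
      (cderiv_real (is_derive_id s 1))) => [r|]; first by rewrite mulrC.
    by rewrite mulr1.
  apply: cderiv_ext (cderivD (des_factor_ray_derivative hsz sz0) (cderivN hl)) => //.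
  by rewrite /dg mulrBr.
rewrite hE !cabsM !cabsV cabs1c ler_pdivrMr ?cabs_gt0// ler_pdivrMr ?subr_gt0//.
by apply: le_trans hb _; lra.
Qed.

End FactorApproximation.

(** * Perturbation of integrals *)

Section LowerIntegral.
Local Open Scope classical_set_scope.
Local Open Scope ring_scope.
Variable R : realType.
Local Notation mu := (@lebesgue_measure R).

(** Monotonicity holds for arbitrary nonnegative functions because the integral
    is a supremum over the simple functions below the integrand. *)
Lemma ge0_le_integral_lower (D : set R) (f g : R -> \bar R) :
  (forall x, D x -> (0 <= f x)%E) -> (forall x, D x -> (f x <= g x)%E) ->
  (\int[mu]_(x in D) f x <= \int[mu]_(x in D) g x)%E.
Proof.
move=> f0 fg; have g0 x : D x -> (0 <= g x)%E.
  by move=> Dx; apply: le_trans (fg x Dx); exact: f0.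
rewrite ge0_integralE// ge0_integralE//.
apply: le_ereal_sup => _ [h hf <-] /=.
exists h => // x; apply: le_trans (hf x) _; rewrite !patchE.
by case: ifPn => // /set_mem; exact: fg.
Qed.

(** The exceptional set [N] is absorbed into a majorant that is infinite on [N] and
    still has the integral 0. *)
Lemma ge0_Rintegral_perturb (D N : set R) (f g b : R -> R) :
  measurable D -> countable N ->
  mu.-integrable D (EFin \o g) -> mu.-integrable D (EFin \o b) ->
  (forall x, D x -> 0 <= f x) -> (forall x, D x -> 0 <= g x) ->
  (forall x, D x -> 0 <= b x) ->
  (forall x, D x -> ~ N x -> `|f x - g x| <= b x) ->
  (\int[mu]_(x in D) (f x)%:E)%E \is a fin_num /\
  `|\int[mu]_(x in D) f x - \int[mu]_(x in D) g x| <= \int[mu]_(x in D) b x.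
Proof.
move=> mD cN ig ib f0 g0 b0 hN.
have mN : measurable N by apply: countable_measurable => //.
have N0 : mu N = 0%E by exact: countable_lebesgue_measure0.
have mg := measurable_int _ ig; have mb := measurable_int _ ib.
pose inf : R -> \bar R := (cst +oo%E) \_ N.
have minf : measurable_fun D inf.
  exact: (@measurable_restrict _ _ _ _ N D (cst +oo%E) mN mD).1.
have inf0 x : (0 <= inf x)%E.
  by rewrite /inf patchE; case: ifP => _ //=; rewrite leey.
have iinf : (\int[mu]_(x in D) inf x = 0)%E.
  rewrite /inf -integral_mkcondr; apply: null_set_integral => //.
    exact: measurableI.
  apply: countable_lebesgue_measure0; apply: sub_countable cN.
  by apply: subset_card_le; exact: subIsetr.
have up : (\int[mu]_(x in D) (f x)%:E <=
    \int[mu]_(x in D) (g x)%:E + \int[mu]_(x in D) (b x)%:E)%E.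
  have -> : (\int[mu]_(x in D) (g x)%:E + \int[mu]_(x in D) (b x)%:E =
     \int[mu]_(x in D) ((g x)%:E + (b x)%:E + inf x))%E.
    rewrite ge0_integralD//=; last 2 first.
    - by move=> x Dx; rewrite adde_ge0// lee_fin ?g0 ?b0.
    - exact: emeasurable_funD.
    by rewrite iinf adde0 ge0_integralD.
  apply: ge0_le_integral_lower => x Dx; first by rewrite lee_fin f0.
  rewrite /inf patchE; case: ifPn => xN.
    by rewrite -EFinD addey// leey.
  rewrite adde0 -EFinD lee_fin; have := hN x Dx.
  move/negP: xN; rewrite inE => xN /(_ xN); rewrite ler_norml; lra.
have gf : forall x, D x -> 0 <= Num.max (g x - b x) 0 by move=> x _; rewrite le_max lexx orbT.
have mg1 : measurable_fun D (fun x => (Num.max (g x - b x) 0)%:E).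
  apply/measurable_EFinP; apply: measurable_funrpos.
  by apply: measurable_funB; apply/measurable_EFinP.
have low : (\int[mu]_(x in D) (g x)%:E <=
    \int[mu]_(x in D) (f x)%:E + \int[mu]_(x in D) (b x)%:E)%E.
  apply: (@le_trans _ _ (\int[mu]_(x in D) (Num.max (g x - b x) 0)%:E +
     \int[mu]_(x in D) (b x)%:E)%E).
    rewrite -ge0_integralD//=; apply: ge0_le_integral_lower => x Dx.
      by rewrite lee_fin g0.
    by rewrite -EFinD lee_fin -lerBlDr le_max lexx.
  apply: leeD2r.
  have e := @ge0_negligible_integral _ _ R mu D N
    (fun x => (Num.max (g x - b x) 0)%:E) mN mD mg1.
  rewrite e//; rewrite integral_mkcondr; apply: ge0_le_integral_lower => x Dx.
    by rewrite patchE; case: ifP => // _; rewrite lee_fin gf.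
  rewrite patchE; case: ifPn => [/set_mem /= xN|_]; rewrite lee_fin ?f0//.
  rewrite ge_max f0// andbT; have := hN x Dx xN; rewrite ler_norml; lra.
have gfin : (\int[mu]_(x in D) (g x)%:E)%E \is a fin_num by exact: integrable_fin_num.
have bfin : (\int[mu]_(x in D) (b x)%:E)%E \is a fin_num by exact: integrable_fin_num.
have ffin : (\int[mu]_(x in D) (f x)%:E)%E \is a fin_num.
  rewrite ge0_fin_numE; last by apply: integral_ge0 => x Dx; rewrite lee_fin f0.
  by apply: le_lt_trans up _; rewrite lte_add_pinfty// ltey_eq ?gfin ?bfin.
split => //; rewrite /Rintegral.
move: up low; rewrite -(fineK ffin) -(fineK gfin) -(fineK bfin) /=.
by rewrite -!EFinD !lee_fin ler_norml; lra.
Qed.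

(** Compares the integral of an arbitrary function [f], such as an inner integral
    of an iterated one, with that of an integrable [g]; the factor 2 comes from
    treating the positive and negative parts separately. *)
Lemma Rintegral_perturb (D N : set R) (f g b : R -> R) :
  measurable D -> countable N ->
  mu.-integrable D (EFin \o g) -> mu.-integrable D (EFin \o b) ->
  (forall x, D x -> 0 <= b x) ->
  (forall x, D x -> ~ N x -> `|f x - g x| <= b x) ->
  `|\int[mu]_(x in D) f x - \int[mu]_(x in D) g x| <= 2 * \int[mu]_(x in D) b x.
Proof.
move=> mD cN ig ib b0 hN.
have split_parts h : mu.-integrable D (EFin \o h) \/
   ((\int[mu]_(x in D) (h^\+ x)%:E)%E \is a fin_num /\
    (\int[mu]_(x in D) (h^\- x)%:E)%E \is a fin_num) ->
   \int[mu]_(x in D) h x = \int[mu]_(x in D) h^\+ x - \int[mu]_(x in D) h^\- x.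
  move=> H; rewrite /Rintegral integralE.
  have fin : (\int[mu]_(x in D) (h^\+ x)%:E)%E \is a fin_num /\
    (\int[mu]_(x in D) (h^\- x)%:E)%E \is a fin_num.
    case: H => [ih|//]; split.
      by apply: integrable_fin_num => //; exact: integrable_funrpos.
    by apply: integrable_fin_num => //; exact: integrable_funrneg.
  have [hp hn] := fin; rewrite -fineB//; congr (fine (_ - _)%E).
    by rewrite -[in RHS]/(EFin \o h^\+) -funerpos.
  by rewrite -[in RHS]/(EFin \o h^\-) -funerneg.
have [|||||f1 h1] := @ge0_Rintegral_perturb D N f^\+ g^\+ b mD cN _ ib.
- exact: integrable_funrpos.
- by move=> x _; rewrite funrpos_ge0.
- by move=> x _; rewrite funrpos_ge0.
- by [].
- move=> x Dx xN; apply: le_trans (hN x Dx xN); rewrite /funrpos.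
  by rewrite !maxEle; case: ifPn; case: ifPn; rewrite -?ltNge => h h';
    rewrite ?ler_norml; have := ler_norm (f x - g x); have := ler_norm (g x - f x);
    rewrite (distrC (g x)) ?normr0; lra.
have [|||||f2 h2] := @ge0_Rintegral_perturb D N f^\- g^\- b mD cN _ ib.
- exact: integrable_funrneg.
- by move=> x _; rewrite funrneg_ge0.
- by move=> x _; rewrite funrneg_ge0.
- by [].
- move=> x Dx xN; apply: le_trans (hN x Dx xN); rewrite /funrneg.
  by rewrite !maxEle; case: ifPn; case: ifPn; rewrite -?ltNge => h h';
    rewrite ?ler_norml; have := ler_norm (f x - g x); have := ler_norm (g x - f x);
    rewrite (distrC (g x)) ?normr0; lra.
rewrite (split_parts f); last by right.
rewrite (split_parts g); last by left.
move: h1 h2; rewrite !ler_norml; lra.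
Qed.

End LowerIntegral.

(** * Contour integrals and their stability *)

Section ComplexIntegral.
Local Open Scope classical_set_scope.
Local Open Scope complex_scope.
Local Open Scope ring_scope.
Variable R : realType.
Local Notation C := R[i].
Local Notation mu := (@lebesgue_measure R).
Implicit Types (D N : set R) (f g : R -> C).

Definition integrableC D f : Prop :=
  mu.-integrable D (EFin \o (fun x => complex.Re (f x))) /\
  mu.-integrable D (EFin \o (fun x => complex.Im (f x))).

Lemma eq_integralC D f g : {in D, f =1 g} -> integralC D f = integralC D g.
Proof.
by move=> h; congr (_ +i* _); apply: eq_Rintegral => x xD; rewrite h.
Qed.

Lemma eq_integrableC D f g : measurable D -> {in D, f =1 g} ->
  integrableC D f -> integrableC D g.
Proof.
by move=> mD h [h1 h2]; split; [apply: eq_integrable h1|apply: eq_integrable h2] => // x xD;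
  rewrite /= h.
Qed.

Lemma integrable_add D (h k : R -> R) : measurable D ->
  mu.-integrable D (EFin \o h) -> mu.-integrable D (EFin \o k) ->
  mu.-integrable D (EFin \o (fun x => h x + k x)).
Proof. by move=> mD ih ik; exact: (@integrableD _ _ _ mu D mD _ _ ih ik). Qed.

Lemma integrable_scale D (h : R -> R) (r : R) : measurable D ->
  mu.-integrable D (EFin \o h) -> mu.-integrable D (EFin \o (fun x => r * h x)).
Proof. by move=> mD ih; exact: (@integrableZl _ _ _ mu D mD r _ ih). Qed.

Lemma integrable_sub D (h k : R -> R) : measurable D ->
  mu.-integrable D (EFin \o h) -> mu.-integrable D (EFin \o k) ->
  mu.-integrable D (EFin \o (fun x => h x - k x)).
Proof. by move=> mD ih ik; exact: (@integrableB _ _ _ mu D mD _ _ ih ik). Qed.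

Lemma integrableCD D f g : measurable D -> integrableC D f -> integrableC D g ->
  integrableC D (fun x => f x + g x).
Proof.
move=> mD [f1 f2] [g1 g2]; split.
  by under eq_fun do rewrite Re_add; exact: integrable_add.
by under eq_fun do rewrite Im_add; exact: integrable_add.
Qed.

Lemma integralCD D f g : measurable D -> integrableC D f -> integrableC D g ->
  integralC D (fun x => f x + g x) = integralC D f + integralC D g.
Proof.
move=> mD [f1 f2] [g1 g2]; rewrite /integralC.
under eq_Rintegral do rewrite Re_add.
rewrite RintegralD//.
under [X in _ +i* X]eq_Rintegral do rewrite Im_add.
by rewrite RintegralD.
Qed.

Lemma integrableCZ D (c : C) f : measurable D -> integrableC D f ->
  integrableC D (fun x => c * f x).
Proof.
move=> mD [f1 f2]; split.
  under eq_fun do rewrite Re_mul.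
  by apply: integrable_sub => //; exact: integrable_scale.
under eq_fun do rewrite Im_mul.
by apply: integrable_add => //; exact: integrable_scale.
Qed.

Lemma integralCZ D (c : C) f : measurable D -> integrableC D f ->
  integralC D (fun x => c * f x) = c * integralC D f.
Proof.
move=> mD [f1 f2]; rewrite /integralC.
have e1 := integrable_scale (complex.Re c) mD f1.
have e2 := integrable_scale (complex.Im c) mD f2.
have e3 := integrable_scale (complex.Re c) mD f2.
have e4 := integrable_scale (complex.Im c) mD f1.
under eq_Rintegral do rewrite Re_mul.
rewrite RintegralB// !RintegralZl//.
under [X in _ +i* X]eq_Rintegral do rewrite Im_mul.
rewrite RintegralD// !RintegralZl//.
case: c {e1 e2 e3 e4} => a b /=; apply/eqP; rewrite eq_complex /=.
by rewrite eqxx /= [b * _]mulrC.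
Qed.

Lemma integralCB D f g : measurable D -> integrableC D f -> integrableC D g ->
  integralC D (fun x => f x - g x) = integralC D f - integralC D g.
Proof.
move=> mD fi gi; have gi' := integrableCZ (- 1) mD gi.
rewrite -[X in _ - X]mul1r -mulNr -integralCZ// -integralCD//.
by apply: eq_integralC => x _; rewrite mulN1r.
Qed.

Lemma integrableC_real D (h : R -> R) : measurable D ->
  mu.-integrable D (EFin \o h) -> integrableC D (fun x => (h x)%:C).
Proof. by move=> mD ih; split => //; exact: integrable0. Qed.

Lemma integralC_real D (h : R -> R) :
  integralC D (fun x => (h x)%:C) = (\int[mu]_(x in D) h x)%:C.
Proof.
rewrite /integralC /=; congr (_ +i* _).
by rewrite /Rintegral integral0.
Qed.

Lemma integralC_perturb D N f g (b : R -> R) : measurable D -> countable N ->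
  integrableC D g -> mu.-integrable D (EFin \o b) ->
  (forall x, D x -> 0 <= b x) ->
  (forall x, D x -> ~ N x -> cabs (f x - g x) <= b x) ->
  cabs (integralC D f - integralC D g) <= 4 * \int[mu]_(x in D) b x.
Proof.
move=> mD cN [g1 g2] ib b0 hN; apply: le_trans (cabs_le _) _.
rewrite Re_add Im_add Re_opp Im_opp /=.
have h1 := @Rintegral_perturb R D N (fun x => complex.Re (f x)) _ b mD cN g1 ib b0.
have h2 := @Rintegral_perturb R D N (fun x => complex.Im (f x)) _ b mD cN g2 ib b0.
rewrite (_ : 4 = 2 + 2 :> R); last by ring.
rewrite [leRHS]mulrDl.
apply: lerD; [apply: h1|apply: h2] => x Dx Nx; apply: le_trans (hN x Dx Nx).
  by rewrite -Re_opp -Re_add normr_Re_le.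
by rewrite -Im_opp -Im_add normr_Im_le.
Qed.

End ComplexIntegral.

Section ContourIntegral.
Local Open Scope classical_set_scope.
Local Open Scope complex_scope.
Local Open Scope ring_scope.
Variable R : realType.
Local Notation C := R[i].
Local Notation mu := (@lebesgue_measure R).
Variable eps : R.
Hypothesis eps0 : 0 < eps.
Implicit Types (F G : R * R -> C).

Definition contour_integrable F : Prop :=
  [/\ integrableC `[eps, +oo[ (fun rho => F (rho, 0)),
      integrableC `[0, 2 * pi] (fun theta =>
        F (eps, theta) * ((0 +i* 1) * contour_point (eps, theta))) &
      integrableC `[eps, +oo[ (fun rho => F (rho, 2 * pi))].

Lemma contour_integrableD F G : contour_integrable F -> contour_integrable G ->
  contour_integrable (fun x => F x + G x).
Proof.
move=> [f1 f2 f3] [g1 g2 g3]; split; try exact: integrableCD.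
apply: eq_integrableC (integrableCD _ f2 g2) => //.
by move=> x _; rewrite mulrDl.
Qed.

Lemma contour_integralD F G : contour_integrable F -> contour_integrable G ->
  contour_integral eps (fun x => F x + G x) =
  contour_integral eps F + contour_integral eps G.
Proof.
move=> [f1 f2 f3] [g1 g2 g3]; rewrite /contour_integral !integralCD//.
under [X in _ + X + _]eq_integralC do rewrite mulrDl.
by rewrite integralCD//; ring.
Qed.

Lemma contour_integrableZ (c : C) F : contour_integrable F ->
  contour_integrable (fun x => c * F x).
Proof.
move=> [f1 f2 f3]; split; try exact: integrableCZ.
apply: eq_integrableC (integrableCZ c _ f2) => //.
by move=> x _; rewrite mulrA.
Qed.

Lemma contour_integralZ (c : C) F : contour_integrable F ->
  contour_integral eps (fun x => c * F x) = c * contour_integral eps F.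
Proof.
move=> [f1 f2 f3]; rewrite /contour_integral !integralCZ//.
under [X in _ + X + _]eq_integralC do rewrite -mulrA.
by rewrite integralCZ//; ring.
Qed.

Lemma contour_integrable0 : contour_integrable (fun=> 0).
Proof.
split; try by apply: integrableC_real => //; exact: integrable0.
apply: (@eq_integrableC _ _ (fun=> 0%:C)) => //; first by move=> x _; rewrite mul0r.
by apply: integrableC_real => //; exact: integrable0.
Qed.

Lemma contour_integral0 : contour_integral eps (fun=> 0) = 0.
Proof.
have := contour_integralZ 0 contour_integrable0.
by under eq_fun do rewrite mul0r; rewrite mul0r.
Qed.

Lemma contour_integrable_sum (I : Type) (s : seq I) (F : I -> R * R -> C) :
  (forall i, contour_integrable (F i)) ->
  contour_integrable (fun x => \sum_(i <- s) F i x).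
Proof.
move=> h; elim: s => [|i s IH].
  by under eq_fun do rewrite big_nil; exact: contour_integrable0.
by under eq_fun do rewrite big_cons; exact: contour_integrableD.
Qed.

Lemma contour_integral_sum (I : Type) (s : seq I) (F : I -> R * R -> C) :
  (forall i, contour_integrable (F i)) ->
  contour_integral eps (fun x => \sum_(i <- s) F i x) =
  \sum_(i <- s) contour_integral eps (F i).
Proof.
move=> h; elim: s => [|i s IH].
  by under eq_fun do rewrite big_nil; rewrite big_nil contour_integral0.
under eq_fun do rewrite big_cons; rewrite big_cons -IH contour_integralD//.
exact: contour_integrable_sum.
Qed.

(** Truth at all points of the contour up to countably many parameters: the
    zeros of the partial sums of the variables have to be avoided. *)
Definition contour_ae (P : R * R -> Prop) : Prop :=
  exists2 N : set R, countable N &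
    (forall rho, eps <= rho -> ~ N rho -> P (rho, 0) /\ P (rho, 2 * pi)) /\
    (forall theta, 0 <= theta <= 2 * pi -> ~ N theta -> P (eps, theta)).

(** Weighted length of the contour; the factor 4 is lost in splitting integrands
    into real and imaginary, positive and negative parts. *)
Definition contour_mass (w : R -> R) : R :=
  4 * (2 * \int[mu]_(x in `[eps, +oo[) w x + 2 * pi * eps * w eps).

Lemma cabs_contour_point (x : R * R) : 0 <= x.1 -> cabs (contour_point x) = x.1.
Proof.
by move=> x0; rewrite cabsM cabs_real ger0_norm// cabs_expC expR0 mulr1.
Qed.

Lemma contour_integral_perturb F G (w : R -> R) (M : R) :
  0 <= M -> (forall x, 0 <= w x) ->
  mu.-integrable `[eps, +oo[ (EFin \o w) -> contour_integrable G ->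
  contour_ae (fun x => cabs (F x - G x) <= M * w x.1) ->
  cabs (contour_integral eps F - contour_integral eps G) <= M * contour_mass w.
Proof.
move=> M0 w0 iw [g1 g2 g3] [N cN [hray hcirc]].
have iMw := integrable_scale M (measurable_itv `[eps, +oo[) iw.
have mI : measurable (`[eps, +oo[ : set R) by exact: measurable_itv.
have mI2 : measurable (`[0, 2 * pi] : set R) by exact: measurable_itv.
have Mw0 x : 0 <= M * w x by rewrite mulr_ge0.
have b1 : cabs (integralC `[eps, +oo[ (fun rho => F (rho, 0)) -
    integralC `[eps, +oo[ (fun rho => G (rho, 0))) <=
    4 * \int[mu]_(x in `[eps, +oo[) (M * w x).
  apply: (@integralC_perturb _ _ N) => // x; rewrite /= in_itv /= andbT => xe xN.
  by have [] := hray x xe xN.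
have b3 : cabs (integralC `[eps, +oo[ (fun rho => F (rho, 2 * pi)) -
    integralC `[eps, +oo[ (fun rho => G (rho, 2 * pi))) <=
    4 * \int[mu]_(x in `[eps, +oo[) (M * w x).
  apply: (@integralC_perturb _ _ N) => // x; rewrite /= in_itv /= andbT => xe xN.
  by have [] := hray x xe xN.
have pi2 : 0 <= 2 * pi :> R by rewrite mulr_ge0// pi_ge0.
have mupi : mu (`[0, 2 * pi] : set R) = (2 * pi)%:E.
  by rewrite lebesgue_measure_itv /= lte_fin; case: ltP => h;
    rewrite ?oppr0 ?addr0 ?sube0//; congr EFin; apply/eqP; rewrite eq_le pi2 h.
have b2 : cabs (integralC `[0, 2 * pi] (fun theta =>
        F (eps, theta) * ((0 +i* 1) * contour_point (eps, theta))) -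
     integralC `[0, 2 * pi] (fun theta =>
        G (eps, theta) * ((0 +i* 1) * contour_point (eps, theta)))) <=
    4 * \int[mu]_(x in `[0, 2 * pi]) (M * w eps * eps).
  apply: (@integralC_perturb _ _ N) => //.
  - apply: continuous_compact_integrable; first exact: segment_compact.
    by move=> x; exact: cvg_cst.
  - by move=> x _; rewrite mulr_ge0// ltW.
  move=> x; rewrite /= in_itv /= => xe xN.
  rewrite -mulrBl cabsM; apply: ler_pM; rewrite ?cabs_ge0//; first exact: hcirc.
  rewrite cabsM cabs_contour_point ?(ltW eps0)// cabsE /= expr0n expr1n add0r.
  by rewrite sqrtr1 mul1r.
have fpi : fine (mu (`[0, 2 * pi] : set R)) = 2 * pi by rewrite mupi.
rewrite Rintegral_cst// fpi in b2.
rewrite RintegralZl// in b1; rewrite RintegralZl// in b3.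
rewrite /contour_integral /contour_mass.
set f1 := integralC _ _ in b1 *; set h1 := integralC _ (fun rho => G (rho, 0)) in b1 *.
set f3 := integralC _ (fun rho => F (rho, 2 * pi)) in b3 *.
set h3 := integralC _ (fun rho => G (rho, 2 * pi)) in b3 *.
set f2 := integralC `[0, 2 * pi] _ in b2 *.
set h2 := integralC `[0, 2 * pi] _ in b2 *.
have -> : - f1 + f2 + f3 - (- h1 + h2 + h3) = - (f1 - h1) + (f2 - h2) + (f3 - h3) by ring.
apply: le_trans (cabsD _ _) _; apply: le_trans (lerD (cabsD _ _) (lexx _)) _.
rewrite cabsN; set J := Rintegral _ _ _ in b1 b3 *.
have -> : M * (4 * (2 * J + 2 * pi * eps * w eps)) =
  4 * (M * J) + 4 * (M * w eps * eps * (2 * pi)) + 4 * (M * J) by ring.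
by apply: lerD => //; apply: lerD.
Qed.

Fixpoint contour_ae_iter (r : nat) : (r.-tuple (R * R) -> Prop) -> Prop :=
  match r with
  | 0 => fun P => P [tuple]
  | r'.+1 => fun P => contour_ae (fun x =>
      contour_ae_iter (fun xs : r'.-tuple (R * R) => P [tuple of x :: xs]))
  end.

Fixpoint iter_integrable (r : nat) : (r.-tuple (R * R) -> C) -> Prop :=
  match r with
  | 0 => fun=> True
  | r'.+1 => fun F : r'.+1.-tuple (R * R) -> C =>
      (forall x, iter_integrable (fun xs : r'.-tuple (R * R) => F [tuple of x :: xs])) /\
      contour_integrable (fun x => contour_integral_iter eps
        (fun xs : r'.-tuple (R * R) => F [tuple of x :: xs]))
  end.

Lemma contour_ae_sub (P Q : R * R -> Prop) :
  (forall x, P x -> Q x) -> contour_ae P -> contour_ae Q.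
Proof.
move=> PQ [N cN [h1 h2]]; exists N => //; split => [rho re rN|theta te tN].
  by have [? ?] := h1 rho re rN; split; exact: PQ.
by apply: PQ; exact: h2.
Qed.

Lemma contour_ae_iter_sub r (P Q : r.-tuple (R * R) -> Prop) :
  (forall xs, P xs -> Q xs) -> contour_ae_iter P -> contour_ae_iter Q.
Proof.
elim: r P Q => [|r IH] P Q PQ /=; first exact: PQ.
by apply: contour_ae_sub => x; apply: IH => xs; exact: PQ.
Qed.

(** Induction on the number of variables: the inner integrals of [F] enter the outer
    step only through their distance to those of [G]. *)
Lemma contour_integral_iter_perturb r (F G : r.-tuple (R * R) -> C)
    (w : 'I_r -> R -> R) (M : R) :
  0 <= M -> (forall k x, 0 <= w k x) ->
  (forall k, mu.-integrable `[eps, +oo[ (EFin \o w k)) ->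
  iter_integrable G ->
  contour_ae_iter (fun xs => cabs (F xs - G xs) <= M * \prod_k w k (tnth xs k).1) ->
  cabs (contour_integral_iter eps F - contour_integral_iter eps G) <=
    M * \prod_k contour_mass (w k).
Proof.
elim: r F G w M => [|r IH] F G w M M0 w0 iw iG hFG.
  by move: hFG => /=; rewrite !big_ord0.
have [iG1 iG2] := iG.
rewrite big_ord_recl mulrCA [leRHS]mulrC.
have mass0 k : 0 <= contour_mass (w k).
  rewrite /contour_mass mulr_ge0// addr_ge0 ?mulr_ge0 ?pi_ge0 ?(ltW eps0)//.
  exact: Rintegral_ge0.
apply: contour_integral_perturb => //; first by rewrite mulr_ge0// prodr_ge0.
apply: contour_ae_sub hFG => x hx.
rewrite mulrAC; apply: IH => //; [by rewrite mulr_ge0 | exact: iG1 | ].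
apply: (contour_ae_iter_sub _ hx) => xs; rewrite big_ord_recl tnth0 mulrA.
rewrite [in X in X -> _](eq_bigr (fun k => w (lift ord0 k) (tnth xs k).1))//.
by move=> k _; rewrite tnthS.
Qed.

Lemma iter_sum r (I : Type) (s : seq I) (F : I -> r.-tuple (R * R) -> C) :
  (forall i, iter_integrable (F i)) ->
  iter_integrable (fun xs => \sum_(i <- s) F i xs) /\
  contour_integral_iter eps (fun xs => \sum_(i <- s) F i xs) =
  \sum_(i <- s) contour_integral_iter eps (F i).
Proof.
elim: r F => [|r IH] F hF; first by [].
have hx x := IH (fun i xs => F i [tuple of x :: xs]) (fun i => (hF i).1 x).
have e : (fun x => contour_integral_iter eps
     (fun xs : r.-tuple (R * R) => \sum_(i <- s) F i [tuple of x :: xs])) =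
   (fun x => \sum_(i <- s) contour_integral_iter eps
     (fun xs : r.-tuple (R * R) => F i [tuple of x :: xs])).
  by apply/funext => x; have [_] := hx x.
split=> /=.
  split; first by move=> x; have [] := hx x.
  by rewrite e; apply: contour_integrable_sum => i; have [] := hF i.
by rewrite e contour_integral_sum// => i; have [] := hF i.
Qed.

Lemma iter_prod r (c : C) (g : 'I_r -> R * R -> C) :
  (forall k, contour_integrable (g k)) ->
  iter_integrable (fun xs : r.-tuple (R * R) => c * \prod_k g k (tnth xs k)) /\
  contour_integral_iter eps (fun xs : r.-tuple (R * R) =>
      c * \prod_k g k (tnth xs k)) =
    c * \prod_k contour_integral eps (g k).
Proof.
elim: r c g => [|r IH] c g hg; first by rewrite /= !big_ord0.
have e x : (fun xs : r.-tuple (R * R) =>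
     c * \prod_k g k (tnth [tuple of x :: xs] k)) =
   (fun xs => c * g ord0 x * \prod_k g (lift ord0 k) (tnth xs k)).
  apply/funext => xs; rewrite big_ord_recl tnth0 mulrA.
  by congr (_ * _); apply: eq_bigr => k _; rewrite tnthS.
have hx x := IH (c * g ord0 x) (fun k => g (lift ord0 k)) (fun k => hg _).
have e2 : (fun x => contour_integral_iter eps (fun xs : r.-tuple (R * R) =>
     c * \prod_k g k (tnth [tuple of x :: xs] k))) =
   (fun x => (c * \prod_k contour_integral eps (g (lift ord0 k))) * g ord0 x).
  by apply/funext => x; rewrite e; have [_ ->] := hx x; rewrite mulrAC.
split=> /=.
  split; first by move=> x; rewrite e; have [] := hx x.
  by rewrite e2; exact: contour_integrableZ.
by rewrite e2 contour_integralZ// big_ord_recl /= mulrAC mulrA.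
Qed.

End ContourIntegral.

(** * Integrable weights and generic points of the contour *)

Section Weights.
Local Open Scope classical_set_scope.
Local Open Scope ring_scope.
Variable R : realType.
Local Notation mu := (@lebesgue_measure R).

(** x^s e^(-a x), with the real power spelled out as in [contour_power]. *)
Definition pow_exp (a s x : R) : R := expR (- (a * x)) * expR (s * ln x).

Lemma pow_exp_ge0 a s x : 0 <= pow_exp a s x.
Proof. by rewrite mulr_ge0 ?expR_ge0. Qed.

Lemma measurable_pow_exp (a s : R) (D : set R) : measurable_fun D (pow_exp a s).
Proof.
apply: (@measurable_funS _ _ _ _ setT) => //.
apply: measurable_funM; apply: (measurableT_comp (@measurable_expR R)).
  by apply: measurableT_comp => //; exact: measurable_funM.
by apply: measurable_funM => //; exact: measurable_ln.
Qed.

Lemma integrable_exp_decay (a : R) (D : set R) : 0 < a -> measurable D ->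
  D `<=` `[0, +oo[ -> mu.-integrable D (EFin \o (fun x => expR (- (a * x)))).
Proof.
move=> a0 mD D0.
have h : mu.-integrable D (EFin \o exponential_pdf a).
  by apply: integrableS (integrable_exponential_pdf a0).
apply: eq_integrable (integrable_scale a^-1 mD h) => // x.
rewrite inE => /D0; rewrite /= in_itv /= andbT => x0.
by rewrite exponential_pdfE// mulrA mulVf ?gt_eqF// mul1r mulNr.
Qed.

(** ln x <= d x - ln d for every d > 0, so ln grows slower than any line. *)
Lemma mul_ln_le_gt0 (s b : R) : 0 <= s -> 0 < b ->
  exists K, forall x, 0 < x -> s * ln x <= K + b * x.
Proof.
move=> s0 b0; pose d := b / (s + 1); have s1 : 0 < s + 1 by lra.
have d0 : 0 < d by rewrite divr_gt0.
exists (- (s * ln d)) => x x0.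
have h : ln d + ln x <= d * x.
  by rewrite -lnM ?posrE// ltW// ln_sublinear// mulr_gt0.
have h2 : s * (ln d + ln x) <= s * (d * x) by rewrite ler_wpM2l.
have h3 : s * (d * x) <= b * x.
  rewrite mulrA ler_wpM2r ?(ltW x0)// /d mulrCA ger_pMr// ler_pdivrMr//; lra.
lra.
Qed.

Lemma mul_ln_le (s b eps : R) : 0 < b -> 0 < eps ->
  exists K, forall x, eps <= x -> s * ln x <= K + b * x.
Proof.
move=> b0 eps0; have [s0|s0] := leP 0 s.
  have [K hK] := mul_ln_le_gt0 s0 b0; exists K => x xe.
  by apply: hK; apply: lt_le_trans xe.
exists (s * ln eps) => x xe.
apply: (@le_trans _ _ (s * ln eps)).
  by rewrite ler_wnM2l ?(ltW s0)// ler_ln ?posrE// (lt_le_trans eps0).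
by rewrite lerDl mulr_ge0 ?(ltW b0)// (le_trans (ltW eps0)).
Qed.

Lemma integrable_pow_exp_bound (a s K : R) (D : set R) : 0 < a -> measurable D ->
  D `<=` `[0, +oo[ -> (forall x, D x -> s * ln x <= K + a / 2 * x) ->
  mu.-integrable D (EFin \o pow_exp a s).
Proof.
move=> a0 mD D0 hK; have a2 : 0 < a / 2 by rewrite divr_gt0.
apply: le_integrable (integrable_scale (expR K) mD (integrable_exp_decay a2 mD D0)) => //.
  by apply/measurable_EFinP; exact: measurable_pow_exp.
move=> x Dx; rewrite /= lee_fin.
rewrite (ger0_norm (pow_exp_ge0 _ _ _)) (ger0_norm (mulr_ge0 (expR_ge0 _) (expR_ge0 _))).
rewrite /pow_exp -!expRD ler_expR.
by have := hK x Dx; lra.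
Qed.

Lemma integrable_pow_exp (a s eps : R) : 0 < a -> 0 < eps ->
  mu.-integrable `[eps, +oo[ (EFin \o pow_exp a s).
Proof.
move=> a0 eps0; have a2 : 0 < a / 2 by rewrite divr_gt0.
have [K hK] := @mul_ln_le s (a / 2) eps a2 eps0.
apply: (integrable_pow_exp_bound (K := K)) => // x; rewrite /= !in_itv /= !andbT.
  exact: le_trans (ltW eps0).
exact: hK.
Qed.

Lemma integrable_pow_exp0 (a s : R) : 0 < a -> 0 <= s ->
  mu.-integrable `]0, +oo[ (EFin \o pow_exp a s).
Proof.
move=> a0 s0; have a2 : 0 < a / 2 by rewrite divr_gt0.
have [K hK] := mul_ln_le_gt0 s0 a2.
apply: (integrable_pow_exp_bound (K := K)) => // x; rewrite /= !in_itv /= !andbT.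
  exact: ltW.
exact: hK.
Qed.

End Weights.

Section ContourPoints.
Local Open Scope classical_set_scope.
Local Open Scope complex_scope.
Local Open Scope ring_scope.
Variable R : realType.
Local Notation C := R[i].
Local Notation mu := (@lebesgue_measure R).
Variable eps : R.
Hypothesis eps0 : 0 < eps.
Local Notation "z .re" := (complex.Re z) (at level 2, format "z .re").
Local Notation "z .im" := (complex.Im z) (at level 2, format "z .im").

Lemma contour_pointE (x : R * R) : contour_point x = (x.1 * cos x.2) +i* (x.1 * sin x.2).
Proof.
rewrite /contour_point /expC /= expR0 mul1r; apply/eqP; rewrite eq_complex /=.
by rewrite !mul0r !subr0 !addr0 !eqxx.
Qed.

Lemma cos_2pi : cos (2 * pi) = 1 :> R.
Proof. by rewrite mulr_natl cos2pi. Qed.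

Lemma sin_2pi : sin (2 * pi) = 0 :> R.
Proof. by rewrite mulr_natl sin2pi. Qed.

Lemma contour_point_top (rho : R) : contour_point (rho, 0) = rho%:C.
Proof. by rewrite contour_pointE /= cos0 sin0 mulr1 mulr0. Qed.

Lemma contour_point_bottom (rho : R) : contour_point (rho, 2 * pi) = rho%:C.
Proof. by rewrite contour_pointE /= cos_2pi sin_2pi mulr1 mulr0. Qed.

(** Inequalities shared by the rays and the circle. The last one turns decay in the
    real part of a point into decay in its modulus. *)
Definition near_contour (x : R * R) : Prop :=
  [/\ eps <= x.1, `|(contour_point x).im| <= eps &
      x.1 - 2 * eps <= (contour_point x).re].

Lemma contour_ae_near : contour_ae eps near_contour.
Proof.
exists set0 => //; split => [rho re _|theta _ _].
  rewrite /near_contour contour_point_top contour_point_bottom /= normr0.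
  by split; split => //; rewrite ?(ltW eps0)//; move: eps0; lra.
rewrite /near_contour contour_pointE /= normrM (gtr0_norm eps0); split => //.
  by rewrite ler_piMr ?sin_max// ltW.
move: (cos_geN1 theta) eps0; nra.
Qed.

Lemma contour_aeI (P Q : R * R -> Prop) : contour_ae eps P -> contour_ae eps Q ->
  contour_ae eps (fun x => P x /\ Q x).
Proof.
move=> [N cN [h1 h2]] [N' cN' [h1' h2']]; exists (N `|` N').
  by rewrite -bigcup2E; apply: bigcup_countable => // -[|[|i]] _ //=; exact: countable0.
split => [rho re /not_orP[rN rN']|theta te /not_orP[tN tN']].
  by have [? ?] := h1 rho re rN; have [? ?] := h1' rho re rN'.
by split; [exact: h2|exact: h2'].
Qed.

Lemma contour_ae_iterI r (P Q : r.-tuple (R * R) -> Prop) :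
  contour_ae_iter eps P -> contour_ae_iter eps Q ->
  contour_ae_iter eps (fun xs => P xs /\ Q xs).
Proof.
elim: r P Q => [|r IH] P Q //= hP hQ.
by apply: contour_ae_sub (contour_aeI hP hQ) => x [hx hx']; exact: IH.
Qed.

Lemma contour_ae_iter_near r :
  contour_ae_iter eps (fun xs : r.-tuple (R * R) => forall k, near_contour (tnth xs k)).
Proof.
elim: r => [|r IH] /=; first by case.
apply: contour_ae_sub contour_ae_near => x hx.
apply: (contour_ae_iter_sub _ IH) => xs h k.
by case: (unliftP ord0 k) => [j ->|->]; rewrite ?tnthS ?tnth0.
Qed.

Lemma contour_ae_add_neq0 (t : C) :
  contour_ae eps (fun x => t + contour_point x != 0).
Proof.
pose a := - t.re / eps.
exists [set x | x \in [:: - t.re; acos a; acos (- a) + pi]].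
  by apply: finite_set_countable; exact: finite_seq.
split => [rho re|theta /andP[t0 t2]] hN.
  rewrite contour_point_top contour_point_bottom.
  suff h : t + rho%:C != 0 by split.
  apply/eqP => /(congr1 (@complex.Re _)); rewrite Re_add /= => h.
  apply: hN; rewrite /= !inE; apply/orP; left; apply/eqP; lra.
apply/eqP => /(congr1 (@complex.Re _)); rewrite Re_add contour_pointE /= => h.
have ca : cos theta = a.
  rewrite /a; apply: (canRL (mulfK _)); first by rewrite gt_eqF.
  by move: h; lra.
apply: hN; rewrite /= !inE; apply/orP; right; apply/orP.
(* The cosine determines theta up to the reflection 2 pi - theta. *)
have [tp|/ltW tp] := leP theta pi.
  by left; rewrite -ca cosK// in_itv /= t0.
right; rewrite -ca.
have -> : - cos theta = cos (theta - pi).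
  by rewrite -[in LHS](subrK pi theta) cosDpi opprK.
by rewrite cosK ?subrK// in_itv /= subr_ge0 tp /=; lra.
Qed.

Lemma contour_ae_add_seq_neq0 (T : seq C) :
  contour_ae eps (fun x => forall t, t \in T -> t + contour_point x != 0).
Proof.
elim: T => [|t T IH]; first by exists set0.
apply: contour_ae_sub (contour_aeI (contour_ae_add_neq0 t) IH) => x [h1 h2] u.
by rewrite inE => /orP[/eqP ->//|]; exact: h2.
Qed.

(** Each partial sum vanishes only for finitely many values of its last variable.
    The offsets [T] collect the contributions of the variables already fixed. *)
Lemma contour_ae_partial_sums r (T : seq C) :
  contour_ae_iter eps (fun xs : r.-tuple (R * R) => forall j : 'I_r, forall t, t \in T ->
    t + \sum_(k < r | (j <= k)%N) contour_point (tnth xs k) != 0).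
Proof.
elim: r T => [|r IH] T /=; first by case.
apply: contour_ae_sub (contour_ae_add_seq_neq0 T) => x hx.
apply: (contour_ae_iter_sub _ (IH (T ++ [seq t + contour_point x | t <- T]))).
move=> xs h j t tT; rewrite big_mkcond big_ord_recl /= tnth0.
have -> : \sum_(i < r) (if (j <= bump 0 i)%N then
    contour_point (tnth [tuple of x :: xs] (lift ord0 i)) else 0) =
    \sum_(i < r | (j <= i.+1)%N) contour_point (tnth xs i).
  by rewrite [RHS]big_mkcond; apply: eq_bigr => i _; rewrite tnthS /bump add1n.
case: (unliftP ord0 j) => [i ->|->] /=.
  by rewrite /bump add1n /= add0r; apply: h; rewrite mem_cat tT.
rewrite addrA; case: r {IH j} xs h => [|r] xs h.
  by rewrite big_ord0 addr0; exact: hx.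
apply: (h ord0); rewrite mem_cat; apply/orP; right.
exact: (map_f (fun u => u + contour_point x) tT).
Qed.

Definition generic_points r (xs : r.-tuple (R * R)) : Prop :=
  (forall k, near_contour (tnth xs k)) /\
  forall j : 'I_r, \sum_(k < r | (j <= k)%N) contour_point (tnth xs k) != 0.

Lemma contour_ae_generic r :
  contour_ae_iter eps (fun xs : r.-tuple (R * R) => generic_points xs).
Proof.
apply: (contour_ae_iter_sub _ (contour_ae_iterI (contour_ae_iter_near r)
  (contour_ae_partial_sums r [:: 0]))) => xs [h1 h2].
by split => // j; rewrite -[X in X != 0]add0r; apply: h2; rewrite inE.
Qed.

Lemma cabs_contour_power (x : R * R) (s : R) :
  cabs (contour_power x s%:C) = expR (s * ln x.1).
Proof. by rewrite cabs_expC Re_mul /= mul0r subr0. Qed.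

End ContourPoints.

(** * Iterated contour integrals of exponential sums *)

Section IntegrandApproximation.
Local Open Scope classical_set_scope.
Local Open Scope complex_scope.
Local Open Scope ring_scope.
Variable R : realType.
Local Notation C := R[i].
Local Notation mu := (@lebesgue_measure R).
Local Notation "z .re" := (complex.Re z) (at level 2, format "z .re").
Local Notation "z .im" := (complex.Im z) (at level 2, format "z .im").

Lemma prod_sub_bound r (a b : 'I_r -> C) (w : 'I_r -> R) (A e : R) :
  1 <= A -> 0 <= e -> (forall j, 0 <= w j) ->
  (forall j, cabs (a j) <= A * w j) -> (forall j, cabs (b j) <= A * w j) ->
  (forall j, cabs (a j - b j) <= e * w j) ->
  cabs (\prod_j a j - \prod_j b j) <= r%:R * A ^+ r * e * \prod_j w j.
Proof.
move=> A1 e0; have A0 : 0 <= A by apply: le_trans A1.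
elim: r a b w => [|r IH] a b w w0 ha hb hab.
  by rewrite !big_ord0 subrr cabs0 !mul0r.
rewrite !big_ord_recl /=; set P := \prod_i _; set Q := \prod_i b _.
set W := \prod_i w _.
have W0 : 0 <= W by apply: prodr_ge0.
have hP : cabs P <= A ^+ r * W.
  rewrite cabs_prod -[r in A ^+ r]card_ord -prodr_const -big_split /=.
  by apply: ler_prod => i _; rewrite cabs_ge0 ha.
have hPQ : cabs (P - Q) <= r%:R * A ^+ r * e * W by apply: IH.
have -> : a ord0 * P - b ord0 * Q = (a ord0 - b ord0) * P + b ord0 * (P - Q) by ring.
apply: le_trans (cabsD _ _) _; rewrite !cabsM.
have h1 : cabs (a ord0 - b ord0) * cabs P <= (e * w ord0) * (A ^+ r * W).
  by apply: ler_pM; rewrite ?cabs_ge0.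
have h2 : cabs (b ord0) * cabs (P - Q) <= (A * w ord0) * (r%:R * A ^+ r * e * W).
  by apply: ler_pM; rewrite ?cabs_ge0.
apply: le_trans (lerD h1 h2) _; rewrite exprS -natr1.
have h3 : (e * w ord0) * (A ^+ r * W) <= A * ((e * w ord0) * (A ^+ r * W)).
  by rewrite ler_peMl// !mulr_ge0// exprn_ge0.
lra.
Qed.

Variable eps : R.
Hypothesis eps0 : 0 < eps.

Lemma near_contour_Re (x : R * R) : near_contour eps x -> - eps <= (contour_point x).re.
Proof. by case; lra. Qed.

Lemma partial_sum_half_strip r (xs : r.-tuple (R * R)) (j : 'I_r) :
  r%:R * eps <= 4^-1 -> generic_points eps xs ->
  half_strip (\sum_(k < r | (j <= k)%N) contour_point (tnth xs k)).
Proof.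
move=> reps [hx _]; split.
  rewrite Re_sum; apply: (@le_trans _ _ (- (r%:R * eps))); first by rewrite lerN2.
  rewrite -mulrN mulr_natl -[r in X in X <= _]card_ord -sumr_const.
  rewrite [leRHS]big_mkcond /=; apply: ler_sum => k _; case: ifP => _.
    exact: near_contour_Re.
  by move: eps0; lra.
rewrite Im_sum; apply: le_trans (ler_norm_sum _ _ _) _.
apply: le_trans reps; rewrite mulr_natl -[r in X in _ <= X]card_ord -sumr_const.
rewrite [leLHS]big_mkcond /=; apply: ler_sum => k _; case: ifP => _.
  by case: (hx k).
exact: ltW.
Qed.

(** The factor 4 pays for replacing Re t by |t| in the exponential, at the price 2,
    and for the remaining factors of the integrand, at most 2 for each variable. *)
Definition contour_weight (s x : R) : R := 4 * pow_exp 2^-1 (s - 1) x.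

Lemma contour_weight_ge0 s x : 0 <= contour_weight s x.
Proof. by rewrite mulr_ge0// pow_exp_ge0. Qed.

Lemma integrable_contour_weight s :
  mu.-integrable `[eps, +oo[ (EFin \o contour_weight s).
Proof. by apply: integrable_scale => //; apply: integrable_pow_exp. Qed.

(** The full sum, which occurs for j = 0, gives decay in every variable; the other
    factors are bounded on the half-strip. *)
Lemma prod_weight_le r (s : 'I_r -> R) (xs : r.-tuple (R * R)) :
  r%:R * eps <= 4^-1 -> generic_points eps xs ->
  (\prod_(j < r) expR (- (2^-1 *
     (\sum_(k < r | (j <= k)%N) contour_point (tnth xs k)).re))) *
  \prod_k cabs (contour_power (tnth xs k) (s k - 1)%:C) <=
  \prod_k contour_weight (s k) (tnth xs k).1.
Proof.
case: r s xs => [|r] s xs reps hg; first by rewrite !big_ord0 mulr1.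
have eps4 : eps <= 4^-1.
  apply: le_trans reps; rewrite ler_peMl ?(ltW eps0)//.
  by rewrite ler1n.
rewrite big_ord_recl.
have h0 : expR (- (2^-1 *
     (\sum_(k < r.+1 | (@ord0 r <= k)%N) contour_point (tnth xs k)).re)) <=
   \prod_(k < r.+1) (2 * expR (- (2^-1 * (tnth xs k).1))).
  rewrite Re_sum mulr_sumr -sumrN expR_sum; apply: ler_prod => k _.
  apply/andP; split; first exact: expR_ge0.
  have [_ _ h] := hg.1 k.
  have e2 : expR eps <= 2.
    apply: (@le_trans _ _ (expR 4^-1)); first by rewrite ler_expR.
    by apply: le_trans (expR_quarter R) _; lra.
  apply: (@le_trans _ _ (expR eps * expR (- (2^-1 * (tnth xs k).1)))).
    by rewrite -expRD ler_expR; lra.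
  by rewrite ler_wpM2r ?expR_ge0.
have h1 : \prod_(i < r) expR (- (2^-1 *
     (\sum_(k < r.+1 | (lift ord0 i <= k)%N) contour_point (tnth xs k)).re)) <= 2 ^+ r.
  rewrite -[r in X in _ <= X]card_ord -prodr_const; apply: ler_prod => i _.
  apply/andP; split; first exact: expR_ge0.
  have [h _] := partial_sum_half_strip (lift ord0 i) reps hg.
  apply: (@le_trans _ _ (4 / 3)); last by lra.
  by apply: expR_half_strip => //; lra.
have p0 : 0 <= \prod_(k < r.+1) cabs (contour_power (tnth xs k) (s k - 1)%:C).
  by apply: prodr_ge0 => k _; exact: cabs_ge0.
apply: (@le_trans _ _ ((\prod_(k < r.+1) (2 * expR (- (2^-1 * (tnth xs k).1))) * 2 ^+ r.+1) *
   \prod_k cabs (contour_power (tnth xs k) (s k - 1)%:C))).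
  rewrite ler_wpM2r//; apply: ler_pM => //; rewrite ?expR_ge0//.
    by apply: prodr_ge0 => i _; exact: expR_ge0.
  by apply: le_trans h1 _; rewrite exprS ler_peMl// ?exprn_ge0//; lra.
rewrite -[X in 2 ^+ X]card_ord -prodr_const.
rewrite [X in _ * X](eq_bigr (fun k => expR ((s k - 1) * ln (tnth xs k).1))); last first.
  by move=> k _; exact: cabs_contour_power.
rewrite -!big_split /=; apply: ler_prod => k _; rewrite /contour_weight /pow_exp.
apply/andP; split; first by rewrite !mulr_ge0 ?expR_ge0.
by rewrite le_eqVlt; apply/orP; left; apply/eqP; ring.
Qed.

Lemma integrand_sub_bound r (s : 'I_r -> R) (xs : r.-tuple (R * R)) (f1 f2 : C -> C)
    (A e : R) : r%:R * eps <= 4^-1 -> generic_points eps xs -> 1 <= A -> 0 <= e ->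
  (forall z, half_strip z -> z != 0 ->
    [/\ cabs (f1 z) <= A * expR (- (2^-1 * z.re)),
        cabs (f2 z) <= A * expR (- (2^-1 * z.re)) &
        cabs (f1 z - f2 z) <= e * expR (- (2^-1 * z.re))]) ->
  cabs ((\prod_(j < r) f1 (\sum_(k < r | (j <= k)%N) contour_point (tnth xs k))) *
         \prod_k contour_power (tnth xs k) (s k - 1)%:C -
        (\prod_(j < r) f2 (\sum_(k < r | (j <= k)%N) contour_point (tnth xs k))) *
         \prod_k contour_power (tnth xs k) (s k - 1)%:C) <=
  r%:R * A ^+ r * e * \prod_k contour_weight (s k) (tnth xs k).1.
Proof.
move=> reps hg A1 e0 hf; rewrite -mulrBl cabsM cabs_prod.
have hS (j : 'I_r) := hf _ (partial_sum_half_strip j reps hg) (hg.2 j).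
have A0 : 0 <= A by apply: le_trans A1.
apply: (@le_trans _ _ (r%:R * A ^+ r * e * \prod_(j < r) expR (- (2^-1 *
     (\sum_(k < r | (j <= k)%N) contour_point (tnth xs k)).re)) *
   \prod_k cabs (contour_power (tnth xs k) (s k - 1)%:C))).
  rewrite ler_wpM2r//; first by apply: prodr_ge0 => k _; exact: cabs_ge0.
  apply: prod_sub_bound => // j; rewrite ?expR_ge0//; by have [] := hS j.
rewrite -mulrA ler_wpM2l ?mulr_ge0 ?exprn_ge0//.
exact: prod_weight_le.
Qed.

(** The integrand of Hankel's integral for n^-s. *)
Definition exp_power (n : nat) (s : R) (x : R * R) : C :=
  expC (- (n%:R * contour_point x)) * contour_power x (s - 1)%:C.

Lemma cderiv_integrableC (f : R -> C) (a b : R) :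
  (forall t, exists d, cderiv f t d) -> integrableC `[a, b] f.
Proof.
move=> hf; split; apply: continuous_compact_integrable;
  [exact: segment_compact| |exact: segment_compact|];
  apply: continuous_subspaceT => t;
  by have [d /cderiv_continuous[? ?]] := hf t.
Qed.

Lemma contour_power_top rho (s : R) : contour_power (rho, 0) s%:C = (expR (s * ln rho))%:C.
Proof.
rewrite /contour_power -expC_real; congr expC; apply/eqP; rewrite eq_complex.
by rewrite Re_mul Im_mul /= !mulr0 !mul0r subr0 addr0 !eqxx.
Qed.

Lemma contour_power_arg rho theta (s : R) : contour_power (rho, theta) s%:C =
  expC (0 +i* (s * theta)) * (expR (s * ln rho))%:C.
Proof.
rewrite /contour_power -expC_real -expCD; congr expC; apply/eqP.
by rewrite eq_complex Re_mul Im_mul Re_add Im_add /= !mul0r !subr0 !add0r !addr0 !eqxx.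
Qed.

Lemma exp_power_ray n (s rho : R) : exp_power n s (rho, 0) = (pow_exp n%:R (s - 1) rho)%:C.
Proof.
rewrite /exp_power contour_point_top contour_power_top /pow_exp real_complexM.
by rewrite -real_complex_nat -real_complexM -real_complexN expC_real.
Qed.

Lemma exp_power_bottom n (s rho : R) : exp_power n s (rho, 2 * pi) =
  expC (0 +i* ((s - 1) * (2 * pi))) * (pow_exp n%:R (s - 1) rho)%:C.
Proof.
rewrite /exp_power contour_point_bottom contour_power_arg /pow_exp real_complexM.
by rewrite -real_complex_nat -real_complexM -real_complexN expC_real mulrCA.
Qed.

Lemma cderiv_contour_point (rho t : R) :
  cderiv (fun t => contour_point (rho, t)) t ((0 +i* 1) * contour_point (rho, t)).
Proof.
rewrite /contour_point.
have h : cderiv (fun t => 0 +i* t) t (0 +i* 1 : C).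
  by split => /=; [exact: is_derive_cst|exact: is_derive_id].
apply: cderiv_ext (cderivZ rho%:C (cderiv_expC h)) => //=.
by rewrite mulrCA.
Qed.

Lemma cderiv_contour_power (rho s t : R) :
  cderiv (fun t => contour_power (rho, t) s%:C) t
    ((0 +i* s) * contour_power (rho, t) s%:C).
Proof.
have h : cderiv (fun t => ln rho +i* t) t (0 +i* 1 : C).
  by split => /=; [exact: is_derive_cst|exact: is_derive_id].
apply: cderiv_ext (cderiv_expC (cderivZ s%:C h)) => //.
congr (_ * _); apply/eqP; rewrite eq_complex Re_mul Im_mul /=.
by rewrite !mulr0 !mul0r mulr1 subr0 addr0 !eqxx.
Qed.

Lemma cderiv_exp_contour (a rho t : R) :
  cderiv (fun t => expC (- (a%:C * contour_point (rho, t)))) t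
    (- (a%:C * ((0 +i* 1) * contour_point (rho, t))) *
      expC (- (a%:C * contour_point (rho, t)))).
Proof.
exact: cderiv_expC (cderivN (cderivZ a%:C (cderiv_contour_point rho t))).
Qed.

Lemma contour_integrable_exp_power n (s : R) : (0 < n)%N ->
  contour_integrable eps (exp_power n s).
Proof.
move=> n0; have n0' : 0 < n%:R :> R by rewrite ltr0n.
have h : integrableC `[eps, +oo[ (fun rho => (pow_exp n%:R (s - 1) rho)%:C).
  by apply: integrableC_real => //; exact: integrable_pow_exp.
split.
- by apply: eq_integrableC h => // rho _; rewrite exp_power_ray.
- apply: cderiv_integrableC => t; eexists.
  apply: cderivM; last exact: cderivZ (cderiv_contour_point _ _).
  rewrite /exp_power -(real_complex_nat R n).
  exact: cderivM (cderiv_exp_contour _ _ _) (cderiv_contour_power _ _ _).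
- apply: eq_integrableC (integrableCZ (expC (0 +i* ((s - 1) * (2 * pi)))) _ h) => //.
  by move=> rho _; rewrite exp_power_bottom.
Qed.

Definition exponent_sum r (N : nat) (m : {ffun 'I_r -> 'I_N}) (k : 'I_r) : nat :=
  \sum_(j < r | (j <= k)%N) (m j).+1.

Lemma exponent_sum_gt0 r N (m : {ffun 'I_r -> 'I_N}) k : (0 < exponent_sum m k)%N.
Proof. by rewrite /exponent_sum (bigD1 k)//= addSn. Qed.

(** The substitution of S_j = t_j + ... + t_r turns the exponents m_j + 1 into
    their partial sums. *)
Lemma integrand_expansion r (P : {poly C}) (s : 'I_r -> R) (xs : r.-tuple (R * R)) :
  (\prod_(j < r) (let z := \sum_(k < r | (j <= k)%N) contour_point (tnth xs k) in
      expC (- z) * P.[expC (- z)])) *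
    \prod_k contour_power (tnth xs k) (s k - 1)%:C =
  \sum_(m : {ffun 'I_r -> 'I_(size P)}) (\prod_j P`_(m j)) *
    \prod_k exp_power (exponent_sum m k) (s k) (tnth xs k).
Proof.
have e (z : C) : expC (- z) * P.[expC (- z)] =
    \sum_(i < size P) P`_i * expC (- (i.+1%:R * z)).
  rewrite horner_coef mulr_sumr; apply: eq_bigr => i _.
  by rewrite -mulrN expCMn exprS mulrCA.
rewrite [X in X * _](eq_bigr (fun j : 'I_r => \sum_(i < size P) P`_i *
  expC (- (i.+1%:R * \sum_(k < r | (j <= k)%N) contour_point (tnth xs k)))));
  last by move=> j _; exact: e.
rewrite bigA_distr_bigA /= mulr_suml; apply: eq_bigr => m _.
have eR : \prod_k exp_power (exponent_sum m k) (s k) (tnth xs k) =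
    (\prod_k expC (- ((exponent_sum m k)%:R * contour_point (tnth xs k)))) *
    \prod_k contour_power (tnth xs k) (s k - 1)%:C by exact: big_split.
have eL : \prod_j (P`_(m j) * expC (- ((m j).+1%:R *
      \sum_(k < r | (j <= k)%N) contour_point (tnth xs k)))) =
    (\prod_j P`_(m j)) * \prod_j expC (- ((m j).+1%:R *
      \sum_(k < r | (j <= k)%N) contour_point (tnth xs k))) by exact: big_split.
rewrite eR eL -mulrA; congr (_ * (_ * _)).
rewrite -!expC_sum; congr expC.
rewrite !sumrN; congr (- _).
under eq_bigr do rewrite mulr_sumr.
rewrite (exchange_big_dep predT) //=; apply: eq_bigr => k _.
by rewrite /exponent_sum natr_sum mulr_suml.
Qed.

(** For exponential sums the integrand is a sum of products of functions of one
    variable, so its iterated integral is a sum of products of contour integrals;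
    stability transfers this value to nearby integrands. *)
Lemma contour_integral_iter_approx r (P : {poly C}) (c : C) (s : 'I_r -> R) (M : R)
    (F : r.-tuple (R * R) -> C) : 0 <= M ->
  (forall xs, generic_points eps xs ->
    cabs (F xs - c * ((\prod_(j < r)
        (let z := \sum_(k < r | (j <= k)%N) contour_point (tnth xs k) in
          expC (- z) * P.[expC (- z)])) *
        \prod_k contour_power (tnth xs k) (s k - 1)%:C)) <=
    M * \prod_k contour_weight (s k) (tnth xs k).1) ->
  cabs (contour_integral_iter eps F - c *
    \sum_(m : {ffun 'I_r -> 'I_(size P)}) (\prod_j P`_(m j)) *
      \prod_k contour_integral eps (exp_power (exponent_sum m k) (s k))) <=
  M * \prod_k contour_mass eps (contour_weight (s k)).
Proof.
move=> M0 hF.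
have hm (m : {ffun 'I_r -> 'I_(size P)}) := @iter_prod R eps r (c * \prod_j P`_(m j))
  (fun k => exp_power (exponent_sum m k) (s k))
  (fun k => contour_integrable_exp_power (s k) (exponent_sum_gt0 m k)).
have [i1 i2] := @iter_sum R eps r _ (index_enum _) _ (fun m => (hm m).1).
have -> : c * \sum_(m : {ffun 'I_r -> 'I_(size P)}) (\prod_j P`_(m j)) *
      \prod_k contour_integral eps (exp_power (exponent_sum m k) (s k)) =
   contour_integral_iter eps (fun xs : r.-tuple (R * R) =>
     \sum_(m : {ffun 'I_r -> 'I_(size P)}) c * \prod_j P`_(m j) *
       \prod_k exp_power (exponent_sum m k) (s k) (tnth xs k)).
  rewrite i2 mulr_sumr; apply: eq_bigr => m _.
  by have [_ ->] := hm m; rewrite mulrA.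
apply: contour_integral_iter_perturb => //.
- by move=> k x; exact: contour_weight_ge0.
- by move=> k; exact: integrable_contour_weight.
apply: (contour_ae_iter_sub _ (contour_ae_generic eps0 r)) => xs /hF.
rewrite integrand_expansion mulr_sumr (eq_bigr (fun m : {ffun 'I_r -> 'I_(size P)} =>
  c * \prod_j P`_(m j) * \prod_k exp_power (exponent_sum m k) (s k) (tnth xs k)))//.
by move=> m _; rewrite mulrA.
Qed.

End IntegrandApproximation.

(** * Gamma integrals on the real axis *)

Section RealGammaIntegral.
Local Open Scope classical_set_scope.
Local Open Scope ring_scope.
Variable R : realType.
Local Notation mu := (@lebesgue_measure R).
Implicit Types (a b e x L s : R).

Lemma le0_of_exp_decay x b0 C c : 0 < c ->
  (forall b, b0 < b -> x <= C * expR (- (c * b))) -> x <= 0.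
Proof.
move=> c0 h; rewrite leNgt; apply/negP => x0.
pose b := Num.max (b0 + 1) (Num.max 0 (C / (c * x))).
have b1 : b0 < b by rewrite /b lt_max ltrDl ltr01.
have b2 : 0 <= b by rewrite /b !le_max lexx orbT.
have b3 : C / (c * x) <= b by rewrite /b !le_max lexx !orbT.
have := h b b1; rewrite expRN -ler_pdivrMr ?invr_gt0 ?expR_gt0// invrK => h'.
have cb0 : 0 <= c * b by rewrite mulr_ge0// ltW.
have h1 := expR_ge1Dx (c * b).
have h2 : C <= b * (c * x) by rewrite -ler_pdivrMr// mulr_gt0.
have h3 : x * (1 + c * b) <= x * expR (c * b) by rewrite ler_pM2l.
have h4 : x * expR (c * b) <= C by exact: h'.
have h5 : x * (1 + c * b) = x + b * (c * x) by ring.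
lra.
Qed.

Lemma le0_of_linear x C b0 : 0 < b0 ->
  (forall b, 0 < b <= b0 -> x <= C * b) -> x <= 0.
Proof.
move=> b00 h; rewrite leNgt; apply/negP => x0.
have C0 : 0 < C.
  have := h b0; rewrite b00 lexx => /(_ isT) h1.
  by rewrite -(pmulr_lgt0 _ b00); apply: lt_le_trans h1.
pose b := Num.min b0 (x / (2 * C)).
have b1 : 0 < b by rewrite lt_min b00 divr_gt0// mulr_gt0.
have b2 : b <= b0 by rewrite ge_min lexx.
have b3 : b <= x / (2 * C) by rewrite ge_min lexx orbT.
have h1 := h b; rewrite b1 b2 in h1; have {}h1 := h1 isT.
have : C * b <= C * (x / (2 * C)) by rewrite ler_pM2l.
have -> : C * (x / (2 * C)) = x / 2 by field; rewrite gt_eqF.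
lra.
Qed.

Lemma Rintegral_split (f : R -> R) a b : a <= b ->
  mu.-integrable `[a, +oo[ (EFin \o f) ->
  \int[mu]_(x in `[a, +oo[) f x =
  \int[mu]_(x in `[a, b]) f x + \int[mu]_(x in `]b, +oo[) f x.
Proof.
move=> ab hi.
have h := @Rintegral_itvB R f (BLeft a) +oo%O b hi _ _.
by rewrite -h ?bnd_simp//; ring.
Qed.

Lemma integrable_sub_itv (f : R -> R) (D E : set R) : measurable D -> measurable E ->
  E `<=` D -> mu.-integrable D (EFin \o f) -> mu.-integrable E (EFin \o f).
Proof. by move=> mD mE ED; exact: (@integrableS _ _ _ mu D E). Qed.

Lemma Rintegral_tail_le (f : R -> R) a b : a <= b ->
  (forall x, a <= x -> 0 <= f x) -> mu.-integrable `[a, +oo[ (EFin \o f) ->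
  \int[mu]_(x in `]b, +oo[) f x <= \int[mu]_(x in `[a, +oo[) f x.
Proof.
move=> ab f0 hi; rewrite (Rintegral_split ab hi) lerDr.
by apply: Rintegral_ge0 => x; rewrite /= in_itv /= => /andP[ax _]; exact: f0.
Qed.

Lemma FTC_segment (f F : R -> R) a b : a < b ->
  (forall x, a <= x <= b -> is_derive x 1 F (f x)) ->
  (forall x, a <= x <= b -> {for x, continuous f}) ->
  \int[mu]_(x in `[a, b]) f x = F b - F a.
Proof.
move=> ab hF hf.
have cF x : a <= x <= b -> {for x, continuous F}.
  move=> /hF[dF _].
  by apply: differentiable_continuous; apply/derivable1_diffP.
rewrite /Rintegral (@continuous_FTC2 R f F a b ab) //.
- apply: continuous_in_subspaceT => x; rewrite inE /= in_itv /=; exact: hf.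
- split.
  + by move=> x; rewrite in_itv /= => /andP[ax xb]; have [] := hF x; rewrite ?(ltW ax) ?(ltW xb).
  + by apply: cvg_at_right_filter; apply: cF; rewrite lexx ltW.
  + by apply: cvg_at_left_filter; apply: cF; rewrite lexx ltW.
- move=> x; rewrite in_itv /= => /andP[ax xb]; rewrite derive1E.
  have h : is_derive x 1 F (f x) by apply: hF; rewrite !ltW.
  exact: derive_val.
Qed.

Lemma FTC_decay (f F : R -> R) e a K : 0 < a -> 0 < e ->
  (forall x, e <= x -> is_derive x 1 F (f x)) ->
  (forall x, e <= x -> {for x, continuous f}) ->
  (forall x, e <= x -> `|f x| <= K * expR (- (a * x))) ->
  (forall x, e <= x -> `|F x| <= K * expR (- (a * x))) ->
  mu.-integrable `[e, +oo[ (EFin \o f) ->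
  \int[mu]_(x in `[e, +oo[) f x = - F e.
Proof.
move=> a0 e0 hF cf bf bF hi.
have K0 : 0 <= K.
  have := bf e (lexx _); rewrite -ler_pdivrMr ?expR_gt0//.
  by apply: le_trans; rewrite divr_ge0 ?expR_ge0.
have a2 : 0 < a / 2 by rewrite divr_gt0.
have mI b : measurable (`]b, +oo[ : set R) by exact: measurable_itv.
have iw : mu.-integrable `[e, +oo[ (EFin \o (fun x => K * expR (- (a / 2 * x)))).
  apply: integrable_scale => //; apply: integrable_exp_decay => // x.
  by rewrite /= !in_itv /= !andbT; exact: le_trans (ltW e0).
set T := \int[mu]_(x in `[e, +oo[) (K * expR (- (a / 2 * x))).
have T0 : 0 <= T by apply: Rintegral_ge0 => x _; rewrite mulr_ge0 ?expR_ge0.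
apply/eqP; rewrite -subr_eq0 opprK -normr_eq0; apply/eqP/le_anti.
rewrite normr_ge0 andbT.
apply: (@le0_of_exp_decay _ e (K + T) (a / 2) a2) => b eb.
have hs : \int[mu]_(x in `[e, b]) f x = F b - F e.
  by apply: FTC_segment => // x /andP[ex _]; [exact: hF|exact: cf].
rewrite (Rintegral_split (ltW eb) hi) hs.
have -> : F b - F e + \int[mu]_(x in `]b, +oo[) f x + F e =
  F b + \int[mu]_(x in `]b, +oo[) f x by ring.
have sub : `]b, +oo[ `<=` (`[e, +oo[ : set R).
  by move=> x; rewrite /= !in_itv /= !andbT => bx; rewrite ltW// (lt_trans eb).
have ib : mu.-integrable `]b, +oo[ (EFin \o f) by apply: integrable_sub_itv hi.
have iwb : mu.-integrable `]b, +oo[ (EFin \o (fun x => K * expR (- (a / 2 * x)))).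
  by apply: integrable_sub_itv iw.
(* One half of the decay keeps the tail integrable, the other makes it small. *)
have half x : expR (- (a * x)) = expR (- (a / 2 * x)) * expR (- (a / 2 * x)).
  by rewrite -expRD; congr expR; field.
have e1 x : 0 <= x -> expR (- (a / 2 * x)) <= 1.
  by move=> x0; rewrite expR_le1 oppr_le0 mulr_ge0// ltW.
have b0 : 0 < b by apply: lt_trans eb.
apply: le_trans (ler_normD _ _) _; rewrite mulrDl; apply: lerD.
  apply: le_trans (bF b (ltW eb)) _; rewrite half mulrA ler_piMr ?e1 ?(ltW b0)//.
  by rewrite mulr_ge0 ?expR_ge0.
apply: le_trans (le_normr_Rintegral _ ib) _ => //.
apply: (@le_trans _ _ (\int[mu]_(x in `]b, +oo[)
    (expR (- (a / 2 * b)) * (K * expR (- (a / 2 * x)))))).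
  apply: le_Rintegral => //.
  - by have := @integrable_norm _ _ _ mu _ _ ib.
  - exact: integrable_scale.
  move=> x; rewrite /= in_itv /= andbT => bx.
  apply: le_trans (bf x _) _; first by rewrite ltW// (lt_trans eb).
  rewrite half mulrCA ler_wpM2r ?mulr_ge0 ?expR_ge0//.
  by rewrite ler_expR lerN2 ler_pM2l// ltW.
rewrite RintegralZl// mulrC ler_wpM2r ?expR_ge0//.
apply: Rintegral_tail_le => //; first exact: ltW.
by move=> x _; rewrite mulr_ge0 ?expR_ge0.
Qed.

Lemma pow_exp_pred L s x : 0 < x -> pow_exp L (s - 1) x = pow_exp L s x / x.
Proof.
by move=> x0; rewrite /pow_exp mulrBl mul1r expRD mulrA [expR (- ln x)]expRN lnK ?posrE.
Qed.

Lemma is_derive_pow_exp L s x : 0 < x ->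
  is_derive x 1 (pow_exp L s) (s * pow_exp L (s - 1) x - L * pow_exp L s x).
Proof.
move=> x0.
have h1 : is_derive x 1 (fun x => - (L * x)) (- L).
  have h := is_deriveN (is_deriveZ L (is_derive_id x (1 : R))).
  by apply: (is_derive_eq h); rewrite /GRing.scale /= mulr1.
have h2 : is_derive x 1 (fun x => s * ln x) (s * x^-1).
  exact: (is_deriveZ s (is_derive1_ln x0)).
have e1 := is_derive1_comp (is_derive_expR _) h1.
have e2 := is_derive1_comp (is_derive_expR _) h2.
have h := is_deriveM e1 e2; apply: (is_derive_eq h).
rewrite pow_exp_pred// /pow_exp /GRing.scale /=; field; rewrite gt_eqF//.
Qed.

Lemma continuous_pow_exp L s x : 0 < x -> {for x, continuous (pow_exp L s)}.
Proof.
move=> x0; have [dF _] := is_derive_pow_exp L s x0.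
by apply: differentiable_continuous; apply/derivable1_diffP.
Qed.

Lemma pow_exp_decay L s e : 0 < L -> 0 < e ->
  exists2 K, 0 <= K & forall x, e <= x -> pow_exp L s x <= K * expR (- (L / 2 * x)).
Proof.
move=> L0 e0; have L2 : 0 < L / 2 by rewrite divr_gt0.
have [K hK] := @mul_ln_le R s (L / 2) e L2 e0.
exists (expR K); first exact: expR_ge0.
move=> x xe; rewrite /pow_exp -!expRD ler_expR.
by have := hK x xe; lra.
Qed.

(** Incomplete gamma function: the value is Gamma(s, L e) / L^s. *)
Definition ray_integral L e s : R := \int[mu]_(x in `[e, +oo[) pow_exp L (s - 1) x.

Lemma ray_integral_rec L e s : 0 < L -> 0 < e ->
  s * ray_integral L e s - L * ray_integral L e (s + 1) = - pow_exp L s e.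
Proof.
move=> L0 e0; rewrite /ray_integral addrK.
have mI : measurable (`[e, +oo[ : set R) by exact: measurable_itv.
have i1 := @integrable_pow_exp R L (s - 1) e L0 e0.
have i2 := @integrable_pow_exp R L s e L0 e0.
have s1 := integrable_scale s mI i1; have s2 := integrable_scale L mI i2.
rewrite -!RintegralZl// -RintegralB//.
have [K1 K10 hK1] := pow_exp_decay (s - 1) L0 e0.
have [K2 K20 hK2] := pow_exp_decay s L0 e0.
have pos x : e <= x -> 0 < x by exact: lt_le_trans.
have L2 : 0 < L / 2 by rewrite divr_gt0.
apply: (@FTC_decay _ _ e (L / 2) (`|s| * K1 + L * K2 + K2) L2 e0).
- by move=> x /pos; exact: is_derive_pow_exp.
- move=> x /pos x0; apply: cvgB; apply: cvgZr; exact: continuous_pow_exp.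
- move=> x ex; apply: le_trans (ler_normB _ _) _; rewrite (normrM s) (normrM L).
  rewrite !(ger0_norm (pow_exp_ge0 _ _ _)) (gtr0_norm L0).
  have := ler_wpM2l (normr_ge0 s) (hK1 x ex).
  have := ler_wpM2l (ltW L0) (hK2 x ex).
  have : 0 <= K2 * expR (- (L / 2 * x)) by rewrite mulr_ge0 ?expR_ge0.
  lra.
- move=> x ex; rewrite ger0_norm ?pow_exp_ge0//.
  apply: le_trans (hK2 x ex) _; rewrite ler_wpM2r ?expR_ge0// lerDr.
  by rewrite addr_ge0 ?mulr_ge0 ?(ltW L0).
- exact: integrable_sub.
Qed.

(** Euler's integral for Gamma(s) / L^s. *)
Definition gamma_integral L s : R := \int[mu]_(x in `]0, +oo[) pow_exp L (s - 1) x.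

Lemma gamma_ray_split L e s : 0 < L -> 0 < e -> 1 <= s ->
  gamma_integral L s =
  \int[mu]_(x in `]0, e]) pow_exp L (s - 1) x + ray_integral L e s.
Proof.
move=> L0 e0 s1; have hs : 0 <= s - 1 by rewrite subr_ge0.
have hi := integrable_pow_exp0 L0 hs.
have h := @Rintegral_itvB R (pow_exp L (s - 1)) (BRight 0) +oo%O e hi _ _.
rewrite /gamma_integral /ray_integral -Rintegral_itv_obnd_cbnd; last first.
  apply: integrable_sub_itv hi => // x; rewrite /= !in_itv /= !andbT.
  exact: lt_trans.
by rewrite -h ?bnd_simp ?(ltW e0)//; ring.
Qed.

Lemma gamma_head_bound L e s : 0 < L -> 0 < e -> 1 <= s ->
  0 <= gamma_integral L s - ray_integral L e s <= expR (s * ln e).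
Proof.
move=> L0 e0 s1; rewrite (gamma_ray_split L0 e0 s1) addrK.
have mI : measurable (`]0, e] : set R) by exact: measurable_itv.
apply/andP; split.
  by apply: Rintegral_ge0 => x _; exact: pow_exp_ge0.
have hs : 0 <= s - 1 by rewrite subr_ge0.
have me : mu (`]0, e] : set R) = e%:E.
  by rewrite lebesgue_measure_itv /= lte_fin e0 oppr0 adde0.
apply: (@le_trans _ _ (\int[mu]_(x in `]0, e]) expR ((s - 1) * ln e))).
  apply: le_Rintegral => //.
  - apply: integrable_sub_itv (integrable_pow_exp0 L0 hs) => // x.
    by rewrite /= !in_itv /= => /andP[-> _].
  - apply: (@integrable_sub_itv _ `[0, e]) => //.
      by move=> x; rewrite /= !in_itv /= => /andP[/ltW -> ->].
    apply: continuous_compact_integrable; first exact: segment_compact.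
    by move=> x; exact: cvg_cst.
  move=> x; rewrite /= in_itv /= => /andP[x0 xe].
  rewrite /pow_exp -expRD ler_expR.
  have h : (s - 1) * ln x <= (s - 1) * ln e by rewrite ler_wpM2l// ler_ln.
  have h0 : 0 <= L * x by rewrite mulr_ge0 ?ltW.
  lra.
have fe : fine (mu (`]0, e] : set R)) = e by rewrite me.
rewrite Rintegral_cst// fe -[X in _ * X](lnK e0) -expRD ler_expR; lra.
Qed.

Lemma expR_mul_ln_le s e : 1 <= s -> 0 < e <= 1 -> expR (s * ln e) <= e.
Proof.
move=> s1 /andP[e0 e1]; rewrite -[leRHS](lnK e0) ler_expR.
have : ln e <= 0 by exact: ln_le0.
nra.
Qed.

(** Integration by parts on the ray from e, followed by e -> 0. *)
Lemma gamma_integral_rec L s : 0 < L -> 1 <= s ->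
  s * gamma_integral L s = L * gamma_integral L (s + 1).
Proof.
move=> L0 s1; apply/eqP; rewrite -subr_eq0 -normr_eq0; apply/eqP/le_anti.
rewrite normr_ge0 andbT.
apply: (@le0_of_linear _ (s + L + 1) 1) => // e /andP[e0 e1].
have hr := @ray_integral_rec L e s L0 e0.
have s2 : 1 <= s + 1 by lra.
have := gamma_head_bound L0 e0 s1; have := gamma_head_bound L0 e0 s2.
have e01 : 0 < e <= 1 by rewrite e0.
have q1 := expR_mul_ln_le s1 e01; have q2 := expR_mul_ln_le s2 e01.
have q3 : pow_exp L s e <= e.
  apply: le_trans q1; rewrite /pow_exp ler_piMl ?expR_ge0//.
  by rewrite expR_le1 oppr_le0 mulr_ge0 ?ltW//.
have q4 := pow_exp_ge0 L s e.
set G := gamma_integral L s; set G' := gamma_integral L (s + 1).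
set J := ray_integral L e s in hr *; set J' := ray_integral L e (s + 1) in hr *.
move=> /andP[a1 a2] /andP[b1 b2].
have -> : s * G - L * G' = s * (G - J) - L * (G' - J') - pow_exp L s e by lra.
have c1 : s * (G - J) <= s * e by rewrite ler_wpM2l; lra.
have c2 : L * (G' - J') <= L * e by rewrite ler_wpM2l; lra.
have c3 : 0 <= s * (G - J) by rewrite mulr_ge0//; lra.
have c4 : 0 <= L * (G' - J') by rewrite mulr_ge0// ltW.
have c5 : 0 <= L * e by rewrite mulr_ge0 ?ltW//.
have c6 : 0 <= s * e by rewrite mulr_ge0 ?(ltW e0)//; lra.
rewrite ler_norml; apply/andP; split; lra.
Qed.

Lemma ray_integral_scale L e s : 0 < L -> 0 < e ->
  ray_integral L e s = expR (- (s * ln L)) * ray_integral 1 (L * e) s.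
Proof.
move=> L0 e0; rewrite /ray_integral.
have Le0 : 0 < L * e by rewrite mulr_gt0.
have dF x : is_derive x 1 ( *%R L) L.
  have h := is_deriveZ L (is_derive_id x (1 : R)).
  by apply: (is_derive_eq h); rewrite /GRing.scale /= mulr1.
have dE : derive1 ( *%R L) = cst L.
  by apply/funext => x; rewrite derive1E; exact: derive_val.
have h := @increasing_ge0_integration_by_substitutiony R ( *%R L)
  (pow_exp 1 (s - 1)) e.
have cLe : continuous ( *%R L) by move=> x; exact: mulrl_continuous.
have -> : \int[mu]_(x in `[(L * e)%R, +oo[) pow_exp 1 (s - 1) x =
   \int[mu]_(x in `[e, +oo[) (expR (s * ln L) * pow_exp L (s - 1) x).
  rewrite /Rintegral h //; last 8 first.
  - by move=> x y _ _ xy; rewrite ltr_pM2l.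
  - by rewrite dE => x _; exact: cvg_cst.
  - by rewrite dE; apply: is_cvg_cst.
  - by rewrite dE; apply: is_cvg_cst.
  - split; first by move=> x _; have [] := dF x.
    by apply: cvg_at_right_filter; exact: cLe.
  - by apply: gt0_cvgMry => //; exact: cvg_id.
  - apply: continuous_in_subspaceT => x; rewrite inE /= in_itv /= andbT => ex.
    by apply: continuous_pow_exp; apply: lt_le_trans ex.
  - by move=> x _; exact: pow_exp_ge0.
  congr fine; apply: eq_integral => x; rewrite inE /= in_itv /= andbT => ex.
  have x0 : 0 < x by apply: lt_le_trans ex.
  rewrite dE; congr EFin; rewrite -[LHS]/(pow_exp 1 (s - 1) (L * x) * L) /pow_exp.
  rewrite mul1r lnM ?posrE// mulrDr expRD -[X in _ * X = _](lnK L0).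
  have -> : s * ln L = (s - 1) * ln L + ln L by ring.
  by rewrite expRD; ring.
rewrite RintegralZl//; last exact: integrable_pow_exp.
by rewrite mulrA -expRD addNr expR0 mul1r.
Qed.

(** The substitution x -> L x is made on the rays starting at e > 0, where the
    integrand is continuous up to the end point, before e -> 0. *)
Lemma gamma_integral_scale L s : 0 < L -> 1 <= s ->
  gamma_integral L s = expR (- (s * ln L)) * gamma_integral 1 s.
Proof.
move=> L0 s1; apply/eqP; rewrite -subr_eq0 -normr_eq0; apply/eqP/le_anti.
rewrite normr_ge0 andbT.
have b0 : 0 < Num.min 1 L^-1 by rewrite lt_min ltr01 invr_gt0.
apply: (@le0_of_linear _ (1 + expR (- (s * ln L)) * L) _ b0) => e.
rewrite le_min => /and3P[e0 e1 eL].
have Le : 0 < L * e <= 1 by rewrite mulr_gt0//= mulrC -ler_pdivlMr// mul1r.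
have [Le0 _] := andP Le.
have hs := @ray_integral_scale L e s L0 e0.
have := gamma_head_bound L0 e0 s1; have := gamma_head_bound (@ltr01 R) Le0 s1.
have e01 : 0 < e <= 1 by rewrite e0.
have q1 := expR_mul_ln_le s1 e01; have q2 := expR_mul_ln_le s1 Le.
have c0 := expR_gt0 (- (s * ln L)); set c := expR _ in c0 hs *.
set G := gamma_integral L s; set G' := gamma_integral 1 s.
set J := ray_integral L e s in hs *; set J' := ray_integral 1 (L * e) s in hs *.
move=> /andP[a1 a2] /andP[b1 b2].
have -> : G - c * G' = (G - J) - c * (G' - J') by rewrite hs; ring.
have d1 : c * (G' - J') <= c * (L * e) by rewrite ler_pM2l//; lra.
have d2 : 0 <= c * (G' - J') by rewrite mulr_ge0// ltW.
have d3 : 0 <= c * (L * e) by rewrite mulr_ge0 ?ltW//.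
rewrite ler_norml; apply/andP; split; lra.
Qed.

Lemma gamma_integral_lower s : 1 <= s -> expR (- 2) <= gamma_integral 1 s.
Proof.
move=> s1; have := gamma_head_bound (@ltr01 R) (@ltr01 R) s1 => /andP[h _].
have le12 : 1 <= 2 :> R by lra.
have hi := @integrable_pow_exp R 1 (s - 1) 1 ltr01 ltr01.
have hsp := Rintegral_split le12 hi.
have ht : 0 <= \int[mu]_(x in `]2, +oo[) pow_exp 1 (s - 1) x.
  by apply: Rintegral_ge0 => x _; exact: pow_exp_ge0.
have mI : measurable (`[1, 2] : set R) by exact: measurable_itv.
have me : fine (mu (`[1, 2] : set R)) = 1.
  by rewrite lebesgue_measure_itv /= lte_fin ltr1n /=; exact: (addrK 1 1).
have hc : \int[mu]_(x in `[1, 2]) expR (- 2) <=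
    \int[mu]_(x in `[1, 2]) pow_exp 1 (s - 1) x.
  apply: le_Rintegral => //.
  - apply: continuous_compact_integrable; first exact: segment_compact.
    by move=> x; exact: cvg_cst.
  - apply: integrable_sub_itv hi => // x.
    by rewrite /= !in_itv /= => /andP[-> _].
  move=> x; rewrite /= in_itv /= => /andP[x1 x2].
  rewrite /pow_exp -expRD ler_expR mul1r.
  have h0 : 0 <= (s - 1) * ln x by rewrite mulr_ge0 ?ln_ge0// subr_ge0.
  by clear - x2 h0; lra.
rewrite Rintegral_cst// me mulr1 in hc.
move: h; rewrite subr_ge0; apply: le_trans; rewrite /ray_integral hsp.
by apply: le_trans hc _; rewrite lerDl.
Qed.

End RealGammaIntegral.

(** * Hankel's integral *)

Section HankelFormula.
Local Open Scope classical_set_scope.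
Local Open Scope complex_scope.
Local Open Scope ring_scope.
Variable R : realType.
Local Notation C := R[i].
Local Notation mu := (@lebesgue_measure R).
Implicit Types (s x e : R) (n k : nat).

(** The monodromy factor e^(2 pi i s) between the two sides of the cut. *)
Definition monodromy s : C := expC (0 +i* (s * (2 * pi))).

Lemma monodromyD1 s : monodromy (s + 1) = monodromy s.
Proof.
have -> : monodromy (s + 1) = monodromy s * expC (0 +i* (2 * pi)).
  rewrite /monodromy -expCD; congr expC; apply/eqP.
  by rewrite eq_complex /= mulrDl mul1r addr0 !eqxx.
by rewrite [X in _ * X]/expC /= expR0 cos_2pi sin_2pi !mulr1.
Qed.

Lemma cabs_monodromy s : cabs (monodromy s) = 1.
Proof. by rewrite cabs_expC expR0. Qed.

Lemma FTC_complex (F f : R -> C) (a b : R) : a < b ->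
  (forall t, cderiv F t (f t)) -> (forall t, exists d, cderiv f t d) ->
  integralC `[a, b] f = F b - F a.
Proof.
move=> ab hF hf; apply/eqP; rewrite eq_complex; apply/andP; split; apply/eqP.
  rewrite Re_add Re_opp /=.
  apply: (@FTC_segment R (fun t => complex.Re (f t)) (fun t => complex.Re (F t))) => // t _.
    by have [] := hF t.
  by have [d /cderiv_continuous[]] := hf t.
rewrite Im_add Im_opp /=.
apply: (@FTC_segment R (fun t => complex.Im (f t)) (fun t => complex.Im (F t))) => // t _.
  by have [] := hF t.
by have [d /cderiv_continuous[]] := hf t.
Qed.

Variable eps : R.
Hypothesis eps0 : 0 < eps.

Lemma contour_powerD1 (x : R * R) s : 0 < x.1 ->
  contour_power x (s - 1)%:C * contour_point x = contour_power x s%:C.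
Proof.
move=> x0; have -> : contour_point x = contour_power x 1%:C.
  case: x x0 => rho theta /= rho0; rewrite contour_power_arg !mul1r lnK ?posrE//.
  by rewrite mulrC.
rewrite /contour_power -expCD -mulrDl -real_complexD subrK.
by [].
Qed.

Definition circle_integral n s : C := integralC `[0, 2 * pi]
  (fun theta => exp_power n s (eps, theta) * ((0 +i* 1) * contour_point (eps, theta))).

Lemma two_pi_gt0 : 0 < 2 * pi :> R.
Proof. by rewrite mulr_gt0// pi_gt0. Qed.

Lemma circle_integrandE n s theta :
  exp_power n s (eps, theta) * ((0 +i* 1) * contour_point (eps, theta)) =
  (0 +i* 1) * (expC (- (n%:R * contour_point (eps, theta))) *
     contour_power (eps, theta) s%:C).
Proof. by rewrite -(@contour_powerD1 (eps, theta) s)// /exp_power; ring. Qed.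

Lemma cderiv_exp_power_circle n s t :
  cderiv (fun theta => expC (- (n%:R * contour_point (eps, theta))) *
     contour_power (eps, theta) s%:C) t
   (s%:C * ((0 +i* 1) * (expC (- (n%:R * contour_point (eps, t))) *
       contour_power (eps, t) s%:C)) -
    n%:R * ((0 +i* 1) * (expC (- (n%:R * contour_point (eps, t))) *
       contour_power (eps, t) (s + 1)%:C))).
Proof.
have h := cderivM (cderiv_exp_contour n%:R eps t) (cderiv_contour_power eps s t).
move: h; rewrite real_complex_nat => h; apply: cderiv_ext h => //.
rewrite -(@contour_powerD1 (eps, t) (s + 1))// addrK.
have -> : 0 +i* s = s%:C * (0 +i* 1) :> C.
  by apply/eqP; rewrite eq_complex Re_mul Im_mul /= !mulr0 !mul0r mulr1 subr0 addr0 !eqxx.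
by ring.
Qed.

Lemma circle_integrable n s : integrableC `[0, 2 * pi]
  (fun theta => exp_power n s (eps, theta) * ((0 +i* 1) * contour_point (eps, theta))).
Proof.
apply: cderiv_integrableC => t; eexists.
under eq_fun do rewrite circle_integrandE.
exact: cderivZ (cderiv_exp_power_circle n s t).
Qed.

Lemma circle_integral_rec n s :
  s%:C * circle_integral n s - n%:R * circle_integral n (s + 1) =
  (monodromy s - 1) * (pow_exp n%:R s eps)%:C.
Proof.
rewrite /circle_integral.
have i1 := circle_integrable n s; have i2 := circle_integrable n (s + 1).
rewrite -!integralCZ// -integralCB//; try exact: integrableCZ.
transitivity (integralC `[0, 2 * pi] (fun t =>
   s%:C * ((0 +i* 1) * (expC (- (n%:R * contour_point (eps, t))) *
       contour_power (eps, t) s%:C)) -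
    n%:R * ((0 +i* 1) * (expC (- (n%:R * contour_point (eps, t))) *
       contour_power (eps, t) (s + 1)%:C)))).
  by apply: eq_integralC => t _; rewrite !circle_integrandE.
rewrite (@FTC_complex (fun theta => expC (- (n%:R * contour_point (eps, theta))) *
     contour_power (eps, theta) s%:C) _ _ _ two_pi_gt0); last 2 first.
- by move=> t; exact: cderiv_exp_power_circle.
- move=> t; eexists; apply: cderivD; first by apply: cderivZ; apply: cderivZ;
    exact: cderiv_exp_power_circle.
  by apply: cderivN; apply: cderivZ; apply: cderivZ; exact: cderiv_exp_power_circle.
rewrite contour_point_top contour_point_bottom contour_power_top contour_power_arg.
rewrite -/(monodromy s) -real_complex_nat -real_complexM -real_complexN expC_real.
by rewrite /pow_exp real_complexM; ring.
Qed.

Lemma contour_integral_exp_powerE n s : (0 < n)%N ->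
  contour_integral eps (exp_power n s) =
  (monodromy s - 1) * (ray_integral n%:R eps s)%:C + circle_integral n s.
Proof.
move=> n0; have n0' : 0 < n%:R :> R by rewrite ltr0n.
rewrite /contour_integral /ray_integral -integralC_real -/(circle_integral n s).
under eq_integralC do rewrite exp_power_ray.
have ir : integrableC `[eps, +oo[ (fun rho => (pow_exp n%:R (s - 1) rho)%:C : C).
  by apply: integrableC_real => //; exact: integrable_pow_exp.
have -> : integralC `[eps, +oo[ (fun rho => exp_power n s (rho, 2 * pi)) =
   monodromy s * integralC `[eps, +oo[ (fun rho => (pow_exp n%:R (s - 1) rho)%:C).
  rewrite -integralCZ//; apply: eq_integralC => rho _.
  by rewrite exp_power_bottom -/(monodromy (s - 1)) -monodromyD1 subrK.
by ring.
Qed.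

(** Integration by parts along the contour; the boundary terms of the rays and of
    the circle cancel. *)
Lemma contour_integral_exp_power_rec n s : (0 < n)%N ->
  s%:C * contour_integral eps (exp_power n s) =
  n%:R * contour_integral eps (exp_power n (s + 1)).
Proof.
move=> n0; have n0' : 0 < n%:R :> R by rewrite ltr0n.
rewrite !contour_integral_exp_powerE// monodromyD1.
have h1 := congr1 (real_complex R) (@ray_integral_rec R n%:R eps s n0' eps0).
have h2 := circle_integral_rec n s.
rewrite real_complexD !real_complexN (real_complexM s) (real_complexM n%:R) real_complex_nat in h1.
apply/eqP; rewrite -subr_eq0; apply/eqP.
transitivity ((monodromy s - 1) * (s%:C * (ray_integral n%:R eps s)%:C -
    n%:R * (ray_integral n%:R eps (s + 1))%:C) +
    (s%:C * circle_integral n s - n%:R * circle_integral n (s + 1))).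
  by ring.
by rewrite h1 h2; ring.
Qed.

Lemma circle_integral_bound n s :
  cabs (circle_integral n s) <=
  4 * (expR (n%:R * eps) * expR (s * ln eps) * (2 * pi)).
Proof.
have z : integralC `[0, 2 * pi] (fun=> 0 : C) = 0.
  by rewrite (integralC_real _ (fun=> 0)) /Rintegral integral0.
rewrite -[circle_integral n s]subr0 -z.
have -> : expR (n%:R * eps) * expR (s * ln eps) * (2 * pi) =
   \int[mu]_(x in `[0, 2 * pi]) (expR (n%:R * eps) * expR (s * ln eps)).
  have fpi : fine (mu (`[0, 2 * pi] : set R)) = 2 * pi.
    by rewrite lebesgue_measure_itv /= lte_fin two_pi_gt0 oppr0 adde0.
  by rewrite Rintegral_cst// fpi.
apply: (@integralC_perturb R _ set0) => //.
- by apply: (@integrableC_real R _ (fun=> 0)) => //; exact: integrable0.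
- apply: continuous_compact_integrable; first exact: segment_compact.
  by move=> x; exact: cvg_cst.
move=> t _ _; rewrite subr0 circle_integrandE cabsM.
rewrite [X in X * _](_ : _ = 1); last first.
  by rewrite cabsE /= expr0n expr1n add0r sqrtr1.
rewrite mul1r cabsM cabs_contour_power -[(eps, t).1]/eps ler_wpM2r ?expR_ge0// cabs_expC ler_expR.
rewrite Re_opp -real_complex_nat Re_mul contour_pointE /= mul0r subr0.
have h := cos_geN1 t.
have h2 : 0 <= n%:R * eps by rewrite mulr_ge0// ltW.
have h3 : 0 <= n%:R * eps * (1 + cos t) by rewrite mulr_ge0//; lra.
by clear - h3; lra.
Qed.

(** Both sides of the formula satisfy the same recursion s f(s) = n f(s + 1), and
    their difference D(s) is O(eps^s); iterating, D(s) is bounded by a constant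
    times the terms (n eps)^m / m! of a convergent series. *)
Lemma contour_integral_exp_power_ge1 n x : (0 < n)%N -> 1 <= x ->
  contour_integral eps (exp_power n x) =
  (monodromy x - 1) * (gamma_integral n%:R x)%:C.
Proof.
move=> n0 x1; have n0' : 0 < n%:R :> R by rewrite ltr0n.
pose D y := contour_integral eps (exp_power n y) -
   (monodromy y - 1) * (gamma_integral n%:R y)%:C.
have Drec y : 1 <= y -> y%:C * D y = n%:R * D (y + 1).
  move=> y1; rewrite /D mulrBr contour_integral_exp_power_rec// monodromyD1.
  have h := congr1 (real_complex R) (gamma_integral_rec n0' y1).
  rewrite !real_complexM real_complex_nat in h.
  by rewrite [X in _ - X]mulrCA h; ring.
pose K := 4 * (expR (n%:R * eps) * (2 * pi)) + 2.
have K0 : 0 <= K.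
  by rewrite addr_ge0// !mulr_ge0 ?expR_ge0// pi_ge0.
have Dbound y : 1 <= y -> cabs (D y) <= K * expR (y * ln eps).
  move=> y1; rewrite /D contour_integral_exp_powerE//.
  have -> : (monodromy y - 1) * (ray_integral n%:R eps y)%:C + circle_integral n y -
      (monodromy y - 1) * (gamma_integral n%:R y)%:C =
    circle_integral n y - (monodromy y - 1) *
      (gamma_integral n%:R y - ray_integral n%:R eps y)%:C.
    by rewrite real_complexD real_complexN; ring.
  apply: le_trans (cabsB _ _) _; rewrite /K [leRHS]mulrDl; apply: lerD.
    by apply: le_trans (circle_integral_bound n y) _; rewrite le_eqVlt;
      apply/orP; left; apply/eqP; ring.
  rewrite cabsM cabs_real; apply: ler_pM; rewrite ?cabs_ge0//.
    apply: le_trans (cabsB _ _) _; rewrite cabs_monodromy cabs1; lra.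
  by have /andP[h1 h2] := gamma_head_bound n0' eps0 y1; rewrite ger0_norm.
have Diter m : cabs (D x) * m`!%:R <= K * expR (x * ln eps) * (n%:R * eps) ^+ m.
  suff h : cabs (D x) * m`!%:R <= n%:R ^+ m * cabs (D (x + m%:R)).
    apply: le_trans h _.
    have xm : 1 <= x + m%:R by rewrite (le_trans x1)// lerDl.
    have := Dbound _ xm; rewrite [(x + m%:R) * _]mulrDl expRD expRM_natl lnK ?posrE// => hb.
    apply: le_trans (ler_wpM2l (exprn_ge0 m (ltW n0')) hb) _.
    by rewrite exprMn le_eqVlt; apply/orP; left; apply/eqP; ring.
  elim: m => [|m IH]; first by rewrite fact0 expr0 mul1r mulr1 addr0.
  have xm : 1 <= x + m%:R by rewrite (le_trans x1)// lerDl.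
  have := congr1 (@cabs R) (Drec _ xm).
  rewrite (cabsM (x + m%:R)%:C) (cabsM n%:R) cabs_real cabs_nat ger0_norm; last by rewrite (le_trans ler01).
  rewrite -addrA natr1 => hr.
  apply: (@le_trans _ _ (m.+1%:R * (cabs (D x) * m`!%:R))).
    by rewrite factS natrM mulrCA.
  apply: (@le_trans _ _ ((x + m%:R) * (n%:R ^+ m * cabs (D (x + m%:R))))).
    apply: ler_pM; [exact: ler0n | by rewrite mulr_ge0 ?cabs_ge0 ?ler0n | | exact: IH].
    by rewrite -natr1 addrC lerD2r.
  rewrite mulrCA hr exprSr mulrA; exact: lexx.
have hc : (fun m => K * expR (x * ln eps) * exp_coeff (n%:R * eps) m) @ \oo --> 0.
  rewrite -[X in _ --> X](mulr0 (K * expR (x * ln eps))).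
  apply: cvgMr; exact: cvg_series_cvg_0 (is_cvg_series_exp_coeff _).
have D0 : cabs (D x) <= 0.
  apply: (@ler_cvg_to _ _ _ _ (cst (cabs (D x))) _ _ _ (cvg_cst _) hc).
  near=> m; have -> : K * expR (x * ln eps) * exp_coeff (n%:R * eps) m =
      K * expR (x * ln eps) * (n%:R * eps) ^+ m / m`!%:R.
    by rewrite /exp_coeff /= mulrA.
  by rewrite ler_pdivlMr ?ltr0n ?fact_gt0//; exact: Diter.
apply/eqP; rewrite -subr_eq0; apply/eqP; apply: cabs_eq0.
by apply/le_anti; rewrite D0 cabs_ge0.
Unshelve. all: by end_near.
Qed.

End HankelFormula.

Section GammaNormalization.
Local Open Scope classical_set_scope.
Local Open Scope complex_scope.
Local Open Scope ring_scope.
Variable R : realType.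
Local Notation C := R[i].
Local Notation mu := (@lebesgue_measure R).
Implicit Types (d x e : R) (n k : nat).

Lemma Gamma_integralE x : Gamma_integral x%:C = (gamma_integral 1 x)%:C.
Proof.
rewrite /Gamma_integral /gamma_integral -integralC_real; apply: eq_integralC => t _.
rewrite /pow_exp mul1r mulrC real_complexM; congr (_ * _).
by rewrite -expC_real; congr expC; rewrite real_complexM real_complexD real_complexN.
Qed.

Lemma shift_neq0 d k m : 0 < d < 1 -> d - k%:R + m%:R != 0.
Proof.
move=> /andP[d0 d1]; apply/eqP => h.
have [mk|/ltnW km] := leqP k m.
  have : 0 <= m%:R - k%:R :> R by rewrite subr_ge0 ler_nat.
  lra.
case: (ltngtP m k) km => // [mk _|mk _]; last by rewrite mk in h; lra.
have : m.+1%:R <= k%:R :> R by rewrite ler_nat.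
rewrite -natr1; lra.
Qed.

Lemma GammaE d k : 0 < d < 1 ->
  Gamma (d - k%:R)%:C = (gamma_integral 1 (1 + d))%:C /
    \prod_(m < k.+1) (d - k%:R + m%:R)%:C.
Proof.
move=> /andP[d0 d1].
have fl : Num.floor (d - k%:R) = - k%:Z.
  by apply: floor_def; rewrite intrD mulrNz /= -pmulrn; apply/andP; split; lra.
rewrite /Gamma [complex.Re _]/= fl abszN absz_nat; congr (_ / _).
  rewrite -real_complex_nat -real_complexD Gamma_integralE; congr ((gamma_integral _ _)%:C).
  by rewrite -natr1; ring.
by apply: eq_bigr => m _; rewrite -real_complex_nat -real_complexD.
Qed.

Lemma shift_prod_neq0 d k : 0 < d < 1 ->
  \prod_(m < k.+1) (d - k%:R + m%:R)%:C != 0 :> C.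
Proof.
move=> hd; apply/prodf_neq0 => m _.
by rewrite real_complex_eq0 shift_neq0.
Qed.

Lemma contour_integral_exp_power_shift e n s m : 0 < e -> (0 < n)%N ->
  contour_integral e (exp_power n s) * \prod_(i < m) (s + i%:R)%:C =
  n%:R ^+ m * contour_integral e (exp_power n (s + m%:R)).
Proof.
move=> e0 n0; elim: m => [|m IH]; first by rewrite big_ord0 expr0 mulr1 mul1r addr0.
rewrite big_ord_recr /= mulrA IH -mulrA [_ * (_ + _)%:C]mulrC.
by rewrite contour_integral_exp_power_rec// mulrA exprSr -addrA natr1.
Qed.

(** Hankel's formula, for the exponents -k + d that are used to approach -k: the
    recursion raises the exponent to 1 + d, where the integral is known. *)
Lemma hankel_formula e n d k : 0 < e -> (0 < n)%N -> 0 < d < 1 ->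
  contour_integral e (exp_power n (d - k%:R)) =
  (monodromy (d - k%:R) - 1) * Gamma (d - k%:R)%:C *
    (expR (- ((d - k%:R) * ln n%:R)))%:C.
Proof.
move=> e0 n0 hd; have n0' : 0 < n%:R :> R by rewrite ltr0n.
have hp := shift_prod_neq0 k hd.
have d1 : 1 <= 1 + d by have /andP[? _] := hd; lra.
apply: (mulIf hp); rewrite contour_integral_exp_power_shift//.
have -> : d - k%:R + k.+1%:R = 1 + d by rewrite -natr1; ring.
rewrite contour_integral_exp_power_ge1// gamma_integral_scale//.
have -> : monodromy (1 + d) = monodromy (d - k%:R).
  elim: k {hp} => [|k IH]; first by rewrite addrC monodromyD1 subr0.
  rewrite IH -[RHS]monodromyD1; congr monodromy; rewrite -natr1; ring.
have key : n%:R ^+ k.+1 * (expR (- ((1 + d) * ln n%:R)))%:C =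
    (expR (- ((d - k%:R) * ln n%:R)))%:C.
  rewrite -real_complex_nat -real_complexX -real_complexM; congr (_%:C).
  rewrite -[X in X ^+ _](lnK n0') -expRM_natl -expRD; congr expR.
  by rewrite -natr1; ring.
rewrite GammaE// -key real_complexM.
move: hp; set P := \prod_(i < k.+1) _ => hp.
move: (expR _)%:C (gamma_integral _ _)%:C (monodromy _ - 1) (n%:R ^+ k.+1) => a b c q.
by field.
Qed.

Definition zeta_prefactor (s : C) : C :=
  1 / ((expC ((0 +i* (2 * pi)) * s) - 1) * Gamma s).

Lemma monodromyE d : expC ((0 +i* (2 * pi)) * d%:C) = monodromy d.
Proof.
rewrite /monodromy; congr expC; apply/eqP.
by rewrite eq_complex Re_mul Im_mul /= !mulr0 !mul0r subr0 add0r mulrC !eqxx.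
Qed.

Lemma pi_lt4 : pi < 4 :> R.
Proof. by have := @pihalf_lt2 R; lra. Qed.

(** For d <= 1/16 the angle 2 pi d is at most 1/2, where the cosine is at least 1/2. *)
Lemma monodromy_lower d k : 0 < d <= 16^-1 -> d <= cabs (monodromy (d - k%:R) - 1).
Proof.
move=> /andP[d0 d1].
have -> : monodromy (d - k%:R) = monodromy d.
  elim: k => [|k IH]; first by rewrite subr0.
  rewrite -IH -monodromyD1; congr monodromy; rewrite -natr1; ring.
apply: le_trans (normr_Im_le _); rewrite /monodromy /expC /= expR0.
rewrite mul0r addr0 mul1r oppr0 addr0.
apply: le_trans (ler_norm _).
pose y : R := d * (2 * pi).
have y0 : 0 <= y by rewrite !mulr_ge0 ?pi_ge0// ltW.
have y1 : y <= 2^-1.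
  have := pi_lt4; have := @pi_gt0 R; rewrite /y; nra.
have [] := @MVT_segment R (@sin R) (@cos R) 0 y y0.
  by apply: continuous_subspaceT => x; exact: continuous_sin.
move=> c; rewrite in_itv /= => /andP[c0 cy]; rewrite sin0 !subr0 -/y => ->.
have := cos_ge1B c; rewrite (ger0_norm c0) => hc.
have h1 : 2^-1 <= cos c by lra.
have h2 : 2^-1 * y <= cos c * y by rewrite ler_wpM2r.
apply: le_trans h2; rewrite /y.
have := @pi_ge2 R; nra.
Qed.

(** The zero of e^(2 pi i s) - 1 at s = -k cancels the pole of Gamma. In the
    constant, e^2 bounds 1 / Gamma(1 + d) and k + 1 bounds each of the k factors of
    the continuation of Gamma that stay away from 0. *)
Lemma zeta_prefactor_bound d k : 0 < d <= 16^-1 ->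
  cabs (zeta_prefactor (d - k%:R)%:C) <= expR 2 * k.+1%:R ^+ k.
Proof.
move=> hd; have [d0 d1] := andP hd.
have hd1 : 0 < d < 1 by apply/andP; split; lra.
have hm := monodromy_lower k hd.
have hG := gamma_integral_lower (_ : 1 <= 1 + d).
have {}hG : expR (- 2) <= gamma_integral 1 (1 + d) by apply: hG; lra.
have hG0 : 0 < gamma_integral 1 (1 + d) by apply: lt_le_trans hG; rewrite expR_gt0.
rewrite /zeta_prefactor monodromyE GammaE// div1r invfM invf_div !cabsM !cabsV.
rewrite cabs_real (gtr0_norm hG0).
have -> : cabs (\prod_(m < k.+1) (d - k%:R + m%:R)%:C) =
    (\prod_(i < k) cabs (d - k%:R + i%:R)%:C) * d.
  rewrite cabs_prod big_ord_recr; congr (_ * _).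
  by rewrite -[nat_of_ord _]/k subrK cabs_real gtr0_norm.
have hp : \prod_(i < k) cabs (d - k%:R + i%:R)%:C <= k.+1%:R ^+ k.
  rewrite -[X in _ ^+ X]card_ord -prodr_const; apply: ler_prod => i _.
  apply/andP; split; first exact: cabs_ge0.
  rewrite cabs_real -natr1.
  have h1 : i%:R <= k%:R :> R by rewrite ler_nat ltnW.
  have h2 : 0 <= i%:R :> R by [].
  by rewrite ler_norml; apply/andP; split; lra.
set M := cabs _ in hm *; set G := gamma_integral _ _ in hG hG0 *.
set P := \prod_(i < k) _ in hp *.
have M0 : 0 < M by apply: lt_le_trans hm.
have P0 : 0 <= P by apply: prodr_ge0 => i _; exact: cabs_ge0.
rewrite mulrC -mulrA -mulrA mulrC.
have -> : d / G / M * P = (d / M) * (G^-1 * P) by ring.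
rewrite -[leRHS]mul1r; apply: ler_pM.
- by rewrite divr_ge0 ?ltW.
- by rewrite mulr_ge0// invr_ge0 ltW.
- by rewrite ler_pdivrMr// mul1r.
apply: ler_pM => //; first by rewrite invr_ge0 ltW.
by rewrite -[expR 2]invrK -expRN lef_pV2 ?posrE ?expR_gt0.
Qed.

Lemma zeta_prefactor_hankel e n d k : 0 < e -> (0 < n)%N -> 0 < d <= 16^-1 ->
  zeta_prefactor (d - k%:R)%:C * contour_integral e (exp_power n (d - k%:R)) =
  (expR (- ((d - k%:R) * ln n%:R)))%:C.
Proof.
move=> e0 n0 hd; have [d0 d1] := andP hd.
have hd1 : 0 < d < 1 by apply/andP; split; lra.
rewrite hankel_formula// /zeta_prefactor monodromyE div1r mulrA mulVf ?mul1r//.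
rewrite mulf_neq0//.
  apply/eqP => h; have := monodromy_lower k hd; rewrite h cabs0; lra.
rewrite GammaE// mulf_neq0 ?invr_eq0 ?shift_prod_neq0//.
rewrite real_complex_eq0 gt_eqF//.
by apply: lt_le_trans (gamma_integral_lower _); rewrite ?expR_gt0//; lra.
Qed.

End GammaNormalization.

(** * Truncated zeta values *)

Section DesingularizedValue.
Local Open Scope classical_set_scope.
Local Open Scope complex_scope.
Local Open Scope ring_scope.
Variable R : realType.
Local Notation C := R[i].
Local Notation mu := (@lebesgue_measure R).
Local Notation "z .re" := (complex.Re z) (at level 2, format "z .re").
Implicit Types (d e c : R) (N : nat) (z : C).

Local Notation weight z := (expR (- (2^-1 * (complex.Re z)))).

(** Bounds with one constant for all truncations, as needed for products. *)
Lemma des_factor_approx_uniform : exists2 A : R, 1 <= A &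
  forall e, 0 < e -> exists N0, forall N, (N0 <= N)%N -> exists2 d, 0 < d &
    forall c, 1 - d < c < 1 -> forall z, half_strip z -> z != 0 ->
    [/\ cabs (des_factor c z) <= A * weight z,
        cabs (des_approx N z) <= A * weight z &
        cabs (des_factor c z - des_approx N z) <= e * weight z].
Proof.
have [N1 hN1] := @des_factor_approx R 1 ltr01.
have [d1 d10 hd1] := hN1 N1 (leqnn _).
have N10 : 0 <= N1%:R :> R by [].
exists (2 * N1%:R + 2); first by lra.
move=> e e0; pose e' := Num.min e 1.
have e'0 : 0 < e' by rewrite lt_min e0 ltr01.
have e'e : e' <= e by rewrite ge_min lexx.
have e'1 : e' <= 1 by rewrite ge_min lexx orbT.
have [N0 hN0] := @des_factor_approx R e' e'0.
exists N0 => N /hN0[d d0 hd]; exists (Num.min d d1); first by rewrite lt_min d0.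
move=> c; rewrite ltrBlDl -ltrBlDr lt_min => /andP[/andP[c1 c2] c3] z hz z0.
have b1 := hd c _ z hz z0; have {}b1 := b1 (_ : 1 - d < c < 1).
have {}b1 : cabs (des_factor c z - des_approx N z) <= e' * weight z.
  by apply: b1; rewrite c3 andbT; lra.
have b2 : cabs (des_factor c z - des_approx N1 z) <= 1 * weight z.
  by apply: hd1 => //; rewrite c3 andbT; lra.
have w0 : 0 <= weight z by exact: expR_ge0.
have b3 : cabs (des_approx N1 z) <= N1%:R * (4 / 3 * weight z).
  apply: le_trans (des_approx_bound N1 hz) _; rewrite ler_wpM2l//.
  have [z1 _] := hz; have := @expR_weight R 1 2^-1 _ _ _ z1.
  by rewrite mul1r; apply; lra.
have b4 : cabs (des_factor c z) <= (4 / 3 * N1%:R + 1) * weight z.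
  rewrite -[des_factor c z](subrK (des_approx N1 z)).
  by apply: le_trans (cabsD _ _) _; lra.
have b5 : cabs (des_approx N z) <= (4 / 3 * N1%:R + 2) * weight z.
  have -> : des_approx N z = des_factor c z - (des_factor c z - des_approx N z) by ring.
  apply: le_trans (cabsB _ _) _.
  have : e' * weight z <= 1 * weight z by rewrite ler_wpM2r.
  lra.
split.
- by apply: le_trans b4 _; rewrite ler_wpM2r//; lra.
- by apply: le_trans b5 _; rewrite ler_wpM2r//; lra.
- by apply: le_trans b1 _; rewrite ler_wpM2r.
Qed.

(** Both truncations are compared with the exact factor for one common c. *)
Lemma des_approx_cauchy (A : R) :
  (forall e, 0 < e -> exists N0, forall N, (N0 <= N)%N -> exists2 d, 0 < d &
    forall c, 1 - d < c < 1 -> forall z, half_strip z -> z != 0 ->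
    [/\ cabs (des_factor c z) <= A * weight z,
        cabs (des_approx N z) <= A * weight z &
        cabs (des_factor c z - des_approx N z) <= e * weight z]) ->
  forall e, 0 < e -> exists N0, forall N M, (N0 <= N)%N -> (N0 <= M)%N ->
    forall z, half_strip z -> z != 0 ->
    [/\ cabs (des_approx N z) <= A * weight z,
        cabs (des_approx M z) <= A * weight z &
        cabs (des_approx N z - des_approx M z) <= e * weight z].
Proof.
move=> hA e e0; have e2 : 0 < e / 2 by rewrite divr_gt0.
have [N0 hN0] := hA _ e2; exists N0 => N M /hN0[d d0 hd] /hN0[d' d'0 hd'] z hz z0.
pose m := Num.min d d'.
have m0 : 0 < m by rewrite lt_min d0.
have md : m <= d by rewrite ge_min lexx.
have md' : m <= d' by rewrite ge_min lexx orbT.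
have c1 : 1 - d < 1 - m / 2 < 1 by apply/andP; split; lra.
have c2 : 1 - d' < 1 - m / 2 < 1 by apply/andP; split; lra.
have [_ h1 h2] := hd _ c1 z hz z0; have [_ h3 h4] := hd' _ c2 z hz z0.
split=> //.
have -> : des_approx N z - des_approx M z =
   (des_factor (1 - m / 2) z - des_approx M z) -
   (des_factor (1 - m / 2) z - des_approx N z) by ring.
by apply: le_trans (cabsB _ _) _; lra.
Qed.

Variable r : nat.
Variable k : 'I_r -> nat.

(** Exponential-sum approximation of the desingularized zeta function at the
    points -k_a + d; for d = 0 it is a finite sum of powers of integers. *)
Definition truncated_zeta N d : C :=
  \sum_(m : {ffun 'I_r -> 'I_(size (des_poly R N))})
    (\prod_j (des_poly R N)`_(m j)) *
    \prod_a (expR (- ((d - (k a)%:R) * ln (exponent_sum m a)%:R)))%:C.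

Definition shifted_point d : 'rV[C]_r := \row_a (d - (k a)%:R)%:C.

Definition prefactor_bound : R := \prod_(a < r) (expR 2 * (k a).+1%:R ^+ k a).

Lemma prod_zeta_prefactor_bound d : 0 < d <= 16^-1 ->
  cabs (\prod_a zeta_prefactor (shifted_point d 0 a)) <= prefactor_bound.
Proof.
move=> hd; rewrite cabs_prod; apply: ler_prod => a _; rewrite mxE cabs_ge0.
exact: zeta_prefactor_bound.
Qed.

(** Depends on the radius e alone: the endpoints 0 and 1 control all shifts d. *)
Definition mass_bound e : R := \prod_(a < r)
  (contour_mass e (contour_weight (- (k a)%:R)) +
   contour_mass e (contour_weight (1 - (k a)%:R))).

(** x^d <= 1 + x for 0 <= d <= 1 makes the weights uniform in d. *)
Lemma prod_mass_bound e d : 0 < e -> 0 < d < 1 ->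
  0 <= \prod_(a < r) contour_mass e (contour_weight (d - (k a)%:R)) <= mass_bound e.
Proof.
move=> e0 /andP[d0 d1].
have mass0 s : 0 <= contour_mass e (@contour_weight R s).
  have w0 x : 0 <= contour_weight s x by exact: contour_weight_ge0.
  rewrite /contour_mass mulr_ge0// addr_ge0 ?mulr_ge0 ?pi_ge0 ?(ltW e0)//.
  exact: Rintegral_ge0.
apply/andP; split; first exact: prodr_ge0.
apply: ler_prod => a _; rewrite mass0 /=.
have wle x : contour_weight (d - (k a)%:R) x <=
    contour_weight (- (k a)%:R) x + contour_weight (1 - (k a)%:R) x.
  rewrite /contour_weight /pow_exp -mulrDr ler_pM2l// -mulrDr ler_pM2l ?expR_gt0//.
  have [h|h] := leP 0 (ln x).
    apply: (@le_trans _ _ (expR ((1 - (k a)%:R - 1) * ln x))); last by rewrite lerDr expR_ge0.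
    by rewrite ler_expR ler_wpM2r//; lra.
  apply: (@le_trans _ _ (expR ((- (k a)%:R - 1) * ln x))); last by rewrite lerDl expR_ge0.
  by rewrite ler_expR ler_wnM2r ?(ltW h)//; lra.
rewrite /contour_mass -mulrDr ler_pM2l//.
have i1 s := @integrable_contour_weight R e e0 s.
have hI : \int[mu]_(x in `[e, +oo[) contour_weight (d - (k a)%:R) x <=
   \int[mu]_(x in `[e, +oo[) contour_weight (- (k a)%:R) x +
   \int[mu]_(x in `[e, +oo[) contour_weight (1 - (k a)%:R) x.
  rewrite -RintegralD//; apply: le_Rintegral => //.
  by apply: integrable_add.
have h2 : 2 * pi * e * contour_weight (d - (k a)%:R) e <=
   2 * pi * e * contour_weight (- (k a)%:R) e +
   2 * pi * e * contour_weight (1 - (k a)%:R) e.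
  rewrite -[leRHS](mulrDr (2 * pi * e)) ler_wpM2l//.
  by rewrite !mulr_ge0 ?pi_ge0// ltW.
apply: (@le_trans _ _ (2 * (\int[mu]_(x in `[e, +oo[) contour_weight (- (k a)%:R) x +
   \int[mu]_(x in `[e, +oo[) contour_weight (1 - (k a)%:R) x) +
   (2 * pi * e * contour_weight (- (k a)%:R) e + 2 * pi * e * contour_weight (1 - (k a)%:R) e))).
  by apply: lerD => //; rewrite ler_pM2l.
by rewrite le_eqVlt; apply/orP; left; apply/eqP; ring.
Qed.

Lemma truncated_zetaE N d e : 0 < e -> 0 < d <= 16^-1 ->
  truncated_zeta N d = (\prod_a zeta_prefactor (shifted_point d 0 a)) *
    \sum_(m : {ffun 'I_r -> 'I_(size (des_poly R N))}) (\prod_j (des_poly R N)`_(m j)) *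
      \prod_a contour_integral e (exp_power (exponent_sum m a) (d - (k a)%:R)).
Proof.
move=> e0 hd; rewrite mulr_sumr; apply: eq_bigr => m _.
rewrite mulrCA; congr (_ * _); rewrite -big_split; apply: eq_bigr => a _.
by rewrite /= mxE zeta_prefactor_hankel// exponent_sum_gt0.
Qed.

Lemma shifted_point_sub1 d a : shifted_point d 0 a - 1 = (d - (k a)%:R - 1)%:C.
Proof. by rewrite mxE [RHS]real_complexD [in RHS]real_complexN. Qed.

Lemma truncated_zeta_cauchy N M (A e t d : R) : 0 < t -> r%:R * t <= 4^-1 ->
  0 < d <= 16^-1 -> 1 <= A -> 0 <= e ->
  (forall z, half_strip z -> z != 0 ->
    [/\ cabs (des_approx N z) <= A * weight z,
        cabs (des_approx M z) <= A * weight z &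
        cabs (des_approx N z - des_approx M z) <= e * weight z]) ->
  cabs (truncated_zeta N d - truncated_zeta M d) <=
    prefactor_bound * (r%:R * A ^+ r * e * mass_bound t).
Proof.
move=> t0 rt hd A1 e0 hNM.
have hd1 : 0 < d < 1 by have [d0 d1] := andP hd; apply/andP; split; lra.
have A0 : 0 <= A by apply: le_trans A1.
have ra0 : 0 <= r%:R * A ^+ r * e by rewrite !mulr_ge0 ?exprn_ge0.
have /andP[mb0 mb1] := prod_mass_bound t0 hd1.
rewrite !(@truncated_zetaE _ d t)// -mulrBr cabsM; apply: ler_pM; rewrite ?cabs_ge0//.
  exact: prod_zeta_prefactor_bound.
apply: le_trans (ler_wpM2l ra0 mb1).
pose F (xs : r.-tuple (R * R)) : C :=
  (\prod_(j < r) des_approx N (\sum_(k < r | (j <= k)%N) contour_point (tnth xs k))) *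
         \prod_a contour_power (tnth xs a) (d - (k a)%:R - 1)%:C.
(* The truncation of order N is the integral of F, with error 0. *)
have h1 : cabs (contour_integral_iter t F - 1 *
    \sum_(m : {ffun 'I_r -> 'I_(size (des_poly R N))}) (\prod_j (des_poly R N)`_(m j)) *
      \prod_a contour_integral t (exp_power (exponent_sum m a) (d - (k a)%:R))) <=
    0 * \prod_a contour_mass t (contour_weight (d - (k a)%:R)).
  apply: contour_integral_iter_approx => // xs _.
  by rewrite mul1r subrr cabs0 mul0r.
have h2 : cabs (contour_integral_iter t F - 1 *
    \sum_(m : {ffun 'I_r -> 'I_(size (des_poly R M))}) (\prod_j (des_poly R M)`_(m j)) *
      \prod_a contour_integral t (exp_power (exponent_sum m a) (d - (k a)%:R))) <=
    (r%:R * A ^+ r * e) * \prod_a contour_mass t (contour_weight (d - (k a)%:R)).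
  apply: contour_integral_iter_approx => // xs hxs; rewrite mul1r.
  exact: (@integrand_sub_bound R t t0 r (fun a => d - (k a)%:R) xs
    (des_approx N) (des_approx M) A e).
rewrite mul0r in h1; rewrite !mul1r in h1 h2.
have -> : \sum_(m : {ffun 'I_r -> 'I_(size (des_poly R N))}) (\prod_j (des_poly R N)`_(m j)) *
      \prod_a contour_integral t (exp_power (exponent_sum m a) (d - (k a)%:R)) =
   contour_integral_iter t F.
  by apply/esym/eqP; rewrite -subr_eq0; apply/eqP/cabs_eq0/le_anti; rewrite h1 cabs_ge0.
exact: h2.
Qed.

(** The normalization turns Hankel's integrals into powers of integers, so the
    truncated value is the exact expression with [des_factor] replaced by
    [des_approx]. *)
Lemma zeta_des_approx_close N (A e t d c : R) : 0 < t -> r%:R * t <= 4^-1 ->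
  0 < d <= 16^-1 -> 1 <= A -> 0 <= e -> c < 1 ->
  (forall z, half_strip z -> z != 0 ->
    [/\ cabs (des_factor c z) <= A * weight z,
        cabs (des_approx N z) <= A * weight z &
        cabs (des_factor c z - des_approx N z) <= e * weight z]) ->
  cabs (zeta_des_approx t c (shifted_point d) - truncated_zeta N d) <=
    prefactor_bound * (r%:R * A ^+ r * e * mass_bound t).
Proof.
move=> t0 rt hd A1 e0 c1 hN.
have hd1 : 0 < d < 1 by have [d0 d1] := andP hd; apply/andP; split; lra.
have A0 : 0 <= A by apply: le_trans A1.
have ra0 : 0 <= r%:R * A ^+ r * e by rewrite !mulr_ge0 ?exprn_ge0.
have /andP[mb0 mb1] := prod_mass_bound t0 hd1.
have cabs1c : cabs (1 - c%:C) = 1 - c.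
  by rewrite -real_complex1 -real_complexN -real_complexD cabs_real ger0_norm; lra.
have c0 : 1 - c%:C != 0 :> C.
  by apply/eqP => /(congr1 (@cabs R)); rewrite cabs1c cabs0; lra.
have cr0 : (1 - c%:C) ^+ r != 0 :> C by rewrite expf_neq0.
rewrite (@truncated_zetaE _ d t)// /zeta_des_approx.
set I := contour_integral_iter _ _; set S := \sum_(m : {ffun _}) _.
rewrite -/(zeta_prefactor _).
have -> : 1 / (1 - c%:C) ^+ r * (\prod_a zeta_prefactor (shifted_point d 0 a)) * I -
    (\prod_a zeta_prefactor (shifted_point d 0 a)) * S =
   (\prod_a zeta_prefactor (shifted_point d 0 a)) *
     ((I - (1 - c%:C) ^+ r * S) / (1 - c%:C) ^+ r).
  by move: (\prod_a _) => P; field.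
rewrite cabsM; apply: ler_pM; rewrite ?cabs_ge0//.
  exact: prod_zeta_prefactor_bound.
apply: le_trans (ler_wpM2l ra0 mb1).
rewrite cabsM cabsV ler_pdivrMr ?cabs_gt0//.
have cc0 := cabs_ge0 ((1 - c%:C) ^+ r).
apply: (@le_trans _ _ ((cabs ((1 - c%:C) ^+ r) * (r%:R * A ^+ r * e)) *
   \prod_a contour_mass t (contour_weight (d - (k a)%:R)))); last first.
  by rewrite le_eqVlt; apply/orP; left; apply/eqP; ring.
apply: contour_integral_iter_approx => //; first by rewrite mulr_ge0.
move=> xs hxs.
have hb := @integrand_sub_bound R t t0 r (fun a => d - (k a)%:R) xs
    (des_factor c) (des_approx N) A e rt hxs A1 e0 hN.
have hH : H_tilde (fun k : 'I_r => contour_point (tnth xs k)) c =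
  (1 - c%:C) ^+ r * \prod_(j < r)
    des_factor c (\sum_(k < r | (j <= k)%N) contour_point (tnth xs k)).
  rewrite /H_tilde -[X in _ ^+ X]card_ord -prodr_const -big_split /=.
  have e1 : (1 - c%:C) * (1 / (1 - c%:C)) = 1 by rewrite div1r mulfV.
  by apply: eq_bigr => j _; rewrite /des_factor [RHS]mulrA e1 [RHS]mul1r.
have hs : \prod_(k0 < r) contour_power (tnth xs k0) (shifted_point d 0 k0 - 1) =
   \prod_a contour_power (tnth xs a) (d - (k a)%:R - 1)%:C.
  by apply: eq_bigr => a _; rewrite shifted_point_sub1.
rewrite hH hs -[X in cabs (X - _)]mulrA -mulrBr cabsM -[leRHS]mulrA ler_wpM2l//.
Qed.

End DesingularizedValue.

(** * Values at the non-positive integers as limits *)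

Section ValueAsLimit.
Local Open Scope classical_set_scope.
Local Open Scope complex_scope.
Local Open Scope ring_scope.
Variable R : realType.
Local Notation C := R[i].
Local Notation weight z := (expR (- (2^-1 * (complex.Re z)))).

Lemma cderiv_ex_sum (I : Type) (s : seq I) (f : I -> R -> C) (x : R) :
  (forall i, exists d, cderiv (f i) x d) ->
  exists d, cderiv (fun t => \sum_(i <- s) f i t) x d.
Proof.
move=> h; elim: s => [|i s [d IH]].
  by exists 0; apply: cderiv_ext (cderiv_cst 0 x) => // t; rewrite big_nil.
have [di hi] := h i; exists (di + d).
by apply: cderiv_ext (cderivD hi IH) => // t; rewrite big_cons.
Qed.

Lemma cderiv_ex_prod (I : Type) (s : seq I) (f : I -> R -> C) (x : R) :
  (forall i, exists d, cderiv (f i) x d) ->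
  exists d, cderiv (fun t => \prod_(i <- s) f i t) x d.
Proof.
move=> h; elim: s => [|i s [d IH]].
  by exists 0; apply: cderiv_ext (cderiv_cst 1 x) => // t; rewrite big_nil.
have [di hi] := h i; eexists.
by apply: cderiv_ext (cderivM hi IH) => // t; rewrite big_cons.
Qed.

Lemma cderiv_dist (f : R -> C) (x : R) : (exists d, cderiv f x d) ->
  forall e, 0 < e -> exists2 b, 0 < b &
    forall t, `|x - t| < b -> cabs (f x - f t) <= e.
Proof.
move=> [d /cderiv_continuous[h1 h2]] e e0.
have e2 : 0 < e / 2 by rewrite divr_gt0.
have /nbhs_ballP[b1 /= b10 hb1] : nbhs x [set t | `|complex.Re (f x) - complex.Re (f t)| < e / 2].
  exact: ((cvgrPdist_lt _ _).1 h1) _ e2.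
have /nbhs_ballP[b2 /= b20 hb2] : nbhs x [set t | `|complex.Im (f x) - complex.Im (f t)| < e / 2].
  exact: ((cvgrPdist_lt _ _).1 h2) _ e2.
exists (Num.min b1 b2); first by rewrite lt_min b10.
move=> t; rewrite lt_min => /andP[t1 t2].
apply: le_trans (cabs_le _) _; rewrite Re_add Im_add Re_opp Im_opp.
have /= q1 := hb1 t t1; have /= q2 := hb2 t t2.
by clear - q1 q2; lra.
Qed.

Variable r : nat.
Variable k : 'I_r -> nat.

Lemma truncated_zeta_dist N e : 0 < e -> exists2 b : R, 0 < b &
  forall d, 0 < d < b -> cabs (truncated_zeta k N 0 - truncated_zeta k N d) <= e.
Proof.
move=> e0; have [|b b0 hb] := @cderiv_dist (truncated_zeta k N) 0 _ e e0.
  apply: cderiv_ex_sum => m.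
  have [|d hd] := @cderiv_ex_prod _ (index_enum 'I_r) (fun a (t : R) =>
     (expR (- ((t - (k a)%:R) * ln (exponent_sum m a)%:R)))%:C : C) 0 _.
    move=> a; set l := ln _.
    have h := cderiv_expC (cderivD (cderivZ (- l)%:C (cderiv_real (is_derive_id (0 : R) 1)))
      (cderiv_cst ((k a)%:R * l)%:C 0)).
    eexists; apply: cderiv_ext h => // t.
    rewrite -expC_real; congr expC; rewrite -real_complexM -real_complexD.
    by congr (_%:C); ring.
  by eexists; exact: cderivZ hd.
exists b => // d /andP[d0 db]; apply: hb.
by rewrite sub0r normrN gtr0_norm.
Qed.

Lemma entire_dist (Z : 'rV[C]_r -> C) e : entire Z -> 0 < e -> exists2 b : R, 0 < b &
  forall d, 0 < d < b -> cabs (Z (shifted_point k 0) - Z (shifted_point k d)) <= e.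
Proof.
move=> hZ e0; have hc := differentiable_continuous (hZ (shifted_point k 0)).
have ec : 0 < e%:C :> C by rewrite ltcR.
have /nbhs_ballP[b /= b0 hb] : nbhs (shifted_point k 0 : 'rV[C^o]_r)
    [set s | `|Z (shifted_point k 0) - Z s| < e%:C].
  exact: ((cvgrPdist_lt _ _).1 hc) _ ec.
have [bi br] : complex.Im b = 0 /\ 0 < complex.Re b.
  by move: b0; rewrite /= ltcE /= => /andP[/eqP -> ->].
exists (complex.Re b) => // d /andP[d0 db].
have hin : ball (shifted_point k 0 : 'rV[C^o]_r) b (shifted_point k d).
  split; first exact: b0.
  move=> i j; rewrite /ball /= !mxE -real_complexN -real_complexD normr_cabs cabs_real.
  have -> : 0 - (k j)%:R - (d - (k j)%:R) = - d by ring.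
  by rewrite normrN gtr0_norm// ltcE /= bi eqxx.
have := hb _ hin; rewrite /= normr_cabs ltcR; exact: ltW.
Qed.

Lemma nonintegral_shifted_point (d : R) : 0 < d < 1 -> nonintegral (shifted_point k d).
Proof.
move=> /andP[d0 d1] a n; apply/eqP; rewrite mxE => /(congr1 (@complex.Re R)).
have -> : complex.Re (n%:~R : C) = n%:~R.
  by rewrite -(rmorph_int (real_complex R)).
rewrite /= => h; have hd : d = (n + (k a)%:Z)%:~R :> R.
  by rewrite intrD -h -pmulrn subrK.
by move: d0 d1; rewrite hd ltr0z -[1](mulr1z 1) ltr_int; lia.
Qed.

(** The approximation is uniform in d because [truncated_zeta_cauchy] works on one
    fixed contour, whereas the contour on which the approximation converges to [Z]
    may shrink with d. *)
Lemma zeta_des_value_limit (Z : 'rV[C]_r -> C) : is_zeta_des Z ->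
  forall e, 0 < e -> exists N0, forall N, (N0 <= N)%N ->
    cabs (Z (shifted_point k 0) - truncated_zeta k N 0) <= e.
Proof.
move=> [entZ hZ] e e0.
have [A A1 hA] := des_factor_approx_uniform R.
have A0 : 0 <= A by apply: le_trans A1.
pose t0 : R := (4 * r.+1%:R)^-1.
have t00 : 0 < t0 by rewrite invr_gt0 mulr_gt0.
have rt t : 0 < t -> t <= t0 -> r%:R * t <= 4^-1.
  move=> tp tt0; apply: (@le_trans _ _ (r.+1%:R * t0)).
    by apply: ler_pM => //; [exact: ltW|rewrite ler_nat].
  by rewrite /t0 invfM mulrCA mulfV ?mulr1.
have pref0 : 0 <= prefactor_bound R k.
  by apply: prodr_ge0 => a _; rewrite mulr_ge0 ?expR_ge0 ?exprn_ge0.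
pose B t := prefactor_bound R k * (r%:R * A ^+ r * mass_bound k t).
have B0 t : 0 < t -> 0 <= B t.
  move=> tp; rewrite /B !mulr_ge0 ?exprn_ge0//.
  have h : 0 < (2^-1 : R) < 1 by apply/andP; split; lra.
  by have /andP[h1 h2] := prod_mass_bound k tp h; apply: le_trans h2.
pose w t : R := e / (8 * (B t + 1)).
have w0 t : 0 < t -> 0 < w t.
  by move=> /B0 h; rewrite divr_gt0// mulr_gt0//; lra.
have wB t : 0 < t -> prefactor_bound R k * (r%:R * A ^+ r * w t * mass_bound k t) <= e / 8.
  move=> tp; have h := B0 _ tp; rewrite /w.
  have -> : prefactor_bound R k * (r%:R * A ^+ r * (e / (8 * (B t + 1))) * mass_bound k t) =
     e / 8 * (B t / (B t + 1)).
    rewrite /B; field; apply/eqP => h'; move: h; rewrite /B; lra.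
  rewrite ler_piMr ?divr_ge0 ?(ltW e0)// ler_pdivrMr; lra.
have [N0 hN0] := des_approx_cauchy hA (w0 _ t00).
exists N0 => N NN0.
(* At -k + d with d > 0 the value of Z is close to the truncation, and N0 does not
   depend on d. *)
have claim d : 0 < d <= 16^-1 ->
    cabs (Z (shifted_point k d) - truncated_zeta k N d) <= e / 2.
  move=> hd; have [d0 d1] := andP hd.
  have hd1 : 0 < d < 1 by apply/andP; split; lra.
  have [t [t1 t2 ht]] : exists t, [/\ 0 < t, t <= t0 &
      zeta_des_approx t c (shifted_point k d) @[c --> (1 : R)^'] -->
        (Z (shifted_point k d) : C^o)].
    have near_t : \forall t \near (0 : R)^'+, [/\ 0 < t, t <= t0 &
        zeta_des_approx t c (shifted_point k d) @[c --> (1 : R)^'] -->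
          (Z (shifted_point k d) : C^o)].
      have hnear := hZ _ (nonintegral_shifted_point hd1).
      near=> t; split.
      - by near: t; exact: nbhs_right_gt.
      - by near: t; exact: nbhs_right_le.
      - by near: t; exact: hnear.
    exact: filter_ex near_t.
  have [M0 hM0] := hA _ (w0 _ t1).
  have [b b0 hb] := hM0 (maxn M0 N0) (leq_maxl _ _).
  have e8 : 0 < (e / 8)%:C :> C by rewrite ltcR divr_gt0.
  have /nbhs_ballP[b' /= b'0 hb'] : nbhs (1 : R) [set c | c != 1 ->
      `|Z (shifted_point k d) - zeta_des_approx t c (shifted_point k d)| < (e / 8)%:C].
    have h0 := (@cvgrPdist_lt _ C^o _ _ _ _ _).1 ht _ e8.
    exact: h0.
  pose m := Num.min b b'.
  have m0 : 0 < m by rewrite lt_min b0.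
  have mb : m <= b by rewrite ge_min lexx.
  have mb' : m <= b' by rewrite ge_min lexx orbT.
  pose c := 1 - m / 2.
  have c1 : c < 1 by rewrite /c; lra.
  have hc : 1 - b < c < 1 by apply/andP; split => //; rewrite /c; lra.
  have hZc : cabs (Z (shifted_point k d) - zeta_des_approx t c (shifted_point k d)) <= e / 8.
    have hin : ball (1 : R) b' c.
      rewrite /ball /= /c opprD opprK addrA subrr add0r gtr0_norm; lra.
    have := hb' c hin; rewrite /= normr_cabs ltcR => h; apply/ltW/h.
    by rewrite lt_eqF.
  have hcl := @zeta_des_approx_close R r k _ A (w t) t d c t1 (rt _ t1 t2) hd A1
    (ltW (w0 _ t1)) c1 (hb c hc).
  have hcy := @truncated_zeta_cauchy R r k _ N A (w t0) t0 d t00 (rt _ t00 (lexx _)) hd A1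
    (ltW (w0 _ t00)) (hN0 _ N (leq_maxr M0 N0) NN0).
  have -> : Z (shifted_point k d) - truncated_zeta k N d =
     (Z (shifted_point k d) - zeta_des_approx t c (shifted_point k d)) +
     (zeta_des_approx t c (shifted_point k d) - truncated_zeta k (maxn M0 N0) d) +
     (truncated_zeta k (maxn M0 N0) d - truncated_zeta k N d) by ring.
  apply: le_trans (cabsD _ _) _; apply: le_trans (lerD (cabsD _ _) (lexx _)) _.
  have := le_trans hcl (wB _ t1); have := le_trans hcy (wB _ t00); lra.
have e4 : 0 < e / 4 by rewrite divr_gt0.
have [b1 b10 hb1] := entire_dist entZ e4.
have [b2 b20 hb2] := truncated_zeta_dist N e4.
pose m : R := Num.min 16^-1 (Num.min b1 b2).
have m0 : 0 < m by rewrite !lt_min b10 b20 invr_gt0 ltr0n.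
have m1 : m <= 16^-1 by rewrite ge_min lexx.
have m2 : m <= b1 by rewrite !ge_min lexx orbT.
have m3 : m <= b2 by rewrite !ge_min lexx !orbT.
have h1 : 0 < m / 2 < b1 by apply/andP; split; lra.
have h2 : 0 < m / 2 < b2 by apply/andP; split; lra.
have h3 : 0 < m / 2 <= 16^-1 by apply/andP; split; lra.
have q1 := hb1 _ h1; have q2 := hb2 _ h2; have q3 := claim _ h3.
have -> : Z (shifted_point k 0) - truncated_zeta k N 0 =
  (Z (shifted_point k 0) - Z (shifted_point k (m / 2))) +
  (Z (shifted_point k (m / 2)) - truncated_zeta k N (m / 2)) -
  (truncated_zeta k N 0 - truncated_zeta k N (m / 2)) by ring.
apply: le_trans (cabsB _ _) _; apply: le_trans (lerD (cabsD _ _) (lexx _)) _.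
lra.
Unshelve. all: by end_near.
Qed.

End ValueAsLimit.

(** * The product formula for multiple power sums *)

Section PowerSums.
Variable R : realType.
Local Notation C := R[i].
Local Open Scope complex_scope.
Local Open Scope ring_scope.

(** A finite multiple zeta sum at the exponents -k_a over the partial sums of the
    positive integers m_j + 1, each of which is weighted by b (m_j). *)
Definition multi_power_sum n (b : 'I_n -> C) r (k : 'I_r -> nat) : C :=
  \sum_(m : {ffun 'I_r -> 'I_n}) (\prod_j b (m j)) *
    \prod_a (exponent_sum m a)%:R ^+ k a.

Lemma truncated_zeta0 r (k : 'I_r -> nat) N :
  truncated_zeta k N 0 =
  multi_power_sum (fun i : 'I_(size (des_poly R N)) => (des_poly R N)`_i) k.
Proof.
apply: eq_bigr => m _; congr (_ * _); apply: eq_bigr => a _.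
rewrite sub0r mulNr opprK expRM_natl lnK ?posrE ?ltr0n ?exponent_sum_gt0//.
by rewrite real_complexX real_complex_nat.
Qed.

Lemma exponent_sum_lshift p q n (m : {ffun 'I_(p + q) -> 'I_n}) (a : 'I_p) :
  exponent_sum m (lshift q a) = exponent_sum [ffun j : 'I_p => m (lshift q j)] a.
Proof.
rewrite /exponent_sum big_split_ord /= [X in (_ + X)%N]big1 ?addn0; last first.
  by move=> j; rewrite leqNgt ltn_addr.
by apply: eq_bigr => j _; rewrite ffunE.
Qed.

Lemma exponent_sum_rshift p q n (m : {ffun 'I_(p.+1 + q) -> 'I_n}) (b : 'I_q) :
  exponent_sum m (rshift p.+1 b) =
  (exponent_sum [ffun j : 'I_p.+1 => m (lshift q j)] ord_max +
   exponent_sum [ffun j : 'I_q => m (rshift p.+1 j)] b)%N.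
Proof.
rewrite /exponent_sum big_split_ord /=; congr (_ + _)%N.
  apply: eq_big => [j|j _]; last by rewrite ffunE.
  by rewrite (leq_trans (ltnW (ltn_ord j)) (leq_addr _ _)) -ltnS ltn_ord.
by apply: eq_big => [j|j _]; rewrite ?leq_add2l// ffunE.
Qed.

Lemma multi_index_split p q n (F : {ffun 'I_p -> 'I_n} -> {ffun 'I_q -> 'I_n} -> C) :
  \sum_(m : {ffun 'I_(p + q) -> 'I_n})
    F [ffun j => m (lshift q j)] [ffun j => m (rshift p j)] =
  \sum_m1 \sum_m2 F m1 m2.
Proof.
pose cat (u : {ffun 'I_p -> 'I_n} * {ffun 'I_q -> 'I_n}) : {ffun 'I_(p + q) -> 'I_n} :=
  [ffun i => match fintype.split i with inl a => u.1 a | inr b => u.2 b end].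
rewrite pair_bigA /= (reindex cat) /=.
  apply: eq_bigr => -[m1 m2] _ /=; congr F; apply/ffunP => j; rewrite !ffunE /=.
    by rewrite (unsplitK (inl _ j)).
  by rewrite (unsplitK (inr _ j)).
exists (fun m => ([ffun j => m (lshift q j)], [ffun j => m (rshift p j)])).
  move=> [m1 m2] _; congr pair; apply/ffunP => j; rewrite !ffunE /=.
    by rewrite (unsplitK (inl _ j)).
  by rewrite (unsplitK (inr _ j)).
move=> m _; apply/ffunP => i; rewrite !ffunE -[in RHS](splitK i).
by case: (fintype.split i) => j /=; rewrite ffunE.
Qed.

Lemma binomial_pairs L l (x y : C) : (l < L)%N ->
  \sum_(i < L) \sum_(j < L) (if (i + j == l)%N then
     (-1) ^+ i * ('C(l, i))%:R * x ^+ i * y ^+ j else 0) = (y - x) ^+ l.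
Proof.
move=> lL; rewrite exprBn (big_ord_widen L (fun i : nat =>
  ((-1) ^+ i * y ^+ (l - i) * x ^+ i) *+ 'C(l, i)))// [RHS]big_mkcond /=.
apply: eq_bigr => i _; rewrite ltnS; have [il|li] := leqP i l; last first.
  by rewrite big1// => j _; rewrite gtn_eqF// ltn_addr.
have hj : (l - i < L)%N by rewrite (leq_ltn_trans (leq_subr _ _)).
rewrite (bigD1 (Ordinal hj))//= subnKC// eqxx big1 ?addr0.
  by rewrite -[in RHS]mulr_natr; ring.
move=> j /eqP jn; case: eqP => // h; case: jn; apply/val_inj => /=.
by rewrite -h addKn.
Qed.

(** Up to sign, the arguments on the right-hand side of the product formula. *)
Definition joint_exponents p q L (k : 'I_p -> nat) (i j : {ffun 'I_q -> 'I_L})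
    (c : 'I_(p + q)) : nat :=
  match fintype.split c with
  | inl a => (k a + (if a.+1 == p then \sum_(b < q) i b else 0))%N
  | inr b => j b
  end.

(** With A the last partial sum of the first multi-index and B_b those of the second,
    the partial sums of the concatenated index are A + B_b, and the identity is
    B_b^l = ((A + B_b) - A)^l expanded by the binomial theorem. *)
Lemma multi_power_sum_mul n (b : 'I_n -> C) p q (k : 'I_p -> nat) (l : 'I_q -> nat) L :
  (0 < p)%N -> (forall a, (l a < L)%N) ->
  multi_power_sum b k * multi_power_sum b l =
  \sum_(ij : {ffun 'I_q -> 'I_L} * {ffun 'I_q -> 'I_L}
          | [forall a, (ij.1 a + ij.2 a == l a)%N])
    (\prod_(a < q) ((-1) ^+ (ij.1 a) * ('C(l a, ij.1 a))%:R)) *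
    multi_power_sum b (joint_exponents k ij.1 ij.2).
Proof.
case: p k => // p k _ hl.
pose la (m1 : {ffun 'I_p.+1 -> 'I_n}) : C := (exponent_sum m1 ord_max)%:R.
pose mu (m2 : {ffun 'I_q -> 'I_n}) a : C := (exponent_sum m2 a)%:R.
pose W1 (m1 : {ffun 'I_p.+1 -> 'I_n}) : C :=
  (\prod_j b (m1 j)) * \prod_a (exponent_sum m1 a)%:R ^+ k a.
pose W2 (m2 : {ffun 'I_q -> 'I_n}) : C := \prod_j b (m2 j).
have inner (ij : {ffun 'I_q -> 'I_L} * {ffun 'I_q -> 'I_L}) :
  multi_power_sum b (joint_exponents k ij.1 ij.2) =
  \sum_m1 \sum_m2 W1 m1 * W2 m2 *
     \prod_a (la m1 ^+ ij.1 a * (la m1 + mu m2 a) ^+ ij.2 a).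
  rewrite -multi_index_split; apply: eq_bigr => m _.
  set m1 := [ffun j : 'I_p.+1 => _]; set m2 := [ffun j : 'I_q => _].
  have e1 : \prod_j b (m j) = (\prod_j b (m1 j)) * \prod_j b (m2 j).
    by rewrite big_split_ord; congr (_ * _); apply: eq_bigr => j _; rewrite ffunE.
  have e2 : \prod_(a < p.+1) (if a == ord_max then la m1 ^+ (\sum_(c < q) ij.1 c)%N else 1) =
      \prod_a la m1 ^+ ij.1 a.
    rewrite (bigD1 ord_max)//= eqxx [X in _ * X]big1 ?mulr1 ?prodrXr// => a.
    by move=> /negbTE ->.
  rewrite e1 big_split_ord /W1 /W2.
  rewrite [X in _ * (X * _)](eq_bigr (fun a => (exponent_sum m1 a)%:R ^+ k a *
     (if a == ord_max then la m1 ^+ (\sum_(c < q) ij.1 c)%N else 1))); last first.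
    move=> a _; rewrite /joint_exponents (unsplitK (inl _ a)) exponent_sum_lshift exprD; congr (_ * _).
    rewrite eqSS -(inj_eq val_inj) /=; case: eqP => [h|_]; last by rewrite expr0.
    by rewrite /la; congr ((exponent_sum _ _)%:R ^+ _); apply: val_inj.
  rewrite [X in _ * (_ * X)](eq_bigr (fun a => (la m1 + mu m2 a) ^+ ij.2 a)); last first.
    by move=> a _; rewrite /joint_exponents (unsplitK (inr _ a)) exponent_sum_rshift natrD.
  have e3 : \prod_(a < p.+1) ((exponent_sum m1 a)%:R ^+ k a *
      (if a == ord_max then la m1 ^+ (\sum_(c < q) ij.1 c)%N else 1)) =
     (\prod_a (exponent_sum m1 a)%:R ^+ k a) * \prod_a la m1 ^+ ij.1 a.
    by rewrite -e2; exact: big_split.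
  have e4 : \prod_a (la m1 ^+ ij.1 a * (la m1 + mu m2 a) ^+ ij.2 a) =
     (\prod_a la m1 ^+ ij.1 a) * \prod_a (la m1 + mu m2 a) ^+ ij.2 a by exact: big_split.
  by rewrite e3 e4; ring.
transitivity (\sum_m1 \sum_m2 W1 m1 * W2 m2 * \prod_a ((la m1 + mu m2 a) - la m1) ^+ l a).
  rewrite /multi_power_sum mulr_suml; apply: eq_bigr => m1 _.
  rewrite mulr_sumr; apply: eq_bigr => m2 _; rewrite -[RHS]mulrA; congr (_ * (_ * _)).
  by apply: eq_bigr => a _; rewrite addrAC subrr add0r.
transitivity (\sum_m1 \sum_m2
  \sum_(ij : {ffun 'I_q -> 'I_L} * {ffun 'I_q -> 'I_L}
          | [forall a, (ij.1 a + ij.2 a == l a)%N])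
    (\prod_(a < q) ((-1) ^+ (ij.1 a) * ('C(l a, ij.1 a))%:R)) *
    (W1 m1 * W2 m2 * \prod_a (la m1 ^+ ij.1 a * (la m1 + mu m2 a) ^+ ij.2 a))); last first.
  under eq_bigr do rewrite exchange_big /=.
  rewrite exchange_big /=; apply: eq_bigr => ij _.
  rewrite inner mulr_sumr; apply: eq_bigr => m1 _.
  by rewrite mulr_sumr.
apply: eq_bigr => m1 _; apply: eq_bigr => m2 _.
rewrite (eq_bigr (fun a => \sum_(i < L) \sum_(j < L) (if (i + j == l a)%N then
     (-1) ^+ i * ('C(l a, i))%:R * la m1 ^+ i * (la m1 + mu m2 a) ^+ j else 0))); last first.
  by move=> a _; rewrite binomial_pairs.
rewrite bigA_distr_bigA /=.
rewrite (eq_bigr (fun f : {ffun 'I_q -> 'I_L} => \sum_(g : {ffun 'I_q -> 'I_L})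
  \prod_a (if (f a + g a == l a)%N then
     (-1) ^+ f a * ('C(l a, f a))%:R * la m1 ^+ f a * (la m1 + mu m2 a) ^+ g a else 0))); last first.
  by move=> f _; rewrite bigA_distr_bigA.
rewrite pair_bigA /= mulr_sumr [RHS]big_mkcond /=; apply: eq_bigr => -[f g] _ /=.
case: ifPn => [/forallP h|/forallPn[a ha]].
  rewrite mulrCA -big_split /=; congr (_ * _); apply: eq_bigr => a _.
  by rewrite h !mulrA.
by rewrite (bigD1 a)//= (negbTE ha) mul0r mulr0.
Qed.

End PowerSums.

(** * The product formula for desingularized values *)

Section Limits.
Local Open Scope classical_set_scope.
Local Open Scope ring_scope.
Variable R : realType.
Local Notation C := R[i].

Lemma truncated_zeta_cvg r (k : 'I_r -> nat) (Z : 'rV[C]_r -> C) : is_zeta_des Z ->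
  (fun N => truncated_zeta k N 0 : C^o) @ \oo --> (Z (shifted_point k 0) : C^o).
Proof.
move=> hZ; apply/cvgrPdist_le => e e0.
have [ei er] : complex.Im e = 0 /\ 0 < complex.Re e.
  by move: e0; rewrite ltcE /= => /andP[/eqP -> ->].
have [N0 hN] := zeta_des_value_limit k hZ er.
exists N0 => // N /= /hN h; rewrite normr_cabs lecE /= ei eqxx.
exact: h.
Qed.

Lemma zeta_des_value_mul (zeta_des : forall r : nat, 'rV[C]_r -> C) :
  (forall r : nat, (0 < r)%N -> is_zeta_des (zeta_des r)) ->
  forall (p q : nat) (k : 'I_p -> nat) (l : 'I_q -> nat) L,
  (0 < p)%N -> (0 < q)%N -> (forall a, (l a < L)%N) ->
  zeta_des p (shifted_point k 0) * zeta_des q (shifted_point l 0) =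
  \sum_(ij : {ffun 'I_q -> 'I_L} * {ffun 'I_q -> 'I_L}
          | [forall b, (ij.1 b + ij.2 b == l b)%N])
      (\prod_(b < q) ((-1) ^+ (ij.1 b) * ('C(l b, ij.1 b))%:R)) *
      zeta_des (p + q)%N (shifted_point (joint_exponents k ij.1 ij.2) 0).
Proof.
move=> hZ p q k l L hp hq hl.
have hpq : (0 < p + q)%N by rewrite addn_gt0 hp.
have c1 := @truncated_zeta_cvg p k _ (hZ _ hp).
have c2 := @truncated_zeta_cvg q l _ (hZ _ hq).
have c3 (K : 'I_(p + q) -> nat) := @truncated_zeta_cvg _ K _ (hZ _ hpq).
have lim1 := cvgM c1 c2.
have lim2 : (fun N => \sum_(ij : {ffun 'I_q -> 'I_L} * {ffun 'I_q -> 'I_L}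
          | [forall b, (ij.1 b + ij.2 b == l b)%N])
      (\prod_(b < q) ((-1) ^+ (ij.1 b) * ('C(l b, ij.1 b))%:R)) *
      truncated_zeta (joint_exponents k ij.1 ij.2) N 0 : C^o) @ \oo -->
    (\sum_(ij : {ffun 'I_q -> 'I_L} * {ffun 'I_q -> 'I_L}
          | [forall b, (ij.1 b + ij.2 b == l b)%N])
      (\prod_(b < q) ((-1) ^+ (ij.1 b) * ('C(l b, ij.1 b))%:R)) *
      zeta_des (p + q)%N (shifted_point (joint_exponents k ij.1 ij.2) 0) : C^o).
  apply: cvg_big => [|ij _]; first exact: add_continuous.
  exact: cvgMr (c3 _).
have eN : (fun N => truncated_zeta k N 0 * truncated_zeta l N 0 : C^o) =
   (fun N => \sum_(ij : {ffun 'I_q -> 'I_L} * {ffun 'I_q -> 'I_L}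
          | [forall b, (ij.1 b + ij.2 b == l b)%N])
      (\prod_(b < q) ((-1) ^+ (ij.1 b) * ('C(l b, ij.1 b))%:R)) *
      truncated_zeta (joint_exponents k ij.1 ij.2) N 0).
  apply/funext => N; rewrite !truncated_zeta0 (@multi_power_sum_mul _ _ _ _ _ k l L hp hl).
  by apply: eq_bigr => ij _; rewrite truncated_zeta0.
apply: (cvg_unique (@norm_hausdorff _ C^o) _ lim2).
by rewrite -eN; exact: lim1.
Qed.

End Limits.

Theorem theorem3p3 (R : realType)
    (zeta_des : forall r : nat, 'rV[R[i]]_r -> R[i])
    (zeta_desP : forall r : nat, (0 < r)%N -> is_zeta_des (zeta_des r))
    (p q : nat) (hp : (0 < p)%N) (hq : (0 < q)%N)
    (k : 'I_p -> nat) (l : 'I_q -> nat) :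
  zeta_des p (\row_(a < p) - (k a)%:R) * zeta_des q (\row_(b < q) - (l b)%:R)
  = \sum_(ij : {ffun 'I_q -> 'I_(\max_(b < q) l b).+1}
               * {ffun 'I_q -> 'I_(\max_(b < q) l b).+1}
          | [forall b, (ij.1 b + ij.2 b == l b)%N])
      (\prod_(b < q) ((-1) ^+ (ij.1 b) * ('C(l b, ij.1 b))%:R))
      * zeta_des (p + q)%N
          (row_mx
             (\row_(a < p)
                (- (k a)%:R
                 - (if (a.+1 == p)%N then \sum_(b < q) (ij.1 b)%:R else 0)))
             (\row_(b < q) - (ij.2 b)%:R)).
Proof.
have pointE r (f : 'I_r -> nat) : \row_(a < r) - (f a)%:R = shifted_point f 0 :> 'rV[R[i]]_r.
  by apply/rowP => a; rewrite !mxE sub0r real_complexN real_complex_nat.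
have hl b : (l b < (\max_(b < q) l b).+1)%N by rewrite ltnS leq_bigmax.
rewrite !pointE (zeta_des_value_mul zeta_desP k hp hq hl).
apply: eq_bigr => ij _; congr (_ * zeta_des _ _).
rewrite -pointE; apply/rowP => c; rewrite -(splitK c) !mxE /joint_exponents unsplitK.
case: (fintype.split c) => a; rewrite !mxE//.
rewrite natrD opprD; congr (_ - _); case: ifP => // _.
by rewrite natr_sum.
Qed.
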